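(* Let $p\ge2$, $\theta,\gamma\in\mathbb{R}$, $\gamma\ne0$, $\lambda=\theta+\mathrm{i}\gamma$, and assume $0<|m(\lambda)|<m(\theta)<\infty$. (i) If $\theta\ne0$, the martingale $(Z_n(\lambda))_{n\in\mathbb{N}_0}$ converges in $L^p$ if, and only if, $$\mathbb{E}|Z_1(\lambda)|^p<\infty,\qquad \max\left(\frac{m(2\theta)}{|m(\lambda)|^2},\frac{m(p\theta)}{|m(\lambda)|^p}\right)<1,$$ and, when $p>2$, $\mathbb{E}[Z_1(2\theta)]^{p/2}<\infty$. (ii) If $\theta=0$, the martingale $(Z_n(\lambda))_{n\in\mathbb{N}_0}$ converges in $L^p$ if, and only if, $$\mathbb{E}|Z_1(\lambda)|^p<\infty,\qquad \mathbb{E}[Z_1(0)]^{p/2}<\infty,\qquad \frac{m(0)}{|m(\lambda)|^2}<1 .$$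
   Context: Branching random walk. Let $\mathcal{M}=\sum_{i=1}^{J}\delta_{X_i}$ be a random point process on $\mathbb{R}$, where $J=\mathcal{M}(\mathbb{R})$ takes values in $\{0,1,2,\ldots\}\cup\{\infty\}$; no assumption is made on the dependence between $J,X_1,X_2,\ldots$. Let $\mathbb{V}=\bigcup_{n\ge0}\mathbb{N}^n$ and let $(\mathcal{M}(u))_{u\in\mathbb{V}}$, $\mathcal{M}(u)=\sum_{i=1}^{J(u)}\delta_{X_i(u)}$, be i.i.d. copies of $\mathcal{M}$. The ancestor $\varnothing$ is at position $S(\varnothing)=0$; each individual $u$ of generation $n$ has offspring $ui$ ($1\le i\le J(u)$, or $i\in\mathbb{N}$ if $J(u)=\infty$) in generation $n+1$, at positions $S(ui)=S(u)+X_i(u)$. Sums $\sum_{|u|=n}$ run over all individuals of the $n$th generation actually born. Standing assumption (supercriticality): $\mathbb{E}J>1$. For $\lambda\in\mathbb{C}$ with real part $\theta$ set $m(\lambda):=\mathbb{E}\sum_{|u|=1}e^{-\lambda S(u)}$ whenever this converges absolutely, i.e. whenever $m(\theta)<\infty$. For real $\theta$, $m(\theta)\in(0,\infty]$ is always defined, and an inequality such as $m(2\theta)/|m(\lambda)|^2<1$ includes the requirement $m(2\theta)<\infty$. If $m(\theta)<\infty$ and $m(\lambda)\ne0$, the Biggins martingale is $$Z_n(\lambda):=\frac{1}{m(\lambda)^n}\sum_{|u|=n}e^{-\lambda S(u)},\qquad n\in\mathbb{N}_0,$$ a mean-one (complex-valued) martingale with respect to $\mathcal{F}_n=\sigma(\mathcal{M}(u):u\in\bigcup_{k=0}^{n-1}\mathbb{N}^k)$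 ($\mathcal{F}_0$ trivial).
   Formalization: Adds the assumption that Z_1(λ) is not almost surely equal to 1; without it ''only if'' fails, e.g. for deterministic M = δ_0 + δ_1, θ = 0, γ = 3, p = 2, where Z_n(λ) = 1 for all n but m(0)/|m(λ)|² > 1. *)

(* Defs.v *)
From HB Require Import structures.
From mathcomp Require Import all_boot all_order all_algebra.
From mathcomp Require Import all_classical all_reals all_analysis.
From mathcomp Require Import measurable_realfun complex.

Set Implicit Arguments.
Unset Strict Implicit.
Unset Printing Implicit Defensive.

Import Order.TTheory GRing.Theory Num.Theory.
Import numFieldNormedType.Exports.

#[global] Open Scope classical_set_scope.
#[global] Open Scope ring_scope.

(* Complex numbers are R[i]; their modulus as an element of R. *)
Notation modulus := ComplexField.Normc.normc.

Definition expC (R : realType) (z : R[i]) : R[i] :=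
  Complex (expR (complex.Re z) * cos (complex.Im z))
          (expR (complex.Re z) * sin (complex.Im z)).

(* Unordered sums over arbitrary index sets: the sum of the positive parts minus
   that of the negative parts.  Only meaningful for absolutely convergent
   families; [fine] sends +oo to 0. *)
Definition sumR (I : choiceType) (R : realType) (D : set I) (f : I -> R) : R :=
  fine (\esum_(i in D) (Num.max (f i) 0)%:E)
  - fine (\esum_(i in D) (Num.max (- f i) 0)%:E).

Definition sumC (I : choiceType) (R : realType) (D : set I) (f : I -> R[i]) :
    R[i] :=
  Complex (sumR D (fun i => complex.Re (f i)))
          (sumR D (fun i => complex.Im (f i))).

Definition expectationC d (T : measurableType d) (R : realType)
    (P : probability T R) (Y : T -> R[i]) : R[i] :=
  Complex (fine 'E_P[fun w => complex.Re (Y w)])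
          (fine 'E_P[fun w => complex.Im (Y w)]).

Definition moment d (T : measurableType d) (R : realType) (P : probability T R)
    (p : R) (Y : T -> R) : \bar R :=
  ('E_P[fun w => (Y w `^ p)%R])%E.

Definition normLp d (T : measurableType d) (R : realType) (P : probability T R)
    (p : R) (Y : T -> R[i]) : \bar R :=
  'N[P]_p%:E [EFin \o (fun w => modulus (Y w))]%E.

Definition cvg_Lp d (T : measurableType d) (R : realType) (P : probability T R)
    (p : R) (Y : nat -> T -> R[i]) : Prop :=
  (forall n, (normLp P p (Y n) < +oo)%E) /\
  exists Yoo : T -> R[i],
    [/\ measurable_fun setT (fun w => complex.Re (Yoo w)),
        measurable_fun setT (fun w => complex.Im (Yoo w)),
        (normLp P p Yoo < +oo)%E &
        normLp P p (fun w => Y n w - Yoo w) @[n --> \oo] --> 0%E].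

Definition independent d (T : measurableType d) (R : realType)
    (P : probability T R) (I : eqType) (G : I -> set (set T)) : Prop :=
  forall (s : seq I) (A : I -> set T),
    uniq s -> (forall i, i \in s -> G i (A i)) ->
    P (\big[setI/setT]_(i <- s) A i) = (\prod_(i <- s) P (A i))%E.

(* The individuals are the words over nat (children are numbered from 0).
   [None] encodes an infinite number of children.  The values [X u i w] for
   [i] beyond [J u w] are irrelevant. *)
Record reproduction (T : Type) (R : realType) := Reproduction {
  J : seq nat -> T -> option nat;
  X : seq nat -> nat -> T -> R }.

Section BranchingRandomWalk.
Context d (T : measurableType d) (R : realType) (P : probability T R).
Context (M : reproduction T R).
Implicit Types (u : seq nat) (w : T) (theta : R) (lambda : R[i]).

Definition has_child u (i : nat) w : bool :=
  if J M u w is Some k then (i < k)%N else true.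

Definition J_ereal u w : \bar R :=
  if J M u w is Some k then (k%:R)%:E else +oo%E.

Definition point_process u w : {measure set R -> \bar R} :=
  mseries (fun i => if has_child u i w
                    then \d_(X M u i w) : {measure set _ -> \bar R}
                    else mzero) 0.

Definition child_event u (i : nat) (B : set R) : set T :=
  [set w | has_child u i w /\ B (X M u i w)].

(* The sigma-algebra generated by J(u) and by the X_i(u) with i <= J(u) (note
   that [J u] exceeds [i] exactly on [child_event u i setT]). *)
Definition sigma_reproduction u : set (set T) :=
  <<s [set E | exists i B, measurable B /\ E = child_event u i B] >>.

(* The usual sigma-algebra on measures, generated by the evaluation maps. *)
Definition sigma_measures :
    set (set {measure set R -> \bar R}) :=
  <<s [set E | exists (B : set R) (C : set (\bar R)),
         [/\ measurable B, measurable C &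
             E = [set mu : {measure set R -> \bar R} | C (mu B)]] ] >>.

Definition same_point_process_law u v : Prop :=
  forall E, sigma_measures E ->
    P (point_process u @^-1` E) = P (point_process v @^-1` E).

(* The independence is that of the families (J(u), X_1(u), X_2(u), ...), not just
   of the point processes: otherwise the numbering of the children of u could
   depend on the reproduction of their descendants.  The equality in law is only
   required for the point processes. *)
Record supercritical_brw : Prop := SupercriticalBRW {
  brw_measurable : forall u i (B : set R),
    measurable B -> measurable (child_event u i B);
  brw_independent : independent P sigma_reproduction;
  brw_identically_distributed : forall u, same_point_process_law u [::];
  brw_supercritical : (1 < \int[P]_w J_ereal [::] w)%E }.

Definition born u w : Prop :=
  forall k, (k < size u)%N -> has_child (take k u) (nth 0%N u k) w.

Definition position u w : R :=
  \sum_(k < size u) X M (take k u) (nth 0%N u k) w.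

Lemma position_rcons u i w : position (rcons u i) w = position u w + X M u i w.
Proof.
rewrite /position size_rcons big_ord_recr /= nth_rcons ltnn eqxx.
rewrite -cats1 take_size_cat//; congr (_ + _); apply: eq_bigr => k _.
by rewrite nth_cat ltn_ord takel_cat// ltnW.
Qed.

Lemma born_rcons u i w : born (rcons u i) w <-> born u w /\ has_child u i w.
Proof.
rewrite /born size_rcons -cats1; split=> [h|[h hi] k].
  split=> [k ku|]; last first.
    by have := h (size u) (ltnSn _); rewrite take_size_cat// nth_cat ltnn subnn.
  by have := h k (ltnW ku); rewrite nth_cat ku takel_cat// ltnW.
rewrite ltnS leq_eqVlt => /predU1P[->|ku].
  by rewrite take_size_cat// nth_cat ltnn subnn.
by rewrite nth_cat ku takel_cat ?(ltnW ku)//; exact: h.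
Qed.

Definition generation (n : nat) w : set (seq nat) :=
  [set u | size u = n /\ born u w].

Definition mreal theta : \bar R :=
  \int[P]_w \esum_(u in generation 1 w) (expR (- theta * position u w))%:E.

(* Meaningful only when [mreal (complex.Re lambda)] is finite. *)
Definition m lambda : R[i] :=
  expectationC P (fun w =>
    sumC (generation 1 w) (fun u => expC (- lambda * (position u w)%:C%C))).

Definition Z (n : nat) lambda w : R[i] :=
  sumC (generation n w) (fun u => expC (- lambda * (position u w)%:C%C))
    / m lambda ^+ n.

(* Z_1(lambda) = 1 a.s.; then Z_n(lambda) = 1 a.s. for all n, whatever the size
   of |m(lambda)|.  This happens for instance if the reproduction is
   deterministic. *)
Definition trivial_martingale lambda : Prop :=
  {ae P, forall w, Z 1 lambda w = 1}.

End BranchingRandomWalk.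

(* Main.v *)
(* The increment Z_{n+1} - Z_n is a sum over the n-th generation of independent
   centred copies of Z_1 - 1, weighted by w_u = e^(-lambda S(u)) / m(lambda)^n.
   Conditionally on the first n generations, its p-th absolute moment is, up to
   constants, Y_n^(p/2) with Y_n = sum_u |w_u|^2: the upper bound uses
   E|Z_1|^p < oo, the lower one that Z_1 is not degenerate.  Hence L^p convergence
   amounts to the decay of E Y_n^(p/2).

   Put w(r) = m(r theta) / |m(lambda)|^r.  Since E Y_n = w(2)^n and
   Y_n^(p/2) >= sum_u |w_u|^p, whose mean is w(p)^n, decay forces w(2) < 1 and
   w(p) < 1.  Conversely Y_{n+1} = sum_u |w_u|^2 eta_u with independent copies
   eta_u of Y_1, so that E Y_{n+1}^(p/2) <= rho^(p/2) E Y_n^(p/2) + C w(p)^n for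
   every rho > w(2), and E Y_n^(p/2) decays geometrically.

   Finally Y_1 is a constant multiple of Z_1(2 theta).  If p = 2, its (p/2)-th
   moment is w(2); if theta = 0, supercriticality and w(2) < 1 give
   |m(lambda)| > 1, hence w(p) <= w(2) < 1. *)

Require Import Defs.
From HB Require Import structures.
From mathcomp Require Import all_boot all_order all_algebra.
From mathcomp Require Import all_classical all_reals all_analysis.
From mathcomp Require Import measurable_realfun complex.
From mathcomp Require Import ring lra.

Set Implicit Arguments.
Unset Strict Implicit.
Unset Printing Implicit Defensive.

Import Order.TTheory GRing.Theory Num.Theory.
Import numFieldNormedType.Exports.


(** * Elementary inequalities for powers *)

Section power_inequalities.
Local Open Scope ring_scope.
Context (R : realType).
Implicit Types q x y v t : R.

(** Conditioning on the first generations is never expressed by conditional expectations: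
    reproductions attached to disjoint sets of words are independent, so one set is frozen while the
    other is integrated ([ge0_integral_freeze]). To this end every sum ranges over the fixed
    countable set of all words, with weight 0 outside the generation. Generations may be infinite
    and p/2 is an arbitrary real, so the moment bounds are proved for finite sums and carried to
    series by Fatou's lemma. Both upper bounds integrate out one summand at a time; a pointwise
    inequality absorbs the error into a running total of the weights already integrated. Equality in
    law is available only for point processes, so a quantity attached to a word is transported to
    the root by writing it as a functional of its point process. In the necessity direction,
    convergence yields just one n with E Y_n^(p/2) < 1. This suffices, since w(2) >= 1 or w(p) >= 1
    would give E Y_n^(p/2) >= 1 for every n. Finiteness of E Y_1^(p/2) comes from the increment Z_2
    - Z_1. *)

Lemma expR_le_quad y : y <= 2^-1 -> expR y <= 1 + y + 2 * y ^+ 2.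
Proof.
move=> y2; have h : 1 - y <= expR (- y) by rewrite expR_ge1Dx.
have y1 : 0 < 1 - y by lra.
rewrite -[expR y]invrK -expRN; apply: (@le_trans _ _ (1 - y)^-1).
  by rewrite lef_pV2 ?posrE ?expR_gt0.
(* (1 - y)(1 + y + 2y^2) = 1 + y^2 (1 - 2y) >= 1. *)
rewrite -(ler_pM2l y1) mulfV ?gt_eqF//; nra.
Qed.

Lemma powR_le_expR q v : 0 <= q -> -1 <= v -> (1 + v) `^ q <= expR (q * v).
Proof.
move=> q0 v1; rewrite mulrC expRM; apply: ge0_ler_powR => //.
- by rewrite nnegrE; lra.
- by rewrite nnegrE expR_ge0.
- exact: expR_ge1Dx.
Qed.

(* Young's inequality [x v^(q-1) <= x^q / q + v^q (q-1) / q]. *)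
Lemma powR_tangent q x v : 1 <= q -> 0 <= x -> 0 <= v ->
  v `^ q + q * v `^ (q - 1) * (x - v) <= x `^ q.
Proof.
move=> q1 x0 v0; have q0 : 0 < q by lra.
have [->|qn1] := eqVneq q 1; first by rewrite !powRr1// subrr powRr0; lra.
have q1' : 0 < q - 1 by rewrite lt_neqAle eq_sym subr_eq0 qn1/=; lra.
have h : x * v `^ (q - 1) <= x `^ q / q + v `^ q * ((q - 1) / q).
  have := @conjugate_powR _ x (v `^ (q - 1)) q (q / (q - 1)) x0
    (powR_ge0 _ _) q0 (divr_gt0 q0 q1').
  rewrite -powRrM mulrCA divff ?gt_eqF// mulr1 invf_div; apply.
  by field; rewrite gt_eqF.
have {}h : q * (x * v `^ (q - 1)) <= x `^ q + v `^ q * (q - 1).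
  rewrite -(ler_pM2l q0) in h; apply: (le_trans h).
  by rewrite le_eqVlt; apply/orP; left; apply/eqP; field; rewrite gt_eqF.
have e := @mulr_powRB1 _ v q v0 q0.
by nra.
Qed.

(** Since x^q = x x^(q-1), it is enough that x^(q-1) and y^(q-1) are at most (x + y)^(q-1). *)
Lemma powR_superadditive q x y : 1 <= q -> 0 <= x -> 0 <= y ->
  x `^ q + y `^ q <= (x + y) `^ q.
Proof.
move=> q1 x0 y0; have q0 : 0 < q by lra.
rewrite -(mulr_powRB1 x0 q0) -(mulr_powRB1 y0 q0).
rewrite -(mulr_powRB1 (addr_ge0 x0 y0) q0) mulrDl.
apply: lerD; apply: ler_wpM2l => //;
  apply: ge0_ler_powR; rewrite ?nnegrE; lra.
Qed.

Lemma powR_sumr_le (I : eqType) (s : seq I) (F : I -> R) q : 1 <= q ->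
  (forall i, 0 <= F i) ->
  \sum_(i <- s) (F i) `^ q <= (\sum_(i <- s) F i) `^ q.
Proof.
move=> q1 F0; elim: s => [|i s IH]; first by rewrite !big_nil powR_ge0.
rewrite !big_cons; apply: le_trans (powR_superadditive q1 _ _) => //.
  by rewrite lerD2l.
by apply: sumr_ge0.
Qed.

(** Models |x + y|^2 with |x| = 1: c is the inner product of x and y, s = |y|^2, and c^2 <= s is the
    Cauchy-Schwarz inequality. The term linear in c is kept exact, because it will integrate to 0;
    only the remainder is estimated. *)
Lemma powR_sqr_dev1 q : 1 <= q -> exists2 C, 1 <= C & forall c s, c ^+ 2 <= s ->
  (1 + 2 * c + s) `^ q <= 1 + 2 * q * c + C * (s + s `^ q).
Proof.
move=> q1; have q0 : 0 <= q by lra.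
have p4 : 1 <= 4 `^ q :> R.
  have h4 : 1 <= 4 :> R by lra.
  by have := ler_powR h4 q0; rewrite powRr0.
(* For s <= 1, v = 2c + s satisfies v^2 <= 10 s. The summand 40 q^2 covers the quadratic term of the
   exponential bound when q v <= 1/2; the product with 4^q covers the case q v > 1/2. *)
exists (4 `^ q * (40 * q ^+ 2) + 40 * q ^+ 2) => [|c s cs]; first by nra.
have s0 : 0 <= s by apply: le_trans cs; exact: sqr_ge0.
have sq0 : 0 <= s `^ q by exact: powR_ge0.
have v1 : -1 <= 2 * c + s by have := sqr_ge0 (c + 1); nra.
have [s1|s1] := leP s 1.
  have v10 : (2 * c + s) ^+ 2 <= 10 * s by have := sqr_ge0 (2 * c - s); nra.
  have Cs : 0 <= 4 `^ q * (40 * q ^+ 2) by rewrite !mulr_ge0 ?powR_ge0 ?sqr_ge0//; lra.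
  have [h|h] := leP (q * (2 * c + s)) 2^-1.
    rewrite -addrA; apply: (le_trans (powR_le_expR q0 v1)).
    apply: (le_trans (expR_le_quad h)).
    have : q ^+ 2 * (2 * c + s) ^+ 2 <= q ^+ 2 * (10 * s).
      by rewrite ler_wpM2l ?sqr_ge0.
    rewrite exprMn => h1.
    have : 0 <= (4 `^ q * (40 * q ^+ 2) + 40 * q ^+ 2) * s `^ q.
      by rewrite mulr_ge0// addr_ge0// mulr_ge0 ?sqr_ge0.
    have : 0 <= 4 `^ q * (40 * q ^+ 2) * s by rewrite mulr_ge0.
    have : q * s <= q ^+ 2 * s by rewrite ler_wpM2r// expr2; nra.
    nra.
  apply: (@le_trans _ _ (4 `^ q)).
    apply: ge0_ler_powR; rewrite ?nnegrE//; first by lra.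
    by nra.
  (* Here q v > 1/2 with v^2 <= 10 s keeps s away from 0, so the crude bound 4^q is itself of order
     s. *)
  have qv : 1 <= 40 * q ^+ 2 * s.
    have : q ^+ 2 * (2 * c + s) ^+ 2 <= q ^+ 2 * (10 * s).
      by rewrite ler_wpM2l ?sqr_ge0.
    nra.
  have : 4 `^ q * 1 <= 4 `^ q * (40 * q ^+ 2 * s) by rewrite ler_wpM2l ?powR_ge0.
  have : 0 <= (4 `^ q * (40 * q ^+ 2) + 40 * q ^+ 2) * s `^ q.
    by rewrite mulr_ge0// addr_ge0// mulr_ge0 ?sqr_ge0.
  have : q * s <= 40 * q ^+ 2 * s by rewrite ler_wpM2r//; nra.
  nra.
(* For s > 1, c^2 <= s <= s^2, so the base 1 + 2c + s is at most 4s. *)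
have cs1 : `|c| <= s.
  by rewrite -(@ler_pXn2r _ 2) ?nnegrE// real_normK ?num_real//; nra.
have [cs2 cs3] : - s <= c /\ c <= s by apply/andP; rewrite -ler_norml.
apply: (@le_trans _ _ ((4 * s) `^ q)).
  apply: ge0_ler_powR; rewrite ?nnegrE//; [by lra|by lra|].
  by lra.
rewrite powRM//.
have ssq : s <= s `^ q by apply: le1r_powR => //; exact: ltW.
have : 4 `^ q * s `^ q * 1 <= 4 `^ q * s `^ q * (40 * q ^+ 2).
  by rewrite ler_wpM2l ?mulr_ge0 ?powR_ge0//; nra.
have : 0 <= 4 `^ q * (40 * q ^+ 2) * s by rewrite !mulr_ge0 ?powR_ge0 ?sqr_ge0//; lra.
have : q * s <= 40 * q ^+ 2 * s by rewrite ler_wpM2r//; nra.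
have : 0 <= q * (c + s) by rewrite mulr_ge0//; lra.
have : 0 <= 40 * q ^+ 2 * s `^ q by rewrite !mulr_ge0 ?sqr_ge0.
nra.
Qed.

(** Homogeneity: divide by Q and apply the case Q = 1 to c / Q and s / Q. When Q = 0, the constraint
    forces c = 0. *)
Lemma powR_sqr_dev q : 1 <= q -> exists2 C, 1 <= C &
  forall Q c s, 0 <= Q -> 0 <= s -> c ^+ 2 <= Q * s ->
  (Q + 2 * c + s) `^ q <=
  Q `^ q + 2 * q * (Q `^ (q - 1) * c) + C * (Q `^ (q - 1) * s + s `^ q).
Proof.
move=> q1; have q0 : 0 < q by lra.
have [C C1 HC] := powR_sqr_dev1 q1; exists C => // Q c s Q0 s0 csQ.
have sq0 : 0 <= s `^ q by exact: powR_ge0.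
have [Q0'|Qn0] := eqVneq Q 0.
  have c0 : c = 0.
    apply/eqP; rewrite -sqrf_eq0 eq_le sqr_ge0 andbT.
    by rewrite Q0' mul0r in csQ.
  rewrite c0 Q0' (powR0 (lt0r_neq0 q0)) !mulr0 !add0r.
  have : 0 <= C * (0 `^ (q - 1) * s) by rewrite !mulr_ge0 ?powR_ge0//; lra.
  nra.
have Qp : 0 < Q by rewrite lt_neqAle eq_sym Qn0.
have h : (c / Q) ^+ 2 <= s / Q.
  rewrite expr_div_n ler_pdivrMr ?exprn_gt0//.
  by have -> : s / Q * Q ^+ 2 = Q * s by field.
have := HC _ _ h; rewrite -(ler_pM2l (powR_gt0 q Qp)).
rewrite -powRM//; last first.
  have : 0 <= (1 + c / Q) ^+ 2 by exact: sqr_ge0.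
  nra.
have -> : Q * (1 + 2 * (c / Q) + s / Q) = Q + 2 * c + s by field.
move=> /le_trans; apply.
have e : Q `^ q = Q * Q `^ (q - 1) by rewrite mulr_powRB1.
have -> : Q `^ q * (1 + 2 * q * (c / Q) + C * (s / Q + (s / Q) `^ q)) =
  Q `^ q + 2 * q * (Q `^ (q - 1) * c)
  + C * (Q `^ (q - 1) * s + (Q * (s / Q)) `^ q).
  by rewrite (powRM q Q0 (divr_ge0 s0 Q0)) e; field.
by have -> : Q * (s / Q) = s by field.
Qed.

(** Absorbs the remainder of [powR_sqr_dev] into the base. (Q + K v)^q dominates both Q^q + q K v
    Q^(q-1), by the tangent at Q, and Q^q + (K v)^q, by superadditivity; the average of the two pays
    for the two error terms, each with the factor K / 2. *)
Lemma powR_sqr_dev_step q C K nu mu Q v : 1 <= q -> 1 <= K ->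
  0 <= C -> C * nu <= K / 2 -> C * mu <= K / 2 -> 0 <= Q -> 0 <= v ->
  Q `^ q + C * (Q `^ (q - 1) * (v * nu) + v `^ q * mu) <= (Q + K * v) `^ q.
Proof.
move=> q1 K1 C0 Cnu Cmu Q0 v0; have q0 : 0 < q by lra.
have Kv0 : 0 <= K * v by rewrite mulr_ge0//; lra.
have := powR_tangent q1 (addr_ge0 Q0 Kv0) Q0.
have := powR_superadditive q1 Q0 Kv0.
rewrite powRM//; last by lra.
have e0 : 0 <= Q `^ (q - 1) by exact: powR_ge0.
have vq0 : 0 <= v `^ q by exact: powR_ge0.
have : K * v `^ q <= K `^ q * v `^ q by rewrite ler_wpM2r// le1r_powR.
have : (Q `^ (q - 1) * v) * (C * nu) <= (Q `^ (q - 1) * v) * (K / 2).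
  by rewrite ler_wpM2l// mulr_ge0.
have : v `^ q * (C * mu) <= v `^ q * (K / 2) by rewrite ler_wpM2l.
have : 1 * (Q `^ (q - 1) * (K * v)) <= q * (Q `^ (q - 1) * (K * v)).
  by rewrite ler_wpM2r// mulr_ge0.
nra.
Qed.

(** The coefficient of the linear term can be taken as close to q as desired, which later makes
    every contraction rate above w(2) attainable. *)
Lemma powR_add_le q e : 1 <= q -> 0 < e -> exists2 C, 1 <= C & forall x y,
  0 <= x -> 0 <= y ->
  (x + y) `^ q <= x `^ q + (q + e) * (x `^ (q - 1) * y) + C * y `^ q.
Proof.
move=> q1 e0; have q0 : 0 < q by lra.
(* With t = y / x at most d, the first bound gives 2 q^2 t^2 <= e t and the second q t <= 1/2, as
   [expR_le_quad] requires. For t > d, 1 + t <= (1/d + 1) t, whence the constant. *)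
pose d := Num.min (e / (2 * q ^+ 2)) ((2 * q)^-1).
have d0 : 0 < d.
  by rewrite lt_min divr_gt0 ?mulr_gt0 ?exprn_gt0//= invr_gt0 mulr_gt0.
have C1 : 1 <= (d^-1 + 1) `^ q.
  have d1 : 1 <= d^-1 + 1 by rewrite lerDr invr_ge0 ltW.
  by have := ler_powR d1 (ltW q0); rewrite powRr0.
exists ((d^-1 + 1) `^ q) => // x y x0 y0.
have yq0 : 0 <= y `^ q by exact: powR_ge0.
have [->|xn0] := eqVneq x 0.
  rewrite (powR0 (lt0r_neq0 q0)) !add0r.
  have : 0 <= (q + e) * (0 `^ (q - 1) * y).
    by rewrite !mulr_ge0 ?powR_ge0//; lra.
  nra.
have xp : 0 < x by rewrite lt_neqAle eq_sym xn0.
pose t := y / x; have t0 : 0 <= t by rewrite divr_ge0.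
have yE : y = x * t by rewrite /t mulrC divfK.
have eq1 : x `^ q = x * x `^ (q - 1) by rewrite mulr_powRB1.
suff : (1 + t) `^ q <= 1 + (q + e) * t + (d^-1 + 1) `^ q * t `^ q.
  rewrite -(ler_pM2l (powR_gt0 q xp)) -(powRM q x0 (addr_ge0 ler01 t0)).
  rewrite yE mulrDr mulr1 => /le_trans; apply.
  rewrite (powRM q x0 t0) eq1; lra.
have [td|td] := leP t d; last first.
  apply: (@le_trans _ _ (((d^-1 + 1) * t) `^ q)).
    apply: ge0_ler_powR.
    - exact: ltW.
    - by rewrite nnegrE addr_ge0.
    - by rewrite nnegrE mulr_ge0// addr_ge0// invr_ge0 ltW.
    rewrite mulrDl mul1r lerD2r mulrC ler_pdivlMr// mul1r; exact: ltW.
  rewrite powRM//; last by rewrite addr_ge0// invr_ge0 ltW.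
  by rewrite lerDr addr_ge0// mulr_ge0//; lra.
have [td1 td2] : t <= e / (2 * q ^+ 2) /\ t <= (2 * q)^-1.
  by apply/andP; rewrite -le_min.
have h1 : q * t <= 2^-1.
  by rewrite mulrC -ler_pdivlMr// -invfM.
have h2 : t * (2 * q ^+ 2) <= e by rewrite -ler_pdivlMr ?mulr_gt0 ?exprn_gt0.
apply: (le_trans (powR_le_expR (ltW q0) (_ : -1 <= t))); first by lra.
apply: (le_trans (expR_le_quad h1)).
have : t * (t * (2 * q ^+ 2)) <= t * e by rewrite ler_wpM2l.
have : 0 <= (d^-1 + 1) `^ q * t `^ q by rewrite mulr_ge0 ?powR_ge0.
nra.
Qed.

End power_inequalities.


(** * Countable unordered sums *)

Section countable_sums.
Local Open Scope classical_set_scope.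
Local Open Scope ereal_scope.
Context (I : countType) (R : realType).

(** The elements with code below N: an exhaustion of [I] by finite duplicate-free lists, through
    which unordered sums become limits of finite ones. *)
Definition cenum (N : nat) : seq I := pmap (@pickle_inv I) (iota 0 N).

Lemma cenum_uniq N : uniq (cenum N).
Proof. by apply: (pmap_uniq (@pickle_invK I)); exact: iota_uniq. Qed.

Lemma big_cenum (f : I -> \bar R) N :
  \sum_(i <- cenum N) f i = \sum_(0 <= k < N) oapp f 0 (pickle_inv k).
Proof.
rewrite /cenum /index_iota subn0; elim: (iota 0 N) => [|k s IH] /=.
  by rewrite !big_nil.
by rewrite big_cons; case: (pickle_inv k) => [i|] /=;
  rewrite ?big_cons IH ?add0e.
Qed.

Lemma esum_nneseries (f : I -> \bar R) : (forall i, 0 <= f i) ->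
  \esum_(i in setT) f i = \sum_(k <oo) oapp f 0 (pickle_inv k).
Proof.
move=> f0; rewrite nneseries_esumT; last first.
  by move=> k; case: (pickle_inv k) => /=.
transitivity (\esum_(k in range (@pickle I)) oapp f 0 (pickle_inv k)).
  have bij : set_bij [set: I] (range (@pickle I)) pickle.
    split => // i j _ _; exact: (pcan_inj pickleK_inv).

  rewrite (reindex_esum _ _ _ _ bij).
  by apply: eq_esum => i _; rewrite pickleK_inv.
rewrite esum_mkcond; apply: eq_esum => k _; case: ifPn => //.
have := @pickle_invK I k; case: (pickle_inv k) => //= i <-.
by rewrite notin_setE => -[]; exists i.
Qed.

Lemma cenum_esum_cvg (f : I -> \bar R) : (forall i, 0 <= f i) ->
  \sum_(i <- cenum N) f i @[N --> \oo] --> \esum_(i in setT) f i.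
Proof.
move=> f0; rewrite esum_nneseries//; under eq_fun do rewrite big_cenum.
by apply: is_cvg_nneseries => k _ _; case: (pickle_inv k) => /=.
Qed.

Lemma cenum_esum_le (f : I -> \bar R) N : (forall i, 0 <= f i) ->
  \sum_(i <- cenum N) f i <= \esum_(i in setT) f i.
Proof.
move=> f0; rewrite esum_nneseries// big_cenum; apply: nneseries_lim_ge => k _ _.
by case: (pickle_inv k) => /=.
Qed.

Lemma esum_ge_term (f : I -> \bar R) i : (forall i, 0 <= f i) ->
  f i <= \esum_(i in setT) f i.
Proof.
move=> f0; rewrite -(@esum_set1 _ _ i f (f0 i)) [leLHS]esum_mkcond.
by apply: le_esum => j _; case: ifP.
Qed.

Lemma esumZl (f : I -> \bar R) (c : R) : (forall i, 0 <= f i) -> (0 <= c)%R ->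
  \esum_(i in setT) (c%:E * f i) = c%:E * \esum_(i in setT) f i.
Proof.
move=> f0 c0; rewrite !esum_nneseries//; last by move=> i; rewrite mule_ge0.
rewrite -nneseriesZl; last by move=> k _; case: (pickle_inv k) => /=.
by congr (limn _); apply/funext => n; apply: eq_bigr => k _;
  case: (pickle_inv k) => //=; rewrite mule0.
Qed.

(** The factor may be +oo, as moments of weights may be. With 0 * +oo = 0, both sides vanish when
    all terms do; otherwise one term makes both infinite. *)
Lemma ge0_esumZl (f : I -> \bar R) (c : \bar R) : (forall i, 0 <= f i) -> 0 <= c ->
  \esum_(i in setT) (c * f i) = c * \esum_(i in setT) f i.
Proof.
move=> f0; case: c => [c c0| _|//]; first exact: esumZl.
have [e0|e0] := eqVneq (\esum_(i in [set: I]) f i) 0.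
  rewrite e0 mule0; apply: esum1 => i _.
  suff -> : f i = 0 by rewrite mule0.
  by apply/eqP; rewrite eq_le f0 andbT -e0; exact: esum_ge_term.
have [[i fi]|nf] := pselect (exists i, f i != 0); last first.
  case/eqP: e0; apply: esum1 => i _; apply/eqP/negPn/negP => fi.
  by apply: nf; exists i.
have fi0 : 0 < f i by rewrite lt_neqAle eq_sym fi f0.
rewrite gt0_mulye; last by rewrite lt_neqAle eq_sym e0 esum_ge0.
have : +oo * f i <= \esum_(j in setT) (+oo * f j).
  by apply: (@esum_ge_term (fun j => +oo * f j)) => j; rewrite mule_ge0.
by rewrite gt0_mulye// leye_eq => /eqP.
Qed.

Context d (T : measurableType d).

Lemma measurable_fun_esum (f : I -> T -> \bar R) :
  (forall i w, 0 <= f i w) -> (forall i, measurable_fun setT (f i)) ->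
  measurable_fun setT (fun w => \esum_(i in setT) f i w).
Proof.
move=> f0 mf; under eq_fun do rewrite esum_nneseries//.
apply: ge0_emeasurable_sum => [k w _ _|k _]; first by case: (pickle_inv k) => /=.
by case: (pickle_inv k) => [i|] //=; exact: measurable_cst.
Qed.

Lemma integral_esum (mu : {measure set T -> \bar R}) (f : I -> T -> \bar R) :
  (forall i w, 0 <= f i w) -> (forall i, measurable_fun setT (f i)) ->
  \int[mu]_w (\esum_(i in setT) f i w) = \esum_(i in setT) (\int[mu]_w f i w).
Proof.
move=> f0 mf; under eq_integral do rewrite esum_nneseries//.
rewrite esum_nneseries; last by move=> i; exact: integral_ge0.
rewrite (integral_nneseries _ measurableT (f := fun k w => oapp (f^~ w) 0 (pickle_inv k))).
- congr (limn _); apply/funext => n; apply: eq_bigr => k _.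
  by case: (pickle_inv k) => //=; exact: integral0.
- by move=> k; case: (pickle_inv k) => [i|] //=; exact: measurable_cst.
- by move=> k w _; case: (pickle_inv k) => /=.
Qed.

End countable_sums.


(** * Sums of signed real families *)

Section real_sums.
Local Open Scope classical_set_scope.
Local Open Scope ring_scope.
Context (R : realType).

Lemma sumR_mkcond (I : choiceType) (D : set I) (f : I -> R) :
  sumR D f = sumR setT (fun i => if i \in D then f i else 0).
Proof.
rewrite /sumR; congr (fine _ - fine _); rewrite esum_mkcond; apply: eq_esum => i _;
  by case: ifP; rewrite ?oppr0 ?maxxx.
Qed.

Lemma eq_sumR (I : choiceType) (D : set I) (f g : I -> R) :
  (forall i, D i -> f i = g i) -> sumR D f = sumR D g.
Proof.
by move=> fg; rewrite /sumR; congr (fine _ - fine _); apply: eq_esum => i Di;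
  rewrite fg.
Qed.

Lemma esum_posneg_lty (I : choiceType) (f : I -> R) :
  (\esum_(i in setT) `|f i|%:E < +oo)%E ->
  (\esum_(i in setT) (Num.max (f i) 0)%:E)%E \is a fin_num /\
  (\esum_(i in setT) (Num.max (- f i) 0)%:E)%E \is a fin_num.
Proof.
move=> foo; split; rewrite ge0_fin_numE.
- apply: le_lt_trans foo; apply: le_esum => i _.
  by rewrite lee_fin ge_max ler_norm normr_ge0.
- by apply: esum_ge0 => i _; rewrite lee_fin le_max lexx orbT.
- apply: le_lt_trans foo; apply: le_esum => i _.
  by rewrite lee_fin ge_max -normrN ler_norm normr_ge0.
- by apply: esum_ge0 => i _; rewrite lee_fin le_max lexx orbT.
Qed.

Lemma maxr0_subN (x : R) : x = Num.max x 0 - Num.max (- x) 0.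
Proof.
by case: (leP x 0); case: (leP (- x) 0); rewrite ?oppr_le0 ?oppr_gt0; lra.
Qed.

Lemma sumR_cvg (I : countType) (f : I -> R) :
  (\esum_(i in setT) `|f i|%:E < +oo)%E ->
  \sum_(i <- cenum I N) f i @[N --> \oo] --> sumR setT f.
Proof.
move=> /esum_posneg_lty [fp fn].
under eq_fun do under eq_bigr do rewrite [f _]maxr0_subN.
under eq_fun do rewrite sumrB.
have cv (g : I -> R) : (forall i, 0 <= g i) ->
    (\esum_(i in setT) (g i)%:E)%E \is a fin_num ->
    \sum_(i <- cenum I N) g i @[N --> \oo] --> fine (\esum_(i in setT) (g i)%:E).
  move=> g0 gfin.
  have := @cenum_esum_cvg _ _ (EFin \o g) (fun i => g0 i).
  rewrite -(fineK gfin) => /fine_cvg.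
  by rewrite /comp/=; under eq_fun do rewrite sumEFin/=.
by apply: cvgB; apply: cv => // i; rewrite le_max lexx orbT.
Qed.

(** Positive and negative parts are not additive, so linearity is obtained through limits of finite
    sums. *)
Lemma sumR_linear (I : countType) (a b : R) (f g : I -> R) :
  (\esum_(i in setT) `|f i|%:E < +oo)%E -> (\esum_(i in setT) `|g i|%:E < +oo)%E ->
  sumR setT (fun i => a * f i + b * g i) = a * sumR setT f + b * sumR setT g.
Proof.
move=> foo goo; apply: (@cvg_unique _ _ (
  \sum_(i <- cenum I N) (a * f i + b * g i) @[N --> \oo])) => //.
  apply: sumR_cvg.
  apply: (@le_lt_trans _ _ (\esum_(i in setT) (`|a|%:E * `|f i|%:E + `|b|%:E * `|g i|%:E)))%E.
    apply: le_esum => i _; rewrite -!EFinM -EFinD lee_fin -!normrM.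
    exact: ler_normD.
  rewrite esumD; [|by move=> i _; rewrite -EFinM lee_fin mulr_ge0..].
  rewrite !esumZl//.
  rewrite lte_add_pinfty// lte_mul_pinfty// ?lee_fin//.
rewrite /=.
under eq_fun do rewrite big_split/= -!mulr_sumr.
by apply: cvgD; apply: cvgMr; exact: sumR_cvg.
Qed.

Lemma esum_pair (I J : choiceType) (F : I * J -> \bar R) :
  (forall k, 0 <= F k)%E ->
  (\esum_(k in setT) F k = \esum_(i in setT) \esum_(j in setT) F (i, j))%E.
Proof.
move=> F0; rewrite (esum_esum (J := fun=> setT) (a := fun i j => F (i, j)))//.
have -> : [set: I] `*`` (fun=> [set: J]) = setT by apply/seteqP; split.
by apply: eq_esum => -[].
Qed.

(** The inner sums of positive parts [p] and of negative parts [n] are finite, so the problem splits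
    into two nonnegative ones, to which Tonelli applies. *)
Lemma sumR_fubini (I J : countType) (F : I -> J -> R) :
  (\esum_(i in setT) \esum_(j in setT) `|F i j|%:E < +oo)%E ->
  sumR setT (fun i => sumR setT (F i)) = sumR setT (fun k => F k.1 k.2).
Proof.
move=> Foo.
pose p i := (\esum_(j in setT) (Num.max (F i j) 0)%:E)%E.
pose n i := (\esum_(j in setT) (Num.max (- F i j) 0)%:E)%E.
have Fi i : (\esum_(j in setT) `|F i j|%:E < +oo)%E.
  apply: le_lt_trans Foo; apply: (@esum_ge_term _ _ (fun i => \esum_(j in setT) `|F i j|%:E)%E).
  by move=> {}i; apply: esum_ge0 => j _; rewrite lee_fin.
have fp i : p i \is a fin_num by have [] := esum_posneg_lty (Fi i).
have fn i : n i \is a fin_num by have [] := esum_posneg_lty (Fi i).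
have p0 i : (0 <= p i)%E by apply: esum_ge0 => j _; rewrite lee_fin le_max lexx orbT.
have n0 i : (0 <= n i)%E by apply: esum_ge0 => j _; rewrite lee_fin le_max lexx orbT.
have -> : sumR setT (fun i => sumR setT (F i)) =
    sumR setT (fun i => 1 * fine (p i) + (- 1) * fine (n i)).
  by apply: eq_sumR => i _; rewrite /sumR mul1r mulN1r.
have ple : (\esum_(i in setT) `|fine (p i)|%:E < +oo)%E.
  apply: le_lt_trans Foo; apply: le_esum => i _.
  rewrite ger0_norm ?fine_ge0// fineK//; apply: le_esum => j _.
  by rewrite lee_fin ge_max ler_norm normr_ge0.
have nle : (\esum_(i in setT) `|fine (n i)|%:E < +oo)%E.
  apply: le_lt_trans Foo; apply: le_esum => i _.
  rewrite ger0_norm ?fine_ge0// fineK//; apply: le_esum => j _.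
  by rewrite lee_fin ge_max -normrN ler_norm normr_ge0.
rewrite sumR_linear// mul1r mulN1r.
have ge0E (g : I -> \bar R) : (forall i, 0 <= g i)%E ->
   (forall i, g i \is a fin_num) ->
   sumR setT (fun i => fine (g i)) = fine (\esum_(i in setT) g i)%E.
  move=> g0 gfin; rewrite /sumR [X in _ - fine X]esum1 ?subr0.
    congr fine; apply: eq_esum => i _.
    by rewrite max_l ?fineK// fine_ge0.
  by move=> i _; rewrite max_r// oppr_le0 fine_ge0.
rewrite !ge0E// /sumR; congr (fine _ - fine _).
  by rewrite esum_pair// => k; rewrite lee_fin le_max lexx orbT.
by rewrite esum_pair// => k; rewrite lee_fin le_max lexx orbT.
Qed.

Lemma sumR_reindex (I J : choiceType) (D : set I) (E : set J) (e : I -> J) (f : J -> R) :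
  set_bij D E e -> sumR E f = sumR D (f \o e).
Proof.
move=> bij; rewrite /sumR; congr (fine _ - fine _);
  by rewrite (reindex_esum _ _ _ _ bij).
Qed.

Context d (T : measurableType d).

Lemma measurable_fun_sumR (I : countType) (f : I -> T -> R) :
  (forall i, measurable_fun setT (f i)) ->
  measurable_fun setT (fun w => sumR setT (f ^~ w)).
Proof.
move=> mf; rewrite /sumR; apply: measurable_funB.
  apply: (measurableT_comp (@fine_measurable R _ measurableT)).
  apply: measurable_fun_esum => [i w|i]; first by rewrite lee_fin le_max lexx orbT.
  by apply/measurable_EFinP; exact: measurable_maxr.
apply: (measurableT_comp (@fine_measurable R _ measurableT)).
apply: measurable_fun_esum => [i w|i]; first by rewrite lee_fin le_max lexx orbT.
apply/measurable_EFinP; apply: measurable_maxr => //.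
exact: measurableT_comp.
Qed.

End real_sums.

(** * Absolutely convergent complex sums *)

Section complex_sums.
Local Open Scope classical_set_scope.
Local Open Scope ring_scope.
Context (R : realType).
Implicit Types z : R[i].
Notation Re := complex.Re.
Notation Im := complex.Im.

Lemma modulusE z : modulus z = Num.sqrt (Re z ^+ 2 + Im z ^+ 2).
Proof. by case: z. Qed.

Lemma modulus_ge0 z : 0 <= modulus z.
Proof. by rewrite modulusE sqrtr_ge0. Qed.

Lemma sqr_modulus z : modulus z ^+ 2 = Re z ^+ 2 + Im z ^+ 2.
Proof. by rewrite modulusE sqr_sqrtr// addr_ge0 ?sqr_ge0. Qed.

Lemma ler_Re_modulus z : `|Re z| <= modulus z.
Proof.
rewrite -(@ler_pXn2r _ 2) ?nnegrE ?modulus_ge0// sqr_modulus.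
by rewrite real_normK ?num_real// lerDl sqr_ge0.
Qed.

Lemma ler_Im_modulus z : `|Im z| <= modulus z.
Proof.
rewrite -(@ler_pXn2r _ 2) ?nnegrE ?modulus_ge0// sqr_modulus.
by rewrite real_normK ?num_real// lerDr sqr_ge0.
Qed.

Lemma complex_ReM z z' : Re (z * z') = Re z * Re z' - Im z * Im z'.
Proof. by case: z z' => [a b] [c e]. Qed.

Lemma complex_ImM z z' : Im (z * z') = Re z * Im z' + Im z * Re z'.
Proof. by case: z z' => [a b] [c e]. Qed.

Lemma complex_ReD z z' : Re (z + z') = Re z + Re z'.
Proof. by case: z z' => [a b] [c e]. Qed.

Lemma complex_ImD z z' : Im (z + z') = Im z + Im z'.
Proof. by case: z z' => [a b] [c e]. Qed.

Lemma complex_ReB z z' : Re (z - z') = Re z - Re z'.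
Proof. by case: z z' => [a b] [c e]. Qed.

Lemma complex_ImB z z' : Im (z - z') = Im z - Im z'.
Proof. by case: z z' => [a b] [c e]. Qed.

Lemma complex_ext z z' : Re z = Re z' -> Im z = Im z' -> z = z'.
Proof. by case: z z' => [a b] [c e] /= -> ->. Qed.

Lemma modulusM z z' : modulus (z * z') = modulus z * modulus z'.
Proof. exact: ComplexField.Normc.normcM. Qed.

Lemma complex_Re_sum (I : Type) (s : seq I) (f : I -> R[i]) :
  Re (\sum_(i <- s) f i) = \sum_(i <- s) Re (f i).
Proof. by elim: s => [|i s IH]; rewrite ?big_nil// !big_cons complex_ReD IH. Qed.

Lemma complex_Im_sum (I : Type) (s : seq I) (f : I -> R[i]) :
  Im (\sum_(i <- s) f i) = \sum_(i <- s) Im (f i).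
Proof. by elim: s => [|i s IH]; rewrite ?big_nil// !big_cons complex_ImD IH. Qed.

Lemma modulus_sum (I : Type) (s : seq I) (f : I -> R[i]) :
  modulus (\sum_(i <- s) f i) <= \sum_(i <- s) modulus (f i).
Proof.
elim: s => [|i s IH]; first by rewrite !big_nil modulusE/= expr0n addr0 sqrtr0.
rewrite !big_cons; apply: le_trans (le_normcD _ _) _.
by rewrite lerD2l.
Qed.

(** Its finiteness is the absolute convergence under which [sumC] has its usual meaning. *)
Definition asumC (I : choiceType) (f : I -> R[i]) : \bar R :=
  \esum_(i in setT) (modulus (f i))%:E.

Lemma asumC_Re (I : choiceType) (f : I -> R[i]) :
  (asumC f < +oo)%E -> (\esum_(i in setT) `|Re (f i)|%:E < +oo)%E.
Proof.
by apply: le_lt_trans; apply: le_esum => i _; rewrite lee_fin ler_Re_modulus.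
Qed.

Lemma asumC_Im (I : choiceType) (f : I -> R[i]) :
  (asumC f < +oo)%E -> (\esum_(i in setT) `|Im (f i)|%:E < +oo)%E.
Proof.
by apply: le_lt_trans; apply: le_esum => i _; rewrite lee_fin ler_Im_modulus.
Qed.

Lemma sumC_mkcond (I : choiceType) (D : set I) (f : I -> R[i]) :
  sumC D f = sumC setT (fun i => if i \in D then f i else 0).
Proof.
rewrite /sumC; congr Complex; rewrite sumR_mkcond; apply: eq_sumR => i _;
  by case: ifP.
Qed.

Lemma eq_sumC (I : choiceType) (D : set I) (f g : I -> R[i]) :
  (forall i, D i -> f i = g i) -> sumC D f = sumC D g.
Proof. by move=> fg; congr Complex; apply: eq_sumR => i Di; rewrite fg. Qed.

(** The shift [z] lets one statement serve for the size of the sum (z = 0) and for tails (z a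
    partial sum). *)
Lemma modulus_sumC_cvg (I : countType) (f : I -> R[i]) (z : R[i]) :
  (asumC f < +oo)%E ->
  modulus (z - \sum_(i <- cenum I N) f i) @[N --> \oo] --> modulus (z - sumC setT f).
Proof.
move=> foo; under eq_fun do rewrite modulusE complex_ReB complex_ImB complex_Re_sum complex_Im_sum.
rewrite modulusE complex_ReB complex_ImB/=.
apply: (@continuous_cvg _ _ _ _ _ _ (@Num.sqrt R)); first exact: sqrt_continuous.
have sq (u : nat -> R) (l : R) : u n @[n --> \oo] --> l ->
    u n ^+ 2 @[n --> \oo] --> l ^+ 2.
  by move=> ul; apply: (continuous_cvg _ (@exprn_continuous R 2 l) ul).
apply: cvgD; apply: sq; apply: cvgB; first exact: cvg_cst.
- by apply: sumR_cvg; exact: asumC_Re.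
- exact: cvg_cst.
- by apply: sumR_cvg; exact: asumC_Im.
Qed.

Lemma modulus_sumC_le (I : countType) (f : I -> R[i]) :
  ((modulus (sumC setT f))%:E <= asumC f)%E.
Proof.
have [foo|] := boolP (asumC f < +oo)%E; last first.
  by rewrite -leNgt leye_eq => /eqP ->; rewrite leey.
have := @modulus_sumC_cvg _ f 0 foo.
rewrite sub0r normcN => h.
have -> : asumC f = (fine (asumC f))%:E.
  rewrite fineK// ge0_fin_numE// esum_ge0// => i _.
  by rewrite lee_fin modulus_ge0.
rewrite lee_fin -(cvg_lim _ h)//; apply: limr_le; first by apply/cvg_ex; eexists; exact: h.
apply: nearW => N; rewrite sub0r normcN.
apply: (le_trans (modulus_sum _ _)); rewrite -lee_fin fineK; last first.
  rewrite ge0_fin_numE// esum_ge0// => i _.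
  by rewrite lee_fin modulus_ge0.
rewrite -sumEFin; apply: (@cenum_esum_le _ _ (fun i => (modulus (f i))%:E)) => i.
by rewrite lee_fin modulus_ge0.
Qed.

Lemma sumC_scale (I : countType) (c : R[i]) (f : I -> R[i]) :
  (asumC f < +oo)%E -> sumC setT (fun i => c * f i) = c * sumC setT f.
Proof.
move=> foo; have [fr fi] := (asumC_Re foo, asumC_Im foo).
apply: complex_ext; rewrite ?complex_ReM ?complex_ImM /=.
  rewrite -mulNr -(sumR_linear _ _ fr fi); apply: eq_sumR => i _.
  by rewrite complex_ReM mulNr.
by rewrite -(sumR_linear _ _ fi fr); apply: eq_sumR => i _; rewrite complex_ImM.
Qed.

Lemma sumCB (I : countType) (f g : I -> R[i]) :
  (asumC f < +oo)%E -> (asumC g < +oo)%E ->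
  sumC setT f - sumC setT g = sumC setT (fun i => f i - g i).
Proof.
move=> foo goo; apply: complex_ext; rewrite ?complex_ReB ?complex_ImB /=.
  rewrite -[sumR _ _ in LHS]mul1r -[X in _ - X]mul1r -mulNr.
  rewrite -(sumR_linear _ _ (asumC_Re foo) (asumC_Re goo)).
  by apply: eq_sumR => i _; rewrite complex_ReB mul1r mulN1r.
rewrite -[sumR _ _ in LHS]mul1r -[X in _ - X]mul1r -mulNr.
rewrite -(sumR_linear _ _ (asumC_Im foo) (asumC_Im goo)).
by apply: eq_sumR => i _; rewrite complex_ImB mul1r mulN1r.
Qed.

Lemma sumC_fubini (I J : countType) (F : I -> J -> R[i]) :
  (\esum_(i in setT) asumC (F i) < +oo)%E ->
  sumC setT (fun i => sumC setT (F i)) = sumC setT (fun k => F k.1 k.2).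
Proof.
move=> Foo; rewrite /sumC; congr Complex.
  rewrite /= (sumR_fubini (F := fun i j => Re (F i j)))//.
  apply: le_lt_trans Foo; apply: le_esum => i _; apply: le_esum => j _.
  by rewrite lee_fin ler_Re_modulus.
rewrite /= (sumR_fubini (F := fun i j => Im (F i j)))//.
apply: le_lt_trans Foo; apply: le_esum => i _; apply: le_esum => j _.
by rewrite lee_fin ler_Im_modulus.
Qed.

Lemma sumC_reindex (I J : choiceType) (D : set I) (E : set J) (e : I -> J)
    (f : J -> R[i]) :
  set_bij D E e -> sumC E f = sumC D (f \o e).
Proof.
by move=> bij; rewrite /sumC; congr Complex; rewrite (sumR_reindex _ bij).
Qed.

End complex_sums.

(** * Measurability of complex-valued functions *)

Section complex_measurable.
Local Open Scope classical_set_scope.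
Local Open Scope ring_scope.
Context (R : realType) d (T : measurableType d).
Notation Re := complex.Re.
Notation Im := complex.Im.

Definition cmeasurable (f : T -> R[i]) :=
  measurable_fun setT (fun w => Re (f w)) /\ measurable_fun setT (fun w => Im (f w)).

Lemma cmeasurable_cst c : cmeasurable (fun=> c).
Proof. by split; exact: measurable_cst. Qed.

Lemma cmeasurableM f g : cmeasurable f -> cmeasurable g ->
  cmeasurable (fun w => f w * g w).
Proof.
move=> [f1 f2] [g1 g2]; split.
  by under eq_fun do rewrite complex_ReM; apply: measurable_funB; apply: measurable_funM.
by under eq_fun do rewrite complex_ImM; apply: measurable_funD; apply: measurable_funM.
Qed.

Lemma cmeasurableD f g : cmeasurable f -> cmeasurable g ->
  cmeasurable (fun w => f w + g w).
Proof.
move=> [f1 f2] [g1 g2]; split.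
  by under eq_fun do rewrite complex_ReD; apply: measurable_funD.
by under eq_fun do rewrite complex_ImD; apply: measurable_funD.
Qed.

Lemma cmeasurableB f g : cmeasurable f -> cmeasurable g ->
  cmeasurable (fun w => f w - g w).
Proof.
move=> [f1 f2] [g1 g2]; split.
  by under eq_fun do rewrite complex_ReB; apply: measurable_funB.
by under eq_fun do rewrite complex_ImB; apply: measurable_funB.
Qed.

Lemma cmeasurable_sumC (I : countType) (f : I -> T -> R[i]) :
  (forall i, cmeasurable (f i)) -> cmeasurable (fun w => sumC setT (f ^~ w)).
Proof.
by move=> mf; split; apply: measurable_fun_sumR => i; case: (mf i).
Qed.

Lemma measurable_modulus f : cmeasurable f ->
  measurable_fun setT (fun w => modulus (f w)).
Proof.
move=> [f1 f2]; under eq_fun do rewrite modulusE -powR12_sqrt ?addr_ge0 ?sqr_ge0//.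
apply: (measurableT_comp (measurable_powR _)).
by apply: measurable_funD; apply: measurable_funX.
Qed.

End complex_measurable.


(** * Integrals of independent coordinates *)

Section joint_law.
Local Open Scope classical_set_scope.
Local Open Scope ereal_scope.
Context d (T : measurableType d) (R : realType) (P : probability T R).
Context d1 (T1 : measurableType d1) d2 (T2 : measurableType d2).

(** The joint law of X and Y agrees with the product law on rectangles, hence everywhere; Tonelli
    then gives the iterated integral. *)
Lemma ge0_integral_indep (X : {mfun T >-> T1}) (Y : {mfun T >-> T2})
    (h : T1 * T2 -> \bar R) :
  (forall E F, measurable E -> measurable F ->
     P (X @^-1` E `&` Y @^-1` F) = P (X @^-1` E) * P (Y @^-1` F)) ->
  measurable_fun setT h -> (forall z, 0 <= h z) ->
  \int[P]_w h (X w, Y w) = \int[P]_w (\int[P]_w' h (X w, Y w')).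
Proof.
move=> ind mh h0.
have mXY : measurable_fun setT (fun w => (X w, Y w)) by exact: measurable_fun_pair.
pose XYm := isMeasurableFun.Build _ _ _ _ _ mXY.
pose XY : {mfun T >-> (T1 * T2)%type} := HB.pack (fun w => (X w, Y w)) XYm.
transitivity (\int[distribution P XY]_z h z).
  by rewrite ge0_integral_distribution.
transitivity (\int[(distribution P X \x distribution P Y)%E]_z h z).
  apply: eq_measure_integral => A mA _; apply/esym.
  by apply: (@product_measure_unique _ _ _ _ _ (distribution P X) (distribution P Y)
    (distribution P XY)).
rewrite fubini_tonelli1// ge0_integral_distribution//=.
- apply: eq_integral => w _; rewrite /fubini_F ge0_integral_distribution//.
  exact: measurableT_comp.
- exact: measurable_fun_fubini_tonelli_F.
- by move=> x; apply: integral_ge0.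
Qed.

End joint_law.

(** * Independence of sigma-algebras generated by disjoint groups of indices *)

Section independent_families.
Local Open Scope classical_set_scope.
Local Open Scope ereal_scope.
Context d (T : measurableType d) (R : realType) (P : probability T R).
Context (I : choiceType) (G : I -> set (set T)).
Hypothesis sigmaG : forall i, sigma_algebra setT (G i).
Hypothesis subG : forall i, G i `<=` measurable.
Hypothesis indG : independent P G.

Let G_setT i : G i setT.
Proof. by have [G0 GC _] := sigmaG i; have := GC _ G0; rewrite setD0. Qed.

Let G_setI i : setI_closed (G i).
Proof.
move=> A B; rewrite -(sigma_algebra_id (sigmaG i)).
exact: (@measurableI _ (g_sigma_algebraType (G i))).
Qed.

Definition join_sigma (A : set I) : set (set T) := \bigcup_(i in A) G i.

Let join_sub A : <<s join_sigma A >> `<=` measurable.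
Proof.
apply: smallest_sub; first exact: sigma_algebra_measurable.
by move=> E [i _]; exact: subG.
Qed.

(** Finite intersections of events of the [G i], written as total families that equal [setT] outside
    [s]. They form a pi-system generating the joined sigma-algebra, and the independence hypothesis
    applies to them directly. *)
Let cylinder (A : set I) : set (set T) :=
  [set E | exists (s : seq I) (F : I -> set T),
    [/\ uniq s, forall i, i \in s -> A i, forall i, G i (F i),
        forall i, i \notin s -> F i = setT & E = [set w | forall i, F i w]]].

Let big_cylinder (s : seq I) (F : I -> set T) :
  (forall i, i \notin s -> F i = setT) ->
  [set w | forall i, F i w] = \big[setI/setT]_(i <- s) F i.
Proof.
move=> FT; rewrite -bigcap_seq; apply/seteqP; split=> w Fw i; first by move=> _.
by have [/Fw//|/FT ->] := boolP (i \in s).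
Qed.

Let cylinder_setI A : setI_closed (cylinder A).
Proof.
move=> _ _ [s [F [us sA GF FT ->]]] [t [H [ut tA GH HT ->]]].
exists (undup (s ++ t)), (fun i => F i `&` H i); split.
- exact: undup_uniq.
- by move=> i; rewrite mem_undup mem_cat => /orP[/sA|/tA].
- by move=> i; exact: G_setI.
- by move=> i; rewrite mem_undup mem_cat negb_or => /andP[/FT -> /HT ->];
    rewrite setIT.
- by apply/seteqP; split=> [w [Fw Hw] i|w FHw]; [|split=> i; case: (FHw i)].
Qed.

Let cylinder_setT A : cylinder A setT.
Proof.
exists [::], (fun=> setT); split => //; last by apply/seteqP; split.
Qed.

Let cylinder_join A : <<s join_sigma A >> `<=` <<s cylinder A >>.
Proof.
apply: smallest_sub; first exact: smallest_sigma_algebra.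
move=> E [i Ai GE]; apply: sub_sigma_algebra.
exists [:: i], (fun j => if j == i then E else setT); split => //.
- by move=> j; rewrite inE => /eqP ->.
- by move=> j; case: eqP => [->|].
- by move=> j; rewrite inE => /negPf ->.
- apply/seteqP; split=> [w Ew j|w /(_ i)]; last by rewrite eqxx.
  by case: ifP.
Qed.

Let cylinder_measurable A : cylinder A `<=` measurable.
Proof.
move=> E [s [F [us sA GF FT ->]]]; rewrite (big_cylinder FT).
by apply: bigsetI_measurable => i _; exact: subG (GF i).
Qed.

Let cylinder_indep A B E F : A `&` B = set0 -> cylinder A E -> cylinder B F ->
  P (E `&` F) = P E * P F.
Proof.
move=> AB [s [E' [us sA GE ET ->]]] [t [F' [ut tB GF FT ->]]].
have st : uniq (s ++ t).
  rewrite cat_uniq us ut andbT/=; apply/hasPn => i it; apply/negP => is_.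
  by have : (A `&` B) i by [split; [exact: sA|exact: tB]]; rewrite AB.
have -> : [set w | forall i, E' i w] `&` [set w | forall i, F' i w] =
    [set w | forall i, (E' i `&` F' i) w].
  by apply/seteqP; split=> [w [Fw Hw] i|w FHw]; [|split=> i; case: (FHw i)].
rewrite (@big_cylinder (s ++ t)); last first.
  by move=> i; rewrite mem_cat negb_or => /andP[/ET -> /FT ->]; rewrite setIT.
rewrite indG//; last by move=> i _; exact: G_setI.
rewrite (big_cylinder ET) (big_cylinder FT) !indG// big_cat.
congr (_ * _); apply: eq_big_seq => i ii.
  rewrite FT ?setIT//; apply/negP => it; move: st; rewrite cat_uniq.
  by move=> /and3P[_ /hasPn /(_ _ it)] /=; rewrite ii.
rewrite ET ?setTI//; apply/negP => it; move: st; rewrite cat_uniq.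
by move=> /and3P[_ /hasPn /(_ _ ii)] /=; rewrite it.
Qed.

(** The finite measures F |-> P (F [&] E) and F |-> P E * P F agree on the pi-system of cylinders,
    hence on the sigma-algebra it generates. Used once for each of the two sides. *)
Let indep_extend (A : set I) (E : set T) : measurable E ->
  (forall F, cylinder A F -> P (E `&` F) = P E * P F) ->
  forall F, <<s join_sigma A >> F -> P (E `&` F) = P E * P F.
Proof.
move=> mE EF F /cylinder_join AF.
have PE : P E \is a fin_num by exact: fin_num_measure.
pose r := NngNum (fine_ge0 (measure_ge0 P E)).
have cov : \bigcup_(k in [set: nat]) [set: T] = setT.
  by apply/seteqP; split=> // w _; exists 0%N.
have := @g_sigma_algebra_measure_unique _ R T (cylinder A)
  (@cylinder_measurable A) (fun=> setT) (fun=> @cylinder_setT A) cov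
  (mrestr P mE) (mscale r P) (@cylinder_setI A).
have rE : (r%:num)%:E = P E by rewrite /r /= fineK.
have -> : P E * P F = mscale r P F by rewrite /mscale rE.
rewrite setIC -/(mrestr P mE F); apply => //.
  move=> {AF}F AF; have := EF _ AF; rewrite setIC -rE; exact.
move=> _; have : P (setT `&` E) < +oo by rewrite setTI -ge0_fin_numE.
exact.
Qed.

Lemma join_sigma_indep A B E F : A `&` B = set0 ->
  <<s join_sigma A >> E -> <<s join_sigma B >> F -> P (E `&` F) = P E * P F.
Proof.
move=> AB AE BF; rewrite setIC muleC; apply: (@indep_extend A) => //.
  exact: join_sub BF.
move=> H AH; rewrite setIC muleC; apply: (@indep_extend B) => //.
  exact: (@cylinder_measurable A).
by move=> K BK; apply: (@cylinder_indep A B).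
Qed.

(** The sample space with only the information carried by the indices in [A]. The identity map into
    it is a random element holding all of that information. *)
Definition join_type (A : set I) := g_sigma_algebraType (join_sigma A).

Lemma measurable_to_join A : measurable_fun setT (id : T -> join_type A).
Proof. by move=> _ E mE; rewrite setTI; exact: (@join_sub A E mE). Qed.

Lemma measurable_from_join A d' (T' : measurableType d') (f : T -> T') :
  measurable_fun setT (f : join_type A -> T') -> measurable_fun setT f.
Proof. by move=> mf; exact: (measurableT_comp mf (@measurable_to_join A)). Qed.

(** Takes the place of conditioning on the indices in [A]: the identities into [join_type A] and
    [join_type B] are independent random elements, so what depends on [A] is frozen while the rest
    is integrated. *)
Lemma ge0_integral_freeze A B (h : join_type A * join_type B -> \bar R) :
  A `&` B = set0 -> measurable_fun setT h -> (forall z, 0 <= h z) ->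
  \int[P]_w h (w, w) = \int[P]_w (\int[P]_w' h (w, w')).
Proof.
move=> AB mh h0.
pose Xm := isMeasurableFun.Build _ _ _ _ _ (@measurable_to_join A).
pose X : {mfun T >-> join_type A} := HB.pack (id : T -> join_type A) Xm.
pose Ym := isMeasurableFun.Build _ _ _ _ _ (@measurable_to_join B).
pose Y : {mfun T >-> join_type B} := HB.pack (id : T -> join_type B) Ym.
apply: (@ge0_integral_indep _ _ _ _ _ _ _ _ X Y) => // E F mE mF.
exact: (@join_sigma_indep A B).
Qed.

End independent_families.


(** * Almost sure limits under the integral *)

Section integration_tools.
Local Open Scope classical_set_scope.
Local Open Scope ring_scope.
Context d (T : measurableType d) (R : realType) (P : probability T R).

Lemma ge0_integral_lty_ae (f : T -> \bar R) : measurable_fun setT f ->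
  (forall w, 0 <= f w)%E -> (\int[P]_w f w < +oo)%E -> {ae P, forall w, (f w < +oo)%E}.
Proof.
move=> mf f0 foo; have fi : P.-integrable setT f.
  by apply/integrableP; split => //; under eq_integral do rewrite gee0_abs//.
apply: filterS (integrable_ae measurableT fi) => w /(_ Logic.I).
by rewrite ge0_fin_numE.
Qed.

(** Fatou's lemma, the almost sure limit being compared with the lower limit. It carries each moment
    bound from finite sums to series. *)
Lemma ae_cvg_integral_le (f_ : nat -> T -> R) (f : T -> R) (B : \bar R) :
  (forall n, measurable_fun setT (f_ n)) -> measurable_fun setT f ->
  (forall n w, 0 <= f_ n w) -> (forall w, 0 <= f w) ->
  {ae P, forall w, f_ n w @[n --> \oo] --> f w} ->
  (forall n, \int[P]_w (f_ n w)%:E <= B)%E -> (\int[P]_w (f w)%:E <= B)%E.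
Proof.
move=> mf_ mf f_0 f0 f_f f_B.
apply: (@le_trans _ _ (\int[P]_w limn_einf (fun n => (f_ n w)%:E))%E).
  apply: ae_ge0_le_integral => //.
  - by move=> w _; rewrite lee_fin.
  - exact/measurable_EFinP.
  - move=> w _; rewrite limn_einf_lim; apply: lime_ge; first exact: is_cvg_einfs.
    apply: nearW => n; apply: le_ereal_inf_tmp => _ [m _ <-].
    by rewrite lee_fin.
  - apply: (emeasurable_fun_cvg (fun n w => einfs (fun k => (f_ k w)%:E) n)).
      by apply: measurable_fun_einfs => n; exact/measurable_EFinP.
    by move=> w _; rewrite limn_einf_lim; exact: is_cvg_einfs.
  - apply: filterS f_f => w fw _.
    have /cvg_limn_einf_sup[->_] : (f_ n w)%:E @[n --> \oo] --> (f w)%:E.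
      by apply: cvg_EFin => //; exact: nearW.
    by [].
apply: (le_trans (fatou _ _ _ _)) => //.
- by move=> n; exact/measurable_EFinP.
- by move=> n w _; rewrite lee_fin.
rewrite limn_einf_lim; apply: lime_le; first exact: is_cvg_einfs.
apply: nearW => n; apply: le_trans (f_B n); apply: ereal_inf_lbound.
by exists n => /=.
Qed.

(** At a positive limit the power is differentiable, hence continuous. At 0 the sequence is squeezed
    by u^r <= u, valid once u < 1 because r >= 1. *)
Lemma cvg_powR_ge0 (u : nat -> R) (l r : R) : 1 <= r -> (forall n, 0 <= u n) ->
  u n @[n --> \oo] --> l -> u n `^ r @[n --> \oo] --> l `^ r.
Proof.
move=> r1 u0 ul; have r0 : 0 < r by lra.
have l0 : 0 <= l.
  by rewrite -(cvg_lim _ ul)//; apply: limr_ge; [apply/cvg_ex; exists l|exact: nearW].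
have [l_eq0|ln0] := eqVneq l 0; last first.
  have lp : 0 < l by rewrite lt_neqAle eq_sym ln0.
  apply: (@continuous_cvg _ _ _ _ _ _ (fun x : R => x `^ r)) => //.
  apply/differentiable_continuous/derivable1_diffP.
  by apply: derivable_powR; rewrite in_itv/= andbT.
rewrite l_eq0 powR0 ?gt_eqF//.
apply: (@squeeze_cvgr _ _ _ _ (fun=> 0) u); last 2 first.
- exact: cvg_cst.
- by rewrite -l_eq0.
have u1 : \forall n \near \oo, u n < 1.
  by apply: (cvgr_lt l) => //; rewrite l_eq0.
near=> n; rewrite powR_ge0/=.
have [->|un0] := eqVneq (u n) 0; first by rewrite powR0 ?gt_eqF.
apply: ge1r_powR => //; rewrite lt_neqAle eq_sym un0 u0/= ltW//.
by near: n.
Unshelve. all: by end_near.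
Qed.

Lemma integral_probability_cst (c : \bar R) : (\int[P]_w c = c)%E.
Proof. by rewrite integral_cst//= probability_setT mule1. Qed.

(** Collects the integrals met when one centred summand is integrated out: the linear terms
    disappear, and only the second and the p-th moment remain. *)
Lemma integral_affine_moments (X : T -> R[i]) (p c u v b1 b2 s mu : R) :
  cmeasurable X ->
  (\int[P]_w (complex.Re (X w))%:E = 0)%E -> (\int[P]_w (complex.Im (X w))%:E = 0)%E ->
  (\int[P]_w (modulus (X w) ^+ 2)%:E = s%:E)%E ->
  (\int[P]_w (modulus (X w) `^ p)%:E = mu%:E)%E ->
  (\int[P]_w (c + u * complex.Re (X w) + v * complex.Im (X w)
     + b1 * modulus (X w) ^+ 2 + b2 * modulus (X w) `^ p)%:E
   = (c + b1 * s + b2 * mu)%:E)%E.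
Proof.
move=> mX EX1 EX2 Es Emu; have [mX1 mX2] := mX.
have mm := measurable_modulus mX.
have i2 : P.-integrable setT (fun w => (modulus (X w) ^+ 2)%:E).
  apply/integrableP; split; first exact/measurable_EFinP/measurable_funX.
  under eq_integral do rewrite gee0_abs ?lee_fin ?sqr_ge0//.
  by rewrite Es ltry.
have ip : P.-integrable setT (fun w => (modulus (X w) `^ p)%:E).
  apply/integrableP; split.
    by apply/measurable_EFinP; apply: (measurableT_comp (measurable_powR _)).
  under eq_integral do rewrite gee0_abs ?lee_fin ?powR_ge0//.
  by rewrite Emu ltry.
have ic (a : R) : P.-integrable setT (fun=> a%:E).
  exact: finite_measure_integrable_cst.
(* The first moment is controlled by |X| <= 1 + |X|^2. *)
have i1 (Y : T -> R) : measurable_fun setT Y -> (forall w, `|Y w| <= modulus (X w)) ->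
    P.-integrable setT (EFin \o Y).
  move=> mY Yle; apply: (@le_integrable _ _ _ _ _ _ _ (fun w => 1%:E + (modulus (X w) ^+ 2)%:E)%E) => //.
  - exact/measurable_EFinP.
  - move=> w _ /=; rewrite lee_fin; apply: (le_trans (Yle w)).
    rewrite ger0_norm ?addr_ge0 ?sqr_ge0//.
    by have := sqr_ge0 (modulus (X w) - 2^-1); nra.
  - exact: integrableD.
have iX1 := i1 _ mX1 (fun w => ler_Re_modulus (X w)).
have iX2 := i1 _ mX2 (fun w => ler_Im_modulus (X w)).
have iZ (a : R) (Y : T -> R) : P.-integrable setT (EFin \o Y) ->
    P.-integrable setT (fun w => (a * Y w)%:E).
  by move=> iY; under eq_fun do rewrite EFinM; exact: integrableZl.
have EZ (a : R) (Y : T -> R) : P.-integrable setT (EFin \o Y) ->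
    (\int[P]_w (a * Y w)%:E = a%:E * \int[P]_w (Y w)%:E)%E.
  by move=> iY; under eq_integral do rewrite EFinM; rewrite integralZl.
under eq_integral do rewrite !EFinD.
have j1 := integrableD measurableT (ic c) (iZ u _ iX1).
have j2 := integrableD measurableT j1 (iZ v _ iX2).
have j3 := integrableD measurableT j2 (iZ b1 _ i2).
rewrite (integralD measurableT j3 (iZ b2 _ ip)).
rewrite (integralD measurableT j2 (iZ b1 _ i2)).
rewrite (integralD measurableT j1 (iZ v _ iX2)).
rewrite (integralD measurableT (ic c) (iZ u _ iX1)).
rewrite !EZ// EX1 EX2 Es Emu !mule0 !adde0 integral_probability_cst.
by rewrite !EFinD !EFinM.
Qed.

End integration_tools.


(** * Moments of weighted sums of independent centred variables *)

Section centered_step.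
Local Open Scope classical_set_scope.
Local Open Scope ring_scope.
Context d (T : measurableType d) (R : realType) (P : probability T R).
Context (X : T -> R[i]) (p s mu : R).
Hypothesis p2 : 2 <= p.
Hypothesis mX : cmeasurable X.
Hypothesis EX1 : (\int[P]_w (complex.Re (X w))%:E = 0)%E.
Hypothesis EX2 : (\int[P]_w (complex.Im (X w))%:E = 0)%E.
Hypothesis Es : (\int[P]_w (modulus (X w) ^+ 2)%:E = s%:E)%E.
Hypothesis Emu : (\int[P]_w (modulus (X w) `^ p)%:E = mu%:E)%E.

Let expand_sqr (x a z : R[i]) : modulus (x + a * z) ^+ 2 =
  modulus x ^+ 2
  + 2 * ((complex.Re x * complex.Re a + complex.Im x * complex.Im a) * complex.Re z
       + (complex.Im x * complex.Re a - complex.Re x * complex.Im a) * complex.Im z)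
  + modulus a ^+ 2 * modulus z ^+ 2.
Proof. by rewrite !sqr_modulus complex_ReD complex_ImD complex_ReM complex_ImM; ring. Qed.

Lemma integral_sqr_centered_step (x a : R[i]) :
  (\int[P]_w (modulus (x + a * X w) ^+ 2)%:E =
   (modulus x ^+ 2 + modulus a ^+ 2 * s)%:E)%E.
Proof.
have := @integral_affine_moments _ _ _ P X p (modulus x ^+ 2)
  (2 * (complex.Re x * complex.Re a + complex.Im x * complex.Im a))
  (2 * (complex.Im x * complex.Re a - complex.Re x * complex.Im a))
  (modulus a ^+ 2) 0 s mu mX EX1 EX2 Es Emu.
rewrite mul0r addr0 => <-; apply: eq_integral => w _; congr EFin.
by rewrite expand_sqr; ring.
Qed.

(** Expand the square and apply [powR_sqr_dev] with base Q = |x|^2 + K t. The linear term integrates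
    to 0, and the remainder is absorbed by raising t to t + |a|^2, which is what allows the step to
    be iterated. *)
Lemma integral_pow_centered_step (C K t : R) (x a : R[i]) :
  (forall Q c s, 0 <= Q -> 0 <= s -> c ^+ 2 <= Q * s ->
    (Q + 2 * c + s) `^ (p / 2) <= Q `^ (p / 2) + p * (Q `^ (p / 2 - 1) * c)
       + C * (Q `^ (p / 2 - 1) * s + s `^ (p / 2))) ->
  0 <= C -> 1 <= K -> C * s <= K / 2 -> C * mu <= K / 2 -> 0 <= t ->
  (\int[P]_w ((modulus (x + a * X w) ^+ 2 + K * t) `^ (p / 2))%:E <=
   ((modulus x ^+ 2 + K * (t + modulus a ^+ 2)) `^ (p / 2))%:E)%E.
Proof.
move=> HC C0 K1 Cs Cmu t0.
pose q := p / 2; pose Q := modulus x ^+ 2 + K * t.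
have q1 : 1 <= q by rewrite /q ler_pdivlMr// mul1r.
have q2 : p = 2 * q by rewrite /q; field.
have Q0 : 0 <= Q by rewrite addr_ge0 ?sqr_ge0// mulr_ge0//; lra.
pose e := Q `^ (q - 1).
(* u and v are the real and imaginary parts of x times the conjugate of a, so that u Re X + v Im X
   is the inner product of x and a X. *)
pose u := complex.Re x * complex.Re a + complex.Im x * complex.Im a.
pose v := complex.Im x * complex.Re a - complex.Re x * complex.Im a.
have mods w : (modulus a ^+ 2 * modulus (X w) ^+ 2) `^ q =
    (modulus a ^+ 2) `^ q * modulus (X w) `^ p.
  rewrite powRM ?sqr_ge0//; congr (_ * _).
  by rewrite -powR_mulrn ?modulus_ge0// -powRrM -q2.
have := @integral_affine_moments _ _ _ P X p (Q `^ q) (p * e * u) (p * e * v)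
  (C * e * modulus a ^+ 2) (C * (modulus a ^+ 2) `^ q) s mu mX EX1 EX2 Es Emu.
set f := (X in (\int[P]_w X w)%E) => Ef.
apply: (@le_trans _ _ (\int[P]_w f w)%E).
  apply: ge0_le_integral => //.
  - by move=> w _; rewrite lee_fin powR_ge0.
  - apply/measurable_EFinP; apply: (measurableT_comp (measurable_powR _)).
    apply: measurable_funD => //; apply: measurable_funX; apply: measurable_modulus.
    by apply: cmeasurableD; [exact: cmeasurable_cst|apply: cmeasurableM => //;
       exact: cmeasurable_cst].
  - apply/measurable_EFinP; case: (mX) => mX1 mX2.
    have mm := measurable_modulus mX.
    apply: measurable_funD; [apply: measurable_funD; [apply: measurable_funD;
      [apply: measurable_funD|]|]|] => //; apply: measurable_funM => //.
      exact: measurable_funX.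
    exact: (measurableT_comp (measurable_powR _)).
  - move=> w _; rewrite lee_fin.
    have -> : modulus (x + a * X w) ^+ 2 + K * t =
      Q + 2 * (u * complex.Re (X w) + v * complex.Im (X w))
        + modulus a ^+ 2 * modulus (X w) ^+ 2.
      by rewrite expand_sqr /Q /u /v; ring.
    apply: (le_trans (HC _ _ _ Q0 _ _)).
    + by rewrite mulr_ge0 ?sqr_ge0.
    + apply: (@le_trans _ _ (modulus x ^+ 2 * (modulus a ^+ 2 * modulus (X w) ^+ 2))).
        rewrite !sqr_modulus /u /v.
        set X1 := complex.Re (X w); set X2 := complex.Im (X w).
        set x1 := complex.Re x; set x2 := complex.Im x.
        set a1 := complex.Re a; set a2 := complex.Im a.
        (* Lagrange's identity: this square is the defect in the Cauchy-Schwarz inequality for x and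
           a X. *)
        have := sqr_ge0 (x2 * (a1 * X1 - a2 * X2) - x1 * (a1 * X2 + a2 * X1)).
        nra.
      apply: ler_wpM2r; first by rewrite mulr_ge0 ?sqr_ge0.
      by rewrite lerDl mulr_ge0//; lra.
    + rewrite -/q mods -/e; lra.
rewrite Ef lee_fin.
have := @powR_sqr_dev_step _ q C K s mu Q (modulus a ^+ 2) q1 K1 C0 Cs Cmu Q0 (sqr_ge0 _).
rewrite -/e -/q.
have -> : Q + K * modulus a ^+ 2 = modulus x ^+ 2 + K * (t + modulus a ^+ 2).
  by rewrite /Q; ring.
by apply: le_trans; lra.
Qed.

End centered_step.


(** * Marcinkiewicz-Zygmund inequalities for weighted sums *)

Section independent_sums.
Local Open Scope classical_set_scope.
Local Open Scope ring_scope.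
Context d (T : measurableType d) (R : realType) (P : probability T R).
Context (I : countType) (G : I -> set (set T)).
Hypothesis sigmaG : forall i, sigma_algebra setT (G i).
Hypothesis subG : forall i, G i `<=` measurable.
Hypothesis indG : independent P G.

Lemma measurable_join_subset (A B : set I) d' (T' : measurableType d') (f : T -> T') :
  A `<=` B -> measurable_fun setT (f : join_type G A -> T') ->
  measurable_fun setT (f : join_type G B -> T').
Proof.
move=> AB mf _ E mE; rewrite setTI.
have := mf measurableT E mE; rewrite setTI.
by apply: sub_sigma_algebra2; exact: bigcup_subset.
Qed.

Lemma cmeasurable_join_subset (A B : set I) (f : T -> R[i]) :
  A `<=` B -> cmeasurable (f : join_type G A -> R[i]) ->
  cmeasurable (f : join_type G B -> R[i]).
Proof. by move=> AB [f1 f2]; split; [exact: (measurable_join_subset AB f1)|exact: (measurable_join_subset AB f2)]. Qed.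

Lemma cmeasurable_from_join (A : set I) (f : T -> R[i]) :
  cmeasurable (f : join_type G A -> R[i]) -> cmeasurable f.
Proof.
by move=> [f1 f2]; split; [exact: (measurable_from_join subG f1)|exact: (measurable_from_join subG f2)].
Qed.

Lemma cmeasurable_comp d1 (T1 : measurableType d1) d2 (T2 : measurableType d2)
    (f : T2 -> R[i]) (g : T1 -> T2) :
  cmeasurable f -> measurable_fun setT g -> cmeasurable (f \o g).
Proof. by move=> [f1 f2] mg; split; [exact: (measurableT_comp f1 mg)|exact: (measurableT_comp f2 mg)]. Qed.

Definition weighted_sum (xi : I -> T -> R[i]) (a : I -> R[i]) (s : seq I) (w : T) :=
  \sum_(i <- s) a i * xi i w.

Definition weighted_series (xi : I -> T -> R[i]) (a : I -> R[i]) (w : T) :=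
  sumC setT (fun i => a i * xi i w).

Section centered.
Context (xi : I -> T -> R[i]) (p s2 mu : R).
Hypothesis p2 : 2 <= p.
Hypothesis mxi : forall i, cmeasurable (xi i : join_type G [set i] -> R[i]).
Hypothesis Exi1 : forall i, (\int[P]_w (complex.Re (xi i w))%:E = 0)%E.
Hypothesis Exi2 : forall i, (\int[P]_w (complex.Im (xi i w))%:E = 0)%E.
Hypothesis Exi_sqr : forall i, (\int[P]_w (modulus (xi i w) ^+ 2)%:E = s2%:E)%E.
Hypothesis Exi_pow : forall i, (\int[P]_w (modulus (xi i w) `^ p)%:E = mu%:E)%E.
Implicit Types (a : I -> R[i]) (s : seq I).

Local Notation S := (weighted_sum xi).

Let mS a s (A : set I) : (forall i, i \in s -> A i) ->
  cmeasurable (S a s : join_type G A -> R[i]).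
Proof.
elim: s => [|i s IH] sA; rewrite /weighted_sum.
  by under eq_fun do rewrite big_nil; exact: cmeasurable_cst.
under eq_fun do rewrite big_cons; apply: cmeasurableD.
  apply: cmeasurableM; first exact: cmeasurable_cst.
  by apply: cmeasurable_join_subset (mxi i) => j ->; apply: sA; rewrite inE eqxx.
by apply: IH => j js; apply: sA; rewrite inE js orbT.
Qed.

Let mS0 a s : cmeasurable (S a s).
Proof. by apply: (@cmeasurable_from_join setT); exact: mS. Qed.

(* Freezes the sum over [s] and integrates out [xi i] alone. *)
Let integral_S_cons a i s (f : R -> R) : i \notin s ->
  measurable_fun setT f -> (forall x, 0 <= x -> 0 <= f x) ->
  (\int[P]_w (f (modulus (S a (i :: s) w) ^+ 2))%:E =
   \int[P]_w (\int[P]_w' (f (modulus (S a s w + a i * xi i w') ^+ 2))%:E))%E.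
Proof.
move=> is_ mf f0.
pose A := [set` s]; pose B := [set i].
pose h (z : join_type G A * join_type G B) : \bar R :=
  (f (modulus (S a s z.1 + a i * xi i z.2) ^+ 2))%:E.
transitivity (\int[P]_w h (w, w))%E.
  by apply: eq_integral => w _; rewrite /h /weighted_sum big_cons addrC.
rewrite (ge0_integral_freeze sigmaG subG indG)//.
- apply/seteqP; split=> // j [/= js ji]; move: is_.
  by rewrite -ji js.
- apply/measurable_EFinP; apply: (measurableT_comp mf).
  apply: measurable_funX; apply: measurable_modulus; apply: cmeasurableD.
    apply: (@cmeasurable_comp _ _ _ _ (S a s : join_type G A -> R[i]) fst) => //.
    exact: mS.
  apply: cmeasurableM; first exact: cmeasurable_cst.
  apply: (@cmeasurable_comp _ _ _ _ (xi i : join_type G B -> R[i]) snd) => //.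
  exact: mxi.
- by move=> z; rewrite lee_fin f0// sqr_ge0.
Qed.

Let mxi0 i : cmeasurable (xi i).
Proof. exact: (cmeasurable_from_join (mxi i)). Qed.

Lemma integral_sqr_sum a s : uniq s ->
  (\int[P]_w (modulus (S a s w) ^+ 2)%:E =
   (s2 * \sum_(i <- s) modulus (a i) ^+ 2)%:E)%E.
Proof.
elim: s => [_|i s IH /= /andP[is_ us]].
  rewrite big_nil mulr0 -[RHS](integral_probability_cst P).
  by apply: eq_integral => w _; rewrite /weighted_sum big_nil modulusE/= expr0n addr0 sqrtr0 expr0n.
rewrite (@integral_S_cons a i s id)//.
under eq_integral do rewrite (integral_sqr_centered_step (mxi0 i) (Exi1 i)
  (Exi2 i) (Exi_sqr i) (Exi_pow i)) EFinD.
have s0 : 0 <= s2.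
  rewrite -lee_fin -(Exi_sqr i); apply: integral_ge0 => w _.
  by rewrite lee_fin sqr_ge0.
rewrite ge0_integralD//=.
- by rewrite integral_probability_cst IH// -EFinD big_cons; congr EFin; ring.
- by move=> w _; rewrite lee_fin sqr_ge0.
- by apply/measurable_EFinP; apply: measurable_funX; exact: measurable_modulus.
- by move=> w _; rewrite lee_fin mulr_ge0 ?sqr_ge0.
Qed.

(** Integrates out the summands one by one; t is the total squared weight of those already removed.
    The general t is what the induction needs, while t = 0 is the case of interest. *)
Lemma integral_pow_sum (C K : R) a s (t : R) :
  (forall Q c v : R, 0 <= Q -> 0 <= v -> c ^+ 2 <= Q * v ->
    (Q + 2 * c + v) `^ (p / 2) <= Q `^ (p / 2) + p * (Q `^ (p / 2 - 1) * c)
       + C * (Q `^ (p / 2 - 1) * v + v `^ (p / 2))) ->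
  0 <= C -> 1 <= K -> C * s2 <= K / 2 -> C * mu <= K / 2 -> 0 <= t -> uniq s ->
  (\int[P]_w ((modulus (S a s w) ^+ 2 + K * t) `^ (p / 2))%:E <=
   ((K * (t + \sum_(i <- s) modulus (a i) ^+ 2)) `^ (p / 2))%:E)%E.
Proof.
move=> HC C0 K1 Cs Cmu; elim: s t => [|i s IH] t t0 /=.
  move=> _; rewrite big_nil addr0 -[leRHS](integral_probability_cst P).
  rewrite le_eqVlt; apply/orP; left; apply/eqP; apply: eq_integral => w _.
  by rewrite /weighted_sum big_nil modulusE/= expr0n addr0 sqrtr0 expr0n add0r.
move=> /andP[is_ us].
rewrite (@integral_S_cons a i s (fun x => (x + K * t) `^ (p / 2)))//; last first.
- by move=> x _; exact: powR_ge0.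
- by apply: (measurableT_comp (measurable_powR _)); apply: measurable_funD.
have mm (K' t' : R) : measurable_fun setT
    (fun w => ((modulus (S a s w) ^+ 2 + K' * t') `^ (p / 2))%:E).
  apply/measurable_EFinP; apply: (measurableT_comp (measurable_powR _)).
  by apply: measurable_funD => //; apply: measurable_funX; exact: measurable_modulus.
apply: (@le_trans _ _ (\int[P]_w
   ((modulus (S a s w) ^+ 2 + K * (t + modulus (a i) ^+ 2)) `^ (p / 2))%:E))%E.
  apply: ge0_le_integral => //.
  - by move=> w _; apply: integral_ge0 => w' _; rewrite lee_fin powR_ge0.
  - have := @measurable_fun_fubini_tonelli_F _ _ T T R P (fun z : T * T =>
     ((modulus (S a s z.1 + a i * xi i z.2) ^+ 2 + K * t) `^ (p / 2))%:E).
    apply => //; last by move=> z; rewrite lee_fin powR_ge0.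
    apply/measurable_EFinP; apply: (measurableT_comp (measurable_powR _)).
    apply: measurable_funD => //; apply: measurable_funX; apply: measurable_modulus.
    apply: cmeasurableD; first by apply: (@cmeasurable_comp _ _ _ _ (S a s) fst).
    apply: cmeasurableM; first exact: cmeasurable_cst.
    by apply: (@cmeasurable_comp _ _ _ _ (xi i) snd).
  - move=> w _. apply: (integral_pow_centered_step p2 (mxi0 i) (Exi1 i) (Exi2 i)
      (Exi_sqr i) (Exi_pow i)).
    + exact: HC.
    + exact: C0.
    + exact: K1.
    + exact: Cs.
    + exact: Cmu.
    + exact: t0.
apply: (le_trans (IH _ _ us)); first by rewrite addr_ge0 ?sqr_ge0.
by rewrite big_cons addrA.
Qed.

Local Notation q := (p / 2).
Let q1 : 1 <= q. Proof. by rewrite ler_pdivlMr// mul1r. Qed.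
Let q0 : 0 <= q. Proof. exact: le_trans q1. Qed.
Let qp : 2 * q = p. Proof. by field. Qed.

Let powR_modulus_sqr (z : R[i]) : (modulus z ^+ 2) `^ q = modulus z `^ p.
Proof. by rewrite -powR_mulrn ?modulus_ge0// -powRrM qp. Qed.

Let s2_ge0 (i : I) : 0 <= s2.
Proof.
by rewrite -lee_fin -(Exi_sqr i); apply: integral_ge0 => w _; rewrite lee_fin sqr_ge0.
Qed.

Let mu_ge0 (i : I) : 0 <= mu.
Proof.
by rewrite -lee_fin -(Exi_pow i); apply: integral_ge0 => w _; rewrite lee_fin powR_ge0.
Qed.

Let integral_modulus_le i : (\int[P]_w (modulus (xi i w))%:E <= (1 + s2)%:E)%E.
Proof.
have mm := measurable_modulus (mxi0 i).
rewrite EFinD -(Exi_sqr i) -[X in (X + _)%E](integral_probability_cst P).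
rewrite -ge0_integralD//; last 2 first.
- by move=> w _; rewrite lee_fin sqr_ge0.
- exact/measurable_EFinP/measurable_funX.
apply: ge0_le_integral => //.
- by move=> w _; rewrite lee_fin modulus_ge0.
- exact/measurable_EFinP.
- by apply: emeasurable_funD => //; exact/measurable_EFinP/measurable_funX.
- move=> w _; rewrite -EFinD lee_fin.
  by have := sqr_ge0 (modulus (xi i w) - 2^-1); nra.
Qed.

(** The first absolute moments of the summands are bounded by 1 + s2, so the absolute sum has finite
    mean. *)
Lemma ae_asumC_lty a : (asumC a < +oo)%E ->
  {ae P, forall w, (asumC (fun i => (a i * xi i w)%R) < +oo)%E}.
Proof.
move=> aoo; have mterm i : measurable_fun setT (fun w => (modulus (a i * xi i w))%:E).
  apply/measurable_EFinP; apply: measurable_modulus.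
  by apply: cmeasurableM => //; exact: cmeasurable_cst.
have term0 i w : (0 <= (modulus (a i * xi i w))%:E)%E by rewrite lee_fin modulus_ge0.
apply: ge0_integral_lty_ae.
- exact: measurable_fun_esum.
- by move=> w; apply: esum_ge0.
rewrite /asumC integral_esum//.
apply: (@le_lt_trans _ _ (\esum_(i in [set: I]) ((1 + `|s2|)%:E * (modulus (a i))%:E)))%E.
  apply: le_esum => i _.
  under eq_integral do rewrite modulusM EFinM.
  rewrite ge0_integralZl//; last 3 first.
  - exact/measurable_EFinP/measurable_modulus.
  - by move=> w _; rewrite lee_fin modulus_ge0.
  - by rewrite lee_fin modulus_ge0.
  rewrite muleC; apply: lee_wpmul2r; first by rewrite lee_fin modulus_ge0.
  by rewrite ger0_norm ?(s2_ge0 i).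
rewrite esumZl; last 2 first.
- by move=> i; rewrite lee_fin modulus_ge0.
- by rewrite addr_ge0.
by rewrite lte_mul_pinfty// lee_fin addr_ge0.
Qed.

Let mD a : cmeasurable (weighted_series xi a).
Proof.
by apply: cmeasurable_sumC => i; apply: cmeasurableM.
Qed.

Let cvg_S a w z : (asumC (fun i => (a i * xi i w)%R) < +oo)%E ->
  modulus (z - S a (cenum I N) w) @[N --> \oo] -->
  modulus (z - weighted_series xi a w).
Proof. exact: modulus_sumC_cvg. Qed.

(** [integral_pow_sum] at t = 0 bounds all partial sums uniformly, and Fatou's lemma passes to the
    series, which converges absolutely almost surely. *)
Lemma marcinkiewicz_zygmund_le : exists2 K, 0 <= K & forall a, (asumC a < +oo)%E ->
  (\int[P]_w (modulus (weighted_series xi a w) `^ p)%:E <=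
   (K%:E * \esum_(i in setT) (modulus (a i) ^+ 2)%:E) `^ q)%E.
Proof.
have [C C1 HC] := powR_sqr_dev q1.
(* Chosen so that C s2 and C mu are at most K / 2. The absolute values are there because s2 and mu
   are known to be nonnegative only once [I] has an element. *)
pose K := 1 + 2 * C * (`|s2| + `|mu|).
have C0 : 0 <= C by lra.
have K1 : 1 <= K by rewrite /K lerDl !mulr_ge0 ?addr_ge0.
exists K => [|a aoo]; first by lra.
have p1 : 1 <= p by apply: le_trans p2; rewrite ler1n.
apply: (@ae_cvg_integral_le _ _ _ P (fun N w => modulus (S a (cenum I N) w) `^ p)).
- move=> N; apply: (measurableT_comp (measurable_powR _)).
  exact: measurable_modulus.
- by apply: (measurableT_comp (measurable_powR _)); exact: measurable_modulus.
- by move=> N w; exact: powR_ge0.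
- by move=> w; exact: powR_ge0.
- apply: filterS (ae_asumC_lty aoo) => w woo.
  apply: cvg_powR_ge0 => //; [by move=> n; exact: modulus_ge0|].
  have := @cvg_S _ _ 0 woo; rewrite sub0r normcN.
  by under eq_fun do rewrite sub0r normcN.
move=> N; have HC' (Q c v : R) : 0 <= Q -> 0 <= v -> c ^+ 2 <= Q * v ->
    (Q + 2 * c + v) `^ (p / 2) <= Q `^ (p / 2) + p * (Q `^ (p / 2 - 1) * c)
       + C * (Q `^ (p / 2 - 1) * v + v `^ (p / 2)).
  by move=> Q0 v0 cQv; have := HC _ _ _ Q0 v0 cQv; rewrite qp.
have Cs : C * s2 <= K / 2.
  by rewrite /K; have := ler_norm s2; have := normr_ge0 mu; nra.
have Cm : C * mu <= K / 2.
  by rewrite /K; have := ler_norm mu; have := normr_ge0 s2; nra.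
have := @integral_pow_sum C K a (cenum I N) 0 HC' C0 K1 Cs Cm (lexx _) (cenum_uniq I N).
under eq_integral do rewrite mulr0 addr0 powR_modulus_sqr.
move=> /le_trans; apply; rewrite add0r -poweR_EFin EFinM -sumEFin.
have s0 N' : (0 <= \sum_(i <- cenum I N') (modulus (a i) ^+ 2)%:E)%E.
  by apply: sume_ge0 => i _; rewrite lee_fin sqr_ge0.
have se : (\sum_(i <- cenum I N) (modulus (a i) ^+ 2)%:E <=
   \esum_(i in [set: I]) (modulus (a i) ^+ 2)%:E)%E.
  by apply: (@cenum_esum_le _ _ (fun i => (modulus (a i) ^+ 2)%:E)) => i;
    rewrite lee_fin sqr_ge0.
have K0 : (0 <= K%:E)%E by rewrite lee_fin; lra.
apply: gt0_ler_poweR => //.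
- by rewrite in_itv/= leey andbT mule_ge0.
- by rewrite in_itv/= leey andbT mule_ge0// (le_trans _ se).
- exact: lee_wpmul2l.
Qed.

(** Fatou's lemma bounds the second moment of the tail, E|S_N - D|^2 <= s2 (A - A_N). With |S_N|^2
    <= 2|D|^2 + 2|S_N - D|^2 this gives 3 s2 A_N <= 2 E|D|^2 + 2 s2 A, and N tends to infinity. The
    factor 1/2 is the cost of that quadratic inequality. *)
Let integral_sqr_ge a : (asumC a < +oo)%E ->
  (\esum_(i in setT) (modulus (a i) ^+ 2)%:E < +oo)%E ->
  ((s2 / 2)%:E * (\esum_(i in setT) (modulus (a i) ^+ 2)%:E) <=
   \int[P]_w (modulus (weighted_series xi a w) ^+ 2)%:E)%E.
Proof.
move=> aoo a2oo.
set D := weighted_series xi a.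
set A := (\esum_(i in setT) (modulus (a i) ^+ 2)%:E)%E.
have A0 : (0 <= A)%E by apply: esum_ge0 => i _; rewrite lee_fin sqr_ge0.
have Afin : A \is a fin_num by rewrite ge0_fin_numE.
pose AN N := \sum_(i <- cenum I N) modulus (a i) ^+ 2.
have ANA N : AN N <= fine A.
  rewrite -lee_fin fineK// -sumEFin.
  by apply: (@cenum_esum_le _ _ (fun i => (modulus (a i) ^+ 2)%:E)) => i;
    rewrite lee_fin sqr_ge0.
have ANcvg : AN N @[N --> \oo] --> fine A.
  have := @cenum_esum_cvg I R (fun i => (modulus (a i) ^+ 2)%:E)
    (fun i => sqr_ge0 (modulus (a i))).
  rewrite -/A -(fineK Afin) => /fine_cvg.
  by rewrite /comp/=; under eq_fun do rewrite sumEFin/=.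
have [E2|] := boolP (\int[P]_w (modulus (D w) ^+ 2)%:E < +oo)%E; last first.
  by rewrite -leNgt leye_eq => /eqP ->; rewrite leey.
have E0 : (0 <= \int[P]_w (modulus (D w) ^+ 2)%:E)%E.
  by apply: integral_ge0 => w _; rewrite lee_fin sqr_ge0.
have Efin : (\int[P]_w (modulus (D w) ^+ 2)%:E)%E \is a fin_num by rewrite ge0_fin_numE.
case: (pselect (exists i : I, True)) => [[i0 _]|noI]; last first.
  rewrite (_ : A = 0%E) ?mule0//; apply: esum1 => i _; exfalso; apply: noI.
  by exists i.
have s0 := s2_ge0 i0.
have tail N : (\int[P]_w (modulus (S a (cenum I N) w - D w) ^+ 2)%:E <=
    (s2 * (fine A - AN N))%:E)%E.
  apply: (@ae_cvg_integral_le _ _ _ P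
    (fun k w => modulus (S a (cenum I N) w - S a (cenum I (k + N)) w) ^+ 2)).
  - move=> k; apply: measurable_funX; apply: measurable_modulus.
    by apply: cmeasurableB; exact: mS0.
  - apply: measurable_funX; apply: measurable_modulus.
    by apply: cmeasurableB; [exact: mS0|exact: mD].
  - by move=> *; exact: sqr_ge0.
  - by move=> *; exact: sqr_ge0.
  - apply: filterS (ae_asumC_lty aoo) => w woo.
    have sq (u : nat -> R) (l : R) : u n @[n --> \oo] --> l ->
        u n ^+ 2 @[n --> \oo] --> l ^+ 2.
      by move=> ul; apply: (continuous_cvg _ (@exprn_continuous R 2 l) ul).
    by apply: sq; have := @cvg_S _ _ (S a (cenum I N) w) woo; rewrite -(cvg_shiftn N).
  move=> k; pose r := pmap (@pickle_inv I) (iota N k).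
  have cE : cenum I (k + N) = cenum I N ++ r.
    by rewrite /cenum addnC iotaD add0n pmap_cat.
  have ur : uniq r by have := cenum_uniq I (k + N); rewrite cE cat_uniq => /and3P[].
  rewrite (eq_integral (fun w => (modulus (S a r w) ^+ 2)%:E)); last first.
    move=> w _; rewrite cE /weighted_sum big_cat/= opprD addNKr.
    by rewrite normcN.
  rewrite integral_sqr_sum// lee_fin ler_wpM2l// lerBrDl.
  by have := ANA (k + N)%N; rewrite /AN cE big_cat.
have key N : 3 * s2 * AN N <=
    2 * fine (\int[P]_w (modulus (D w) ^+ 2)%:E)%E + 2 * s2 * fine A.
  have mDD := mD a.
  have mSD : cmeasurable (fun w => S a (cenum I N) w - D w).
    by apply: cmeasurableB; [exact: mS0|exact: mD].
  have mm2 (f : T -> R[i]) : cmeasurable f -> measurable_fun setT (fun w => (modulus (f w) ^+ 2)%:E).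
    by move=> mf; apply/measurable_EFinP; apply: measurable_funX; exact: measurable_modulus.
  have : (\int[P]_w (modulus (S a (cenum I N) w) ^+ 2)%:E <=
    \int[P]_w (2%:E * (modulus (D w) ^+ 2)%:E
                + 2%:E * (modulus (S a (cenum I N) w - D w) ^+ 2)%:E))%E.
    apply: ge0_le_integral => //.
    - by move=> w _; rewrite lee_fin sqr_ge0.
    - exact: mm2.
    - by apply: emeasurable_funD; apply: measurable_funeM; exact: mm2.
    - move=> w _; rewrite -!EFinM -EFinD lee_fin.
      have h := le_normcD (D w) (S a (cenum I N) w - D w).
      rewrite addrC subrK in h.
      have g := modulus_ge0 (S a (cenum I N) w).
      have := sqr_ge0 (modulus (D w) - modulus (S a (cenum I N) w - D w)).
      nra.
  rewrite integral_sqr_sum ?cenum_uniq// ge0_integralD//; last 4 first.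
  - by move=> w _; rewrite -EFinM lee_fin mulr_ge0 ?sqr_ge0.
  - by apply: measurable_funeM; exact: mm2.
  - by move=> w _; rewrite -EFinM lee_fin mulr_ge0 ?sqr_ge0.
  - by apply: measurable_funeM; exact: mm2.
  rewrite !ge0_integralZl//; last 4 first.
  - exact: mm2.
  - by move=> w _; rewrite lee_fin sqr_ge0.
  - exact: mm2.
  - by move=> w _; rewrite lee_fin sqr_ge0.
  rewrite -/(AN N) -(fineK Efin) => h.
  have : ((s2 * AN N)%:E <= 2%:E * (fine (\int[P]_w (modulus (D w) ^+ 2)%:E))%:E
      + 2%:E * (s2 * (fine A - AN N))%:E)%E.
    by apply: (le_trans h); apply: leeD => //; apply: lee_wpmul2l.
  by rewrite -!EFinM -EFinD lee_fin; nra.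
rewrite -(fineK Afin) -(fineK Efin) -EFinM lee_fin.
have : 3 * s2 * fine A <=
    2 * fine (\int[P]_w (modulus (D w) ^+ 2)%:E)%E + 2 * s2 * fine A.
  have c3 : 3 * s2 * AN N @[N --> \oo] --> 3 * s2 * fine A by exact: cvgMr.
  rewrite -(cvg_lim _ c3)//; apply: limr_le; first by apply/cvg_ex; eexists; exact: c3.
  by apply: nearW => N; exact: key.
lra.
Qed.

(** Jensen's inequality for x^q, obtained by integrating the tangent at v = (s2 / 2) A against
    |D|^2, whose mean is at least v. In this form an infinite p-th moment needs no separate
    treatment. *)
Lemma marcinkiewicz_zygmund_ge a : (asumC a < +oo)%E ->
  (\esum_(i in setT) (modulus (a i) ^+ 2)%:E < +oo)%E ->
  (((s2 / 2)%:E * \esum_(i in setT) (modulus (a i) ^+ 2)%:E) `^ q <=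
   \int[P]_w (modulus (weighted_series xi a w) `^ p)%:E)%E.
Proof.
move=> aoo a2oo; have := integral_sqr_ge aoo a2oo.
set D := weighted_series xi a.
set A := (\esum_(i in setT) (modulus (a i) ^+ 2)%:E)%E.
have A0 : (0 <= A)%E by apply: esum_ge0 => i _; rewrite lee_fin sqr_ge0.
have Afin : A \is a fin_num by rewrite ge0_fin_numE.
case: (pselect (exists i : I, True)) => [[i0 _]|noI]; last first.
  rewrite (_ : A = 0%E) ?mule0; last first.
    by apply: esum1 => i _; exfalso; apply: noI; exists i.
  rewrite poweR0r; last by rewrite gt_eqF// (lt_le_trans _ q1).
  by move=> _; apply: integral_ge0 => w _; rewrite lee_fin powR_ge0.
have s0 := s2_ge0 i0.
rewrite -(fineK Afin) -EFinM; set v := s2 / 2 * fine A => vE.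
have v0 : 0 <= v by rewrite /v !mulr_ge0 ?fine_ge0.
rewrite poweR_EFin.
have mm := measurable_modulus (mD a).
have h : (\int[P]_w ((q * v `^ (q - 1))%:E * (modulus (D w) ^+ 2)%:E) <=
    \int[P]_w ((modulus (D w) `^ p)%:E + ((q - 1) * v `^ q)%:E))%E.
  apply: ge0_le_integral => //.
  - by move=> w _; rewrite -EFinM lee_fin mulr_ge0 ?sqr_ge0// mulr_ge0 ?powR_ge0.
  - by apply: measurable_funeM; exact/measurable_EFinP/measurable_funX.
  - apply: emeasurable_funD => //; apply/measurable_EFinP.
    exact: (measurableT_comp (measurable_powR _)).
  - move=> w _; rewrite -EFinM -EFinD lee_fin -powR_modulus_sqr.
    have := powR_tangent q1 (sqr_ge0 (modulus (D w))) v0.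
    have := @mulr_powRB1 _ v q v0 (lt_le_trans ltr01 q1).
    nra.
rewrite ge0_integralZl// in h; last 3 first.
- exact/measurable_EFinP/measurable_funX.
- by move=> w _; rewrite lee_fin sqr_ge0.
- by rewrite lee_fin mulr_ge0 ?powR_ge0.
rewrite ge0_integralD// in h; last 3 first.
- by move=> w _; rewrite lee_fin powR_ge0.
- by apply/measurable_EFinP; exact: (measurableT_comp (measurable_powR _)).
- by move=> w _; rewrite lee_fin mulr_ge0 ?powR_ge0// subr_ge0.
rewrite integral_probability_cst in h.
have {}h : ((q * v `^ (q - 1))%:E * v%:E <=
   \int[P]_w (modulus (D w) `^ p)%:E + ((q - 1) * v `^ q)%:E)%E.
  apply: le_trans h; apply: lee_wpmul2l => //.
  by rewrite lee_fin mulr_ge0 ?powR_ge0.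
rewrite -(@leeD2rE _ ((q - 1) * v `^ q)%:E)//; apply: le_trans h.
rewrite -EFinM -EFinD lee_fin.
have e := @mulr_powRB1 _ v q v0 (lt_le_trans ltr01 q1).
have -> : q * v `^ (q - 1) * v = q * (v * v `^ (q - 1)) by ring.
by rewrite e; lra.
Qed.

End centered.
End independent_sums.


(** * Moments of weighted sums of independent nonnegative variables *)

Section nonnegative_sums.
Local Open Scope classical_set_scope.
Local Open Scope ring_scope.
Context d (T : measurableType d) (R : realType) (P : probability T R).
Context (I : countType) (G : I -> set (set T)).
Hypothesis sigmaG : forall i, sigma_algebra setT (G i).
Hypothesis subG : forall i, G i `<=` measurable.
Hypothesis indG : independent P G.
Context (eta : I -> T -> R) (q rho mu : R).
Hypothesis q1 : 1 <= q.
Hypothesis eta0 : forall i w, 0 <= eta i w.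
Hypothesis meta : forall i, measurable_fun setT (eta i : join_type G [set i] -> R).
Hypothesis Eeta : forall i, (\int[P]_w (eta i w)%:E <= rho%:E)%E.
Hypothesis Eeta_pow : forall i, (\int[P]_w (eta i w `^ q)%:E <= mu%:E)%E.
Implicit Types (l : I -> R) (s : seq I).

Let meta0 i : measurable_fun setT (eta i).
Proof. by apply: (measurable_from_join subG (A := [set i])); exact: meta. Qed.

(** [powR_add_le] leaves a linear term with mean at most (q + e) rho x^(q-1) l. As (q + e) rho <= q
    rho', the tangent of the power at x absorbs it into (x + rho' l)^q. *)
Let integral_pow_step C e rho' i (x l : R) : 0 <= C -> 0 <= q + e ->
  (forall x y : R, 0 <= x -> 0 <= y ->
    (x + y) `^ q <= x `^ q + (q + e) * (x `^ (q - 1) * y) + C * y `^ q) ->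
  (q + e) * rho <= q * rho' -> 0 <= rho' -> 0 <= x -> 0 <= l ->
  (\int[P]_w ((x + l * eta i w) `^ q)%:E <=
   ((x + rho' * l) `^ q + C * mu * l `^ q)%:E)%E.
Proof.
move=> C0 qe0 HC rr rho0 x0 l0.
have e0 : 0 <= x `^ (q - 1) by exact: powR_ge0.
pose b := (q + e) * (x `^ (q - 1) * l).
have b0 : 0 <= b by rewrite /b !mulr_ge0.
have c0 : 0 <= C * l `^ q by rewrite mulr_ge0 ?powR_ge0.
have mpow : measurable_fun setT (fun w => (eta i w `^ q)%:E).
  by apply/measurable_EFinP; apply: (measurableT_comp (measurable_powR _)).
have meta1 : measurable_fun setT (fun w => (eta i w)%:E) by exact/measurable_EFinP.
apply: (@le_trans _ _ (\int[P]_w ((x `^ q)%:E + b%:E * (eta i w)%:E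
    + (C * l `^ q)%:E * (eta i w `^ q)%:E))%E).
  apply: ge0_le_integral => //.
  - by move=> w _; rewrite lee_fin powR_ge0.
  - apply/measurable_EFinP; apply: (measurableT_comp (measurable_powR _)).
    by apply: measurable_funD => //; exact: measurable_funM.
  - by apply: emeasurable_funD; [apply: emeasurable_funD => //|];
      exact: measurable_funeM.
  - move=> w _; rewrite -!EFinM -!EFinD lee_fin.
    apply: (le_trans (HC _ _ x0 (mulr_ge0 l0 (eta0 i w)))).
    by rewrite powRM// /b; lra.
rewrite ge0_integralD//; last 4 first.
- move=> w _; rewrite -EFinM -EFinD lee_fin addr_ge0 ?powR_ge0// mulr_ge0//.
- by apply: emeasurable_funD => //; exact: measurable_funeM.
- by move=> w _; rewrite -EFinM lee_fin mulr_ge0// powR_ge0.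
- exact: measurable_funeM.
rewrite ge0_integralD//; last 3 first.
- by move=> w _; rewrite lee_fin powR_ge0.
- by move=> w _; rewrite -EFinM lee_fin mulr_ge0.
- exact: measurable_funeM.
rewrite integral_probability_cst !ge0_integralZl//; last 2 first.
- by move=> w _; rewrite lee_fin powR_ge0.
- by move=> w _; rewrite lee_fin.
apply: (@le_trans _ _ ((x `^ q)%:E + b%:E * rho%:E + (C * l `^ q)%:E * mu%:E)%E).
  by apply: leeD; [apply: leeD => //|]; apply: lee_wpmul2l.
rewrite -!EFinM -!EFinD lee_fin.
have := powR_tangent q1 (addr_ge0 x0 (mulr_ge0 rho0 l0)) x0.
have : (x `^ (q - 1) * l) * ((q + e) * rho) <= (x `^ (q - 1) * l) * (q * rho').
  by rewrite ler_wpM2l// mulr_ge0.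
by rewrite /b; nra.
Qed.

(** The offset x collects rho' l_i for the summands already integrated out. *)
Let integral_pow_finite C e rho' l s x : 0 <= C -> 0 <= q + e ->
  (forall x y : R, 0 <= x -> 0 <= y ->
    (x + y) `^ q <= x `^ q + (q + e) * (x `^ (q - 1) * y) + C * y `^ q) ->
  (q + e) * rho <= q * rho' -> 0 <= rho' -> (forall i, 0 <= l i) -> uniq s ->
  0 <= x ->
  (\int[P]_w ((\sum_(i <- s) l i * eta i w + x) `^ q)%:E <=
   ((rho' * (\sum_(i <- s) l i) + x) `^ q + C * mu * \sum_(i <- s) (l i) `^ q)%:E)%E.
Proof.
move=> C0 qe0 HC rr rho0 l0; elim: s x => [|i s IH] x /=.
  move=> _ x0; rewrite !big_nil !mulr0 add0r addr0.
  under eq_integral do rewrite big_nil add0r.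
  by rewrite integral_probability_cst.
move=> /andP[is_ us] x0.
have sum0 s' w : 0 <= \sum_(i <- s') l i * eta i w.
  by apply: sumr_ge0 => j _; rewrite mulr_ge0.
have msum s' (A : set I) : (forall i, i \in s' -> A i) ->
    measurable_fun setT ((fun w => \sum_(i <- s') l i * eta i w) : join_type G A -> R).
  elim: s' => [|j s' IH'] sA; first by under eq_fun do rewrite big_nil; exact: measurable_cst.
  under eq_fun do rewrite big_cons; apply: measurable_funD.
    apply: measurable_funM => //.
    apply: (measurable_join_subset (A := [set j]) (B := A) (f := eta j)) => //.
    by move=> k ->; apply: sA; rewrite inE eqxx.
  by apply: IH' => k ks; apply: sA; rewrite inE ks orbT.
have msum0 s' : measurable_fun setT (fun w => \sum_(i <- s') l i * eta i w).
  by apply: (measurable_from_join subG (A := setT)); exact: msum.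
pose h (z : join_type G [set` s] * join_type G [set i]) : \bar R :=
  ((\sum_(i <- s) l i * eta i z.1 + x + l i * eta i z.2) `^ q)%:E.
have -> : (\int[P]_w ((\sum_(j <- i :: s) l j * eta j w + x) `^ q)%:E =
    \int[P]_w h (w, w))%E.
  by apply: eq_integral => w _; rewrite /h big_cons /=; congr (_ `^ _)%:E; ring.
rewrite (ge0_integral_freeze sigmaG subG indG); last 3 first.
- apply/seteqP; split=> // j [/= js ji]; move: is_.
  by rewrite -ji js.
- apply/measurable_EFinP; apply: (measurableT_comp (measurable_powR _)).
  apply: measurable_funD; first apply: measurable_funD => //.
    apply: (@measurableT_comp _ _ _ _ _ _ ((fun w => \sum_(i <- s) l i * eta i w) : join_type G [set` s] -> R) _ fst) => //.
    exact: msum.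
  apply: measurable_funM => //.
  by apply: (@measurableT_comp _ _ _ _ _ _ (eta i : join_type G [set i] -> R) _ snd).
- by move=> z; rewrite lee_fin powR_ge0.
apply: (@le_trans _ _ (\int[P]_w (((\sum_(i <- s) l i * eta i w + (x + rho' * l i)) `^ q)%:E
   + (C * mu * (l i) `^ q)%:E))%E).
  have mu0 : 0 <= mu.
    rewrite -lee_fin; apply: le_trans (Eeta_pow i); apply: integral_ge0 => w _.
    by rewrite lee_fin powR_ge0.
  apply: ge0_le_integral => //.
  - by move=> w _; apply: integral_ge0 => w' _; rewrite lee_fin powR_ge0.
  - have := @measurable_fun_fubini_tonelli_F _ _ T T R P (fun z : T * T =>
      ((\sum_(i <- s) l i * eta i z.1 + x + l i * eta i z.2) `^ q)%:E).
    apply => //; last by move=> z; rewrite lee_fin powR_ge0.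
    apply/measurable_EFinP; apply: (measurableT_comp (measurable_powR _)).
    apply: measurable_funD; first apply: measurable_funD => //.
      by apply: (@measurableT_comp _ _ _ _ _ _ (fun w => \sum_(i <- s) l i * eta i w) _ fst).
    apply: measurable_funM => //.
    by apply: (@measurableT_comp _ _ _ _ _ _ (eta i) _ snd).
  - apply: emeasurable_funD => //; apply/measurable_EFinP.
    apply: (measurableT_comp (measurable_powR _)).
    exact: measurable_funD.
  - move=> w _; rewrite -EFinD.
    have -> : \sum_(j <- s) l j * eta j w + (x + rho' * l i) =
      \sum_(j <- s) l j * eta j w + x + rho' * l i by rewrite addrA.
    exact: (integral_pow_step i C0 qe0 HC rr rho0 (addr_ge0 (sum0 s w) x0) (l0 i)).
have mu0 : 0 <= mu.
  rewrite -lee_fin; apply: le_trans (Eeta_pow i); apply: integral_ge0 => w _.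
  by rewrite lee_fin powR_ge0.
rewrite ge0_integralD//; last 3 first.
- by move=> w _; rewrite lee_fin powR_ge0.
- apply/measurable_EFinP; apply: (measurableT_comp (measurable_powR _)).
  exact: measurable_funD.
- by move=> w _; rewrite lee_fin !mulr_ge0 ?powR_ge0.
rewrite integral_probability_cst.
have xl0 : 0 <= x + rho' * l i by rewrite addr_ge0 ?mulr_ge0.
apply: (le_trans (leeD2r _ (IH _ us xl0))).
rewrite -EFinD lee_fin !big_cons.
have -> : rho' * (l i + \sum_(j <- s) l j) + x =
  rho' * (\sum_(j <- s) l j) + (x + rho' * l i) by ring.
by lra.
Qed.

(** A Rosenthal-type bound whose leading constant is as close to the mean as desired. That sharpness
    is essential: with rho' < 1 the first term becomes a contraction. *)
Lemma integral_pow_series_le rho' : 0 <= rho -> rho < rho' ->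
  exists2 C, 0 <= C & forall l, (forall i, 0 <= l i) ->
  (\int[P]_w ((\esum_(i in setT) (l i * eta i w)%:E) `^ q) <=
   (rho'%:E * \esum_(i in setT) (l i)%:E) `^ q +
   C%:E * \esum_(i in setT) ((l i) `^ q)%:E)%E.
Proof.
move=> rho0 rr.
(* Gives e (rho + 1) = q (rho' - rho), hence (q + e) rho <= q rho'; the added 1 guards against rho =
   0. *)
pose e := q * (rho' - rho) / (rho + 1).
have e0 : 0 < e by rewrite /e divr_gt0 ?mulr_gt0 ?subr_gt0 ?ltr_wpDl//; exact: lt_le_trans q1.
have [C C1 HC] := powR_add_le q1 e0.
have C0 : 0 <= C by lra.
have q0 : 0 < q by exact: lt_le_trans q1.
have qe0 : 0 <= q + e by rewrite addr_ge0// ltW.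
have rho'0 : 0 < rho' by exact: le_lt_trans rr.
have rr' : (q + e) * rho <= q * rho'.
  have : e * (rho + 1) = q * (rho' - rho) by rewrite /e divfK// gt_eqF// ltr_wpDl.
  by nra.
exists (C * `|mu|) => [|l l0]; first by rewrite mulr_ge0.
(* If the total weight is infinite then so is the right-hand side, because rho' > 0. *)
have [soo|] := boolP (\esum_(i in [set: I]) (l i)%:E < +oo)%E; last first.
  rewrite -leNgt leye_eq => /eqP ->.
  rewrite gt0_muley ?lte_fin// poweRyr ?gt_eqF// addye ?leey//.
  rewrite gt_eqF// (@lt_le_trans _ _ 0%E)// mule_ge0//.
    by rewrite lee_fin mulr_ge0.
  by apply: esum_ge0 => i _; rewrite lee_fin powR_ge0.
have term0 i w : (0 <= (l i * eta i w)%:E)%E by rewrite lee_fin mulr_ge0.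
have mterm i : measurable_fun setT (fun w => (l i * eta i w)%:E).
  by apply/measurable_EFinP; exact: measurable_funM.
have mes := measurable_fun_esum term0 mterm.
have aefin : {ae P, forall w, (\esum_(i in [set: I]) (l i * eta i w)%:E < +oo)%E}.
  apply: ge0_integral_lty_ae => //; first by move=> w; exact: esum_ge0.
  rewrite integral_esum//.
  apply: (@le_lt_trans _ _ (\esum_(i in [set: I]) (rho%:E * (l i)%:E)))%E.
    apply: le_esum => i _; under eq_integral do rewrite EFinM.
    rewrite ge0_integralZl//.
    - by rewrite muleC; apply: lee_wpmul2r; rewrite ?lee_fin.
    - exact/measurable_EFinP.
    - by move=> w _; rewrite lee_fin.
    - by rewrite lee_fin.
  by rewrite esumZl// lte_mul_pinfty.
rewrite (@ge0_ae_eq_integral _ _ _ P setT _ (fun w => (fine (\esum_(i in [set: I]) (l i * eta i w)%:E) `^ q)%:E)%E)//; last 5 first.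
- exact: (measurableT_comp (measurable_poweR _)).
- apply/measurable_EFinP; apply: (measurableT_comp (measurable_powR _)).
  exact: (measurableT_comp (@fine_measurable R _ measurableT)).
- by move=> w _; exact: poweR_ge0.
- by move=> w _; rewrite lee_fin powR_ge0.
- apply: filterS aefin => w woo _.
  by rewrite -poweR_EFin fineK// ge0_fin_numE// esum_ge0.
apply: (@ae_cvg_integral_le _ _ _ P (fun N w => (\sum_(i <- cenum I N) l i * eta i w + 0) `^ q)).
- move=> N; apply: (measurableT_comp (measurable_powR _)).
  apply: measurable_funD => //; apply: measurable_sum => i.
  exact: measurable_funM.
- apply: (measurableT_comp (measurable_powR _)).
  exact: (measurableT_comp (@fine_measurable R _ measurableT)).
- by move=> *; exact: powR_ge0.
- by move=> *; exact: powR_ge0.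
- apply: filterS aefin => w woo; apply: cvg_powR_ge0 => //.
    by move=> N; rewrite addr0; apply: sumr_ge0 => i _; rewrite mulr_ge0.
  under eq_fun do rewrite addr0.
  have := @cenum_esum_cvg I R (fun i => (l i * eta i w)%:E) (term0^~ w).
  have sfin : (\esum_(i in [set: I]) (l i * eta i w)%:E)%E \is a fin_num.
    by rewrite ge0_fin_numE// esum_ge0.
  rewrite -(fineK sfin) => /fine_cvg.
  by rewrite /comp/=; under eq_fun do rewrite sumEFin/=.
move=> N; apply: (le_trans (@integral_pow_finite C e rho' l (cenum I N) 0 C0 qe0 HC
   rr' (ltW rho'0) l0 (cenum_uniq I N) (lexx _))).
rewrite addr0 EFinD; apply: leeD.
  have s0 : (0 <= \sum_(i <- cenum I N) (l i)%:E)%E by apply: sume_ge0 => i _; rewrite lee_fin.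
  have se : (\sum_(i <- cenum I N) (l i)%:E <= \esum_(i in [set: I]) (l i)%:E)%E.
    by apply: (@cenum_esum_le _ _ (fun i => (l i)%:E)) => i; rewrite lee_fin.
  rewrite -poweR_EFin EFinM -sumEFin; apply: gt0_ler_poweR; first exact: ltW.
  - by rewrite in_itv/= leey andbT mule_ge0// lee_fin ltW.
  - by rewrite in_itv/= leey andbT mule_ge0// ?lee_fin ?(ltW rho'0)// (le_trans _ se).
  - by apply: lee_wpmul2l => //; rewrite lee_fin ltW.
rewrite EFinM -sumEFin.
apply: (@le_trans _ _ ((C * `|mu|)%:E * \sum_(i <- cenum I N) ((l i) `^ q)%:E)%E).
  apply: lee_wpmul2r; first by apply: sume_ge0 => i _; rewrite lee_fin powR_ge0.
  by rewrite lee_fin ler_wpM2l// ler_norm.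
apply: lee_wpmul2l; first by rewrite lee_fin mulr_ge0.
by apply: (@cenum_esum_le _ _ (fun i => ((l i) `^ q)%:E)) => i; rewrite lee_fin powR_ge0.
Qed.

End nonnegative_sums.


(** * Point processes *)

Section measures_on_the_line.
Local Open Scope classical_set_scope.
Local Open Scope ring_scope.
Context (R : realType).

(** An alias able to carry the equality, choice and point structures that a measurable type
    requires. *)
Definition measures := {measure set R -> \bar R}.

HB.instance Definition _ := gen_eqMixin measures.
HB.instance Definition _ := gen_choiceMixin measures.
HB.instance Definition _ := isPointed.Build measures mzero.

Definition evaluation_events : set (set measures) :=
  [set E | exists (B : set R) (C : set (\bar R)),
     [/\ measurable B, measurable C & E = [set mu : measures | C (mu B)]]].

Definition measure_space := g_sigma_algebraType evaluation_events.

Lemma measurable_evaluation (B : set R) : measurable B ->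
  measurable_fun setT (fun mu : measure_space => (mu : measures) B).
Proof.
move=> mB _ C mC; rewrite setTI; apply: sub_sigma_algebra.
by exists B, C.
Qed.

Import HBNNSimple.

(** For a simple function the integral is a finite combination of evaluations; monotone convergence
    does the rest. *)
Lemma measurable_integral_against (f : R -> \bar R) :
  measurable_fun setT f -> (forall x, 0 <= f x)%E ->
  measurable_fun setT (fun mu : measure_space => (\int[(mu : measures)]_x f x)%E).
Proof.
move=> mf f0; pose g := nnsfun_approx measurableT mf.
pose F n (mu : measure_space) := (\int[(mu : measures)]_x (g n x)%:E)%E.
have mF n : measurable_fun setT (F n).
  rewrite /F; under eq_fun do rewrite integralT_nnsfun sintegralE.
  apply: emeasurable_fsum => //= r.
  by apply: measurable_funeM => //=; exact: measurable_evaluation.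
apply: (emeasurable_fun_cvg _ _ mF) => mu _.
rewrite (_ : (\int[_]_x f x)%E =
    (\int[(mu : measures)]_x limn (fun n => (g n x)%:E))%E).
  apply: cvg_monotone_convergence => //.
  - by move=> n; exact/measurable_EFinP.
  - by move=> n x _; rewrite lee_fin.
  - by move=> t _ n m nm; rewrite lee_fin; exact/lefP/nd_nnsfun_approx.
apply: eq_integral => t _.
by apply/esym/cvg_lim => //; exact/cvg_nnsfun_approx.
Qed.

End measures_on_the_line.

(** * Functionals of the reproduction point processes *)

Section point_process_law.
Local Open Scope classical_set_scope.
Local Open Scope ring_scope.
Context d (T : measurableType d) (R : realType) (P : probability T R).
Context (M : reproduction T R).
Hypothesis HM : supercritical_brw P M.
Implicit Types (u : seq nat) (w : T).

Lemma integral_point_process u w (f : R -> \bar R) : measurable_fun setT f ->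
  (forall x, 0 <= f x)%E ->
  (\int[point_process M u w]_x f x =
   \esum_(i in setT) (if has_child M u i w then f (X M u i w) else 0))%E.
Proof.
move=> mf f0; rewrite /point_process ge0_integral_measure_series//.
rewrite -nneseries_esumT; last by move=> i; case: ifP.
congr (limn _); apply/funext => n; apply: eq_bigr => i _.
by case: ifP => _; [rewrite integral_dirac// diracT mul1e|rewrite integral_measure_zero].
Qed.

(** The mass given to a Borel set B is the sum of the indicators of the events
    [child_event M u i B]. *)
Lemma measurable_point_process u :
  measurable_fun setT (fun w => point_process M u w : measure_space R).
Proof.
apply: (@measurability d _ T (measure_space R) setT _ (@evaluation_events R)) => //.
move=> _ [_ [B [C [mB mC ->]]] <-].
rewrite setTI (_ : _ @^-1` _ = (fun w => point_process M u w B) @^-1` C)//.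
rewrite -[X in measurable X]setTI.
suff : measurable_fun setT (fun w => point_process M u w B) by apply.
rewrite (_ : (fun w => _) =
    (fun w => \esum_(i in setT) (\1_(child_event M u i B) w)%:E)%E); last first.
  apply/funext => w; rewrite -nneseries_esumT//.
  apply: congr_lim; apply/funext => n; apply: eq_bigr => i _.
  rewrite /child_event indicE; case: ifPn => hc.
    rewrite /= /dirac indicE; congr (_%:R)%:E; congr nat_of_bool.
    by apply/idP/idP; rewrite !inE//= => -[].
  rewrite /mzero memNset//=; case=> hc'; by rewrite hc' in hc.
apply: measurable_fun_esum => // i; apply/measurable_EFinP.
by apply: measurable_indic; exact: (brw_measurable HM).
Qed.

(** The only way in which equality in law enters. The numbering of children may have a different law
    at different words, so only functionals of the point process can be compared. *)
Lemma same_point_process_integral u (F : measure_space R -> \bar R) :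
  measurable_fun setT F -> (forall mu, 0 <= F mu)%E ->
  (\int[P]_w F (point_process M u w) = \int[P]_w F (point_process M [::] w))%E.
Proof.
move=> mF F0.
pose pm v := isMeasurableFun.Build _ _ _ _ _ (measurable_point_process v).
pose pp v : {mfun T >-> measure_space R} :=
  HB.pack (fun w => point_process M v w : measure_space R) (pm v).
transitivity (\int[distribution P (pp u)]_z F z)%E.
  by rewrite ge0_integral_distribution.
transitivity (\int[distribution P (pp [::])]_z F z)%E; last first.
  by rewrite ge0_integral_distribution.
apply: eq_measure_integral => E mE _.
exact: (brw_identically_distributed HM).
Qed.

End point_process_law.


(** * Weights of the branching random walk *)

Section weights.
Local Open Scope classical_set_scope.
Local Open Scope ring_scope.
Context d (T : measurableType d) (R : realType) (P : probability T R).
Context (M : reproduction T R) (lambda : R[i]).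
Implicit Types (u : seq nat) (w : T).
Notation Re := complex.Re.
Notation Im := complex.Im.

Definition displacement_weight (x : R) : R[i] :=
  expC (- lambda * x%:C%C) / m P M lambda.

Definition child_weight u i w : R[i] :=
  if has_child M u i w then displacement_weight (X M u i w) else 0.

(* [e^(-lambda S(u)) / m(lambda)^|u|] if [u] is born, and 0 otherwise. *)
Definition word_weight u w : R[i] :=
  \prod_(k < size u) child_weight (take k u) (nth 0%N u k) w.

(** Extending by 0 to all words replaces the random index set of a generation by a fixed countable
    one, so that measurability and Fubini apply. *)
Definition gen_weight (n : nat) u w : R[i] :=
  if size u == n then word_weight u w else 0.

(** The copy of Z_1 attached to u; at the root it is almost surely Z_1 itself, see
    [Z1_offspring_sum]. *)
Definition offspring_sum u w : R[i] := sumC setT (fun i => child_weight u i w).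

Lemma expCD (z z' : R[i]) : expC (z + z') = expC z * expC z'.
Proof.
apply: complex_ext; rewrite ?complex_ReM ?complex_ImM /expC/= complex_ReD complex_ImD;
  rewrite expRD ?cosD ?sinD; ring.
Qed.

Lemma modulus_expC (z : R[i]) : modulus (expC z) = expR (Re z).
Proof.
rewrite modulusE /expC/= !exprMn -mulrDr cos2Dsin2 mulr1 sqrtr_sqr.
by rewrite ger0_norm ?expR_ge0.
Qed.

Lemma word_weight_nil w : word_weight [::] w = 1.
Proof. by rewrite /word_weight big_ord0. Qed.

Lemma word_weight_rcons u i w :
  word_weight (rcons u i) w = word_weight u w * child_weight u i w.
Proof.
rewrite /word_weight size_rcons big_ord_recr /= nth_rcons ltnn eqxx.
rewrite -cats1 take_size_cat//; congr (_ * _); apply: eq_bigr => k _.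
by rewrite nth_cat ltn_ord takel_cat// ltnW.
Qed.

Lemma word_weightE u w : word_weight u w =
  if `[< born M u w >] then expC (- lambda * (position M u w)%:C%C) / m P M lambda ^+ size u
  else 0.
Proof.
elim/last_ind: u => [|u i IH].
  rewrite word_weight_nil asboolT// /position big_ord0 expr0 divr1.
  have -> : - lambda * 0%:C%C = 0 by exact: mulr0.
  by rewrite /expC/= expR0 cos0 sin0 mulr0 mul1r.
rewrite word_weight_rcons IH /child_weight.
have [bu|bu] := asboolP (born M u w); last first.
  rewrite mul0r asboolF// => /born_rcons[]; tauto.
case: ifPn => hc; last first.
  rewrite mulr0 asboolF// => /born_rcons[_ hc'].
  by rewrite hc' in hc.
rewrite asboolT; last exact/born_rcons.
rewrite position_rcons size_rcons exprSr rmorphD mulrDr expCD /displacement_weight.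
by rewrite invfM mulrACA.
Qed.

Lemma mem_generation n u w :
  (u \in generation M n w) = (size u == n) && `[< born M u w >].
Proof.
apply/idP/andP => [/set_mem[<- b]|[/eqP su /asboolP b]].
  by split => //; exact/asboolP.
by apply/mem_set; split.
Qed.

Hypothesis m0 : 0 < modulus (m P M lambda).

Let m_neq0 : m P M lambda != 0.
Proof.
apply/eqP => mE; move: m0.
by rewrite mE modulusE/= expr0n addr0 sqrtr0 ltxx.
Qed.

Lemma gen_weight_generation n u w : m P M lambda ^+ n * gen_weight n u w =
  if u \in generation M n w then expC (- lambda * (position M u w)%:C%C) else 0.
Proof.
rewrite mem_generation /gen_weight word_weightE.
case: eqP => [<-|_]; last by rewrite mulr0.
case: asboolP => _ /=; last by rewrite mulr0.
by rewrite mulrC divfK// expf_neq0.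
Qed.

(** Absolute convergence is what permits moving the normalisation m^n inside the sum. *)
Lemma Z_gen_weight n w : (asumC (gen_weight n ^~ w) < +oo)%E ->
  Z P M n lambda w = sumC setT (gen_weight n ^~ w).
Proof.
move=> aoo; rewrite /Z sumC_mkcond.
under eq_sumC do rewrite -gen_weight_generation.
by rewrite sumC_scale// mulrC mulKf// expf_neq0.
Qed.

End weights.

(** * Measurability of the weights with respect to the reproductions *)

Section weight_measurability.
Local Open Scope classical_set_scope.
Local Open Scope ring_scope.
Context d (T : measurableType d) (R : realType) (P : probability T R).
Context (M : reproduction T R) (lambda : R[i]).
Hypothesis HM : supercritical_brw P M.
Implicit Types (u : seq nat) (w : T).
Notation G := (sigma_reproduction M).

Lemma sigma_reproduction_sigma_algebra u : sigma_algebra setT (G u).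
Proof. exact: smallest_sigma_algebra. Qed.

Lemma sigma_reproduction_measurable u : G u `<=` measurable.
Proof.
apply: smallest_sub; first exact: sigma_algebra_measurable.
by move=> _ [i [B [mB ->]]]; exact: (brw_measurable HM).
Qed.

Lemma measurable_child_fun u i (f : R -> R) : measurable_fun setT f ->
  measurable_fun setT ((fun w => if has_child M u i w then f (X M u i w) else 0)
    : join_type G [set u] -> R).
Proof.
move=> mf _ B mB; rewrite setTI.
have mE C : measurable C ->
    measurable (child_event M u i C : set (join_type G [set u])).
  move=> mC; apply: sub_sigma_algebra; exists u => //.
  by apply: sub_sigma_algebra; exists i, C.
(* An unborn child has value 0, so the event of not being born belongs to the preimage exactly when
   B contains 0. *)
rewrite (_ : _ @^-1` B = child_event M u i (f @^-1` B)
    `|` (if 0 \in B then ~` child_event M u i setT else set0)).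
  apply: measurableU.
    by apply: mE; rewrite -[X in measurable X]setTI; exact: mf.
  by case: ifP => // _; apply: measurableC; exact: mE.
apply/seteqP; split=> w /=.
  case: ifPn => hc Bw; first by left.
  by right; rewrite mem_set// => -[hc']; rewrite hc' in hc.
case=> [[-> //]|]; case: ifP => //= /set_mem B0 hc.
by case: ifP => // hc'; exfalso; apply: hc; split.
Qed.

Lemma cmeasurable_displacement_weight :
  cmeasurable (displacement_weight P M lambda : R -> R[i]).
Proof.
apply: cmeasurableM; last exact: cmeasurable_cst.
have mlin (c : R) : measurable_fun setT (fun x : R => c * x) by exact: measurable_funM.
have reE (x : R) : complex.Re (- lambda * x%:C%C) = - complex.Re lambda * x.
  by case: lambda => a b /=; rewrite mulr0 subr0.
have imE (x : R) : complex.Im (- lambda * x%:C%C) = - complex.Im lambda * x.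
  by case: lambda => a b /=; rewrite mulr0 add0r.
split; rewrite /expC/=; under eq_fun do rewrite reE imE; apply: measurable_funM;
  apply: measurableT_comp => //; apply: continuous_measurable_fun;
  by [exact: continuous_cos|exact: continuous_sin].
Qed.

Lemma cmeasurable_child_weight u i :
  cmeasurable (child_weight P M lambda u i : join_type G [set u] -> R[i]).
Proof.
have [m1 m2] := cmeasurable_displacement_weight; split.
  have := @measurable_child_fun u i _ m1; congr measurable_fun; apply/funext => w.
  by rewrite /child_weight; case: ifP.
have := @measurable_child_fun u i _ m2; congr measurable_fun; apply/funext => w.
by rewrite /child_weight; case: ifP.
Qed.

Lemma cmeasurable_word_weight u (A : set (seq nat)) :
  (forall k, (k < size u)%N -> A (take k u)) ->
  cmeasurable (word_weight P M lambda u : join_type G A -> R[i]).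
Proof.
elim/last_ind: u => [|u i IH] uA.
  rewrite (_ : word_weight P M lambda [::] = fun=> 1); first exact: cmeasurable_cst.
  by apply/funext => w; exact: word_weight_nil.
rewrite (_ : word_weight P M lambda (rcons u i) = fun w =>
    word_weight P M lambda u w * child_weight P M lambda u i w); last first.
  by apply/funext => w; exact: word_weight_rcons.
apply: cmeasurableM.
  apply: IH => k ku; have := uA k; rewrite size_rcons => /(_ (ltnW ku)).
  by rewrite -cats1 takel_cat// ltnW.
apply: cmeasurable_join_subset (cmeasurable_child_weight u i).
move=> _ ->; have := uA (size u); rewrite size_rcons ltnS leqnn => /(_ isT).
by rewrite -cats1 take_size_cat.
Qed.

(** A weight in generation n involves only the reproduction of proper prefixes, which have length
    below n; it is therefore independent of the reproductions in generation n. *)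
Lemma cmeasurable_gen_weight n u (A : set (seq nat)) :
  (forall v, (size v < n)%N -> A v) ->
  cmeasurable (gen_weight P M lambda n u : join_type G A -> R[i]).
Proof.
move=> nA; rewrite /gen_weight; case: eqP => [su|_]; last exact: cmeasurable_cst.
by apply: cmeasurable_word_weight => k ku; apply: nA; rewrite size_take ku -su.
Qed.

Lemma cmeasurable_offspring_sum u :
  cmeasurable (offspring_sum P M lambda u : join_type G [set u] -> R[i]).
Proof. by apply: cmeasurable_sumC => i; exact: cmeasurable_child_weight. Qed.

End weight_measurability.


(** * Sums over words, grouped by parent *)

Section word_sums.
Local Open Scope classical_set_scope.
Local Open Scope ring_scope.
Context (R : realType).

Let rcons_bij : set_bij [set: seq nat * nat] [set v : seq nat | v != [::]]
  (fun k => rcons k.1 k.2).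
Proof.
split.
- by move=> [u i] _ /=; rewrite -size_eq0 size_rcons.
- by move=> [u i] [v j] _ _ /= /rcons_inj[-> ->].
- move=> v /=; case/lastP: v => // u i _.
  by exists (u, i).
Qed.

Lemma esum_rcons (F : seq nat -> \bar R) : (forall v, 0 <= F v)%E -> F [::] = 0%E ->
  (\esum_(v in setT) F v = \esum_(u in setT) \esum_(i in setT) F (rcons u i))%E.
Proof.
move=> F0 Fnil; transitivity (\esum_(v in [set v : seq nat | v != [::]]) F v)%E.
  rewrite [RHS]esum_mkcond; apply: eq_esum => v _; case: ifPn => //.
  by rewrite notin_setE /= => /negP; rewrite negbK => /eqP ->.
rewrite (reindex_esum _ _ _ _ rcons_bij).
by rewrite (esum_pair (F := fun k => F (rcons k.1 k.2))).
Qed.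

Lemma sumC_rcons (f : seq nat -> R[i]) : f [::] = 0 ->
  sumC setT f = sumC setT (fun k : seq nat * nat => f (rcons k.1 k.2)).
Proof.
move=> fnil; transitivity (sumC [set v : seq nat | v != [::]] f).
  rewrite [RHS]sumC_mkcond; apply: eq_sumC => v _; case: ifPn => //.
  by rewrite notin_setE /= => /negP; rewrite negbK => /eqP ->.
exact: (sumC_reindex _ rcons_bij).
Qed.

Context d (T : measurableType d).

Lemma generation1_bij (M : reproduction T R) w :
  set_bij [set i | has_child M [::] i w] (generation M 1 w) (fun i => [:: i]).
Proof.
split.
- by move=> i hi; split => // -[|//].
- by move=> i j _ _ [].
- move=> [|i [|j u]] [] //= _ b; exists i => //=.
  exact: (b 0%N).
Qed.

Lemma esum_generation1 (M : reproduction T R) w (f : seq nat -> \bar R) :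
  (\esum_(u in generation M 1 w) f u =
   \esum_(i in setT) if has_child M [::] i w then f [:: i] else 0)%E.
Proof.
rewrite (reindex_esum _ _ _ _ (generation1_bij M w)) esum_mkcond; apply: eq_esum => i _.
have -> // : (i \in [set i | has_child M [::] i w]) = has_child M [::] i w.
by apply/idP/idP; rewrite inE.
Qed.

End word_sums.

(** * Laws of sums over the children of an individual *)

Section weight_laws.
Local Open Scope classical_set_scope.
Local Open Scope ring_scope.
Context d (T : measurableType d) (R : realType) (P : probability T R).
Context (M : reproduction T R) (lambda : R[i]).
Hypothesis HM : supercritical_brw P M.
Implicit Types (u : seq nat) (w : T).
Notation Re := complex.Re.
Notation Im := complex.Im.
Notation dw := (displacement_weight P M lambda).
Notation cw := (child_weight P M lambda).
Notation off := (offspring_sum P M lambda).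

(** The inner sum is the integral of f against the point process of u. *)
Lemma child_sum_law u (f : R -> \bar R) (H : \bar R -> \bar R) :
  measurable_fun setT f -> (forall x, 0 <= f x)%E ->
  measurable_fun setT H -> (forall x, 0 <= H x)%E ->
  (\int[P]_w H (\esum_(i in setT) if has_child M u i w then f (X M u i w) else 0) =
   \int[P]_w H (\esum_(i in setT) if has_child M [::] i w then f (X M [::] i w) else 0))%E.
Proof.
move=> mf f0 mH H0.
under eq_integral do rewrite -integral_point_process//.
under [RHS]eq_integral do rewrite -integral_point_process//.
apply: (same_point_process_integral HM u
  (F := fun mu : measure_space R => H (\int[(mu : measures R)]_x f x)%E)) => //.
exact: (measurableT_comp mH (measurable_integral_against mf f0)).
Qed.

(* The functional of the point process computing [offspring_sum]. *)
Let off_of (mu : measure_space R) : R[i] := Complex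
  (fine (\int[(mu : measures R)]_x (Num.max (Re (dw x)) 0)%:E)%E
   - fine (\int[(mu : measures R)]_x (Num.max (- Re (dw x)) 0)%:E)%E)
  (fine (\int[(mu : measures R)]_x (Num.max (Im (dw x)) 0)%:E)%E
   - fine (\int[(mu : measures R)]_x (Num.max (- Im (dw x)) 0)%:E)%E).

Let moff_of : cmeasurable off_of.
Proof.
have [m1 m2] := cmeasurable_displacement_weight P M lambda.
have mint (f : R -> R) : measurable_fun setT f -> measurable_fun setT
    (fun mu : measure_space R => fine (\int[(mu : measures R)]_x (Num.max (f x) 0)%:E)%E).
  move=> mf; apply: (measurableT_comp (@fine_measurable R _ measurableT)).
  apply: measurable_integral_against.
    by apply/measurable_EFinP; exact: measurable_maxr.
  by move=> x; rewrite lee_fin le_max lexx orbT.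
by split; apply: measurable_funB; apply: mint => //; exact: measurableT_comp.
Qed.

Let offE u w : off u w = off_of (point_process M u w).
Proof.
have [m1 m2] := cmeasurable_displacement_weight P M lambda.
have maxE (f : R -> R) (g : nat -> R) : measurable_fun setT f ->
    (forall i, g i = if has_child M u i w then f (X M u i w) else 0) ->
    (\esum_(i in setT) (Num.max (g i) 0)%:E =
     \int[(point_process M u w : measures R)]_x (Num.max (f x) 0)%:E)%E.
  move=> mf gE; rewrite integral_point_process.
  - by apply: eq_esum => i _; rewrite gE; case: ifP; rewrite ?maxxx.
  - by apply/measurable_EFinP; exact: measurable_maxr.
  - by move=> x; rewrite lee_fin le_max lexx orbT.
rewrite /offspring_sum /sumC /sumR /off_of; congr (Complex (fine _ - fine _) (fine _ - fine _)).
- by apply: maxE => // i; rewrite /child_weight; case: ifP.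
- apply: (maxE (fun x => - Re (dw x))); first exact: measurableT_comp.
  by move=> i; rewrite /child_weight; case: ifP; rewrite ?oppr0.
- by apply: maxE => // i; rewrite /child_weight; case: ifP.
- apply: (maxE (fun x => - Im (dw x))); first exact: measurableT_comp.
  by move=> i; rewrite /child_weight; case: ifP; rewrite ?oppr0.
Qed.

(** Measurability of H on the complex plane is phrased through compositions with [cmeasurable] maps.
    The real functional H is split into positive and negative parts, each covered by
    [same_point_process_integral]. *)
Lemma offspring_law u (H : R[i] -> \bar R) :
  (forall d' (A : measurableType d') (f : A -> R[i]), cmeasurable f ->
     measurable_fun setT (H \o f)) ->
  (\int[P]_w H (off u w) = \int[P]_w H (off [::] w))%E.
Proof.
move=> mH.
have eqH (K : \bar R -> \bar R) : measurable_fun setT K -> (forall x, 0 <= K x)%E ->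
    (\int[P]_w K (H (off u w)) = \int[P]_w K (H (off [::] w)))%E.
  move=> mK K0; under eq_integral do rewrite offE.
  under [RHS]eq_integral do rewrite offE.
  apply: (same_point_process_integral HM u (F := fun mu => K (H (off_of mu)))) => //.
  by apply: measurableT_comp => //; apply: (mH _ (measure_space R)).
rewrite [LHS]integralE [RHS]integralE.
have -> : (\int[P]_w ((fun w => H (off u w))^\+ w) =
    \int[P]_w ((fun w => H (off [::] w))^\+ w))%E.
  rewrite funepos.unlock; apply: (eqH (fun x => maxe x 0)%E).
    exact: measurable_maxe.
  by move=> x; rewrite le_max lexx orbT.
have -> // : (\int[P]_w ((fun w => H (off u w))^\- w) =
    \int[P]_w ((fun w => H (off [::] w))^\- w))%E.
rewrite funeneg.unlock; apply: (eqH (fun x => maxe (- x) 0)%E).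
  by apply: measurable_maxe => //; exact: measurableT_comp.
by move=> x; rewrite le_max lexx orbT.
Qed.

(** For r != 0 this is w(r), see [weight_moment_ratio]. At r = 0 every unborn child would contribute
    0^0 = 1, whence the condition r != 0 in the lemmas about it. *)
Definition weight_moment (r : R) : \bar R :=
  (\int[P]_w \esum_(i in setT) (modulus (cw [::] i w) `^ r)%:E)%E.

Let child_powE (r : R) u i w : r != 0 -> ((modulus (cw u i w) `^ r)%:E =
  if has_child M u i w then (modulus (dw (X M u i w)) `^ r)%:E else 0)%E.
Proof.
move=> r0; rewrite /child_weight; case: ifP => // _.
by rewrite modulusE/= expr0n addr0 sqrtr0 powR0.
Qed.

Let mdw_pow (r : R) : measurable_fun setT (fun x => (modulus (dw x) `^ r)%:E).
Proof.
apply/measurable_EFinP; apply: (measurableT_comp (measurable_powR _)).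
exact/measurable_modulus/cmeasurable_displacement_weight.
Qed.

Lemma child_pow_law (r : R) u (H : \bar R -> \bar R) : r != 0 ->
  measurable_fun setT H -> (forall x, 0 <= H x)%E ->
  (\int[P]_w H (\esum_(i in setT) (modulus (cw u i w) `^ r)%:E) =
   \int[P]_w H (\esum_(i in setT) (modulus (cw [::] i w) `^ r)%:E))%E.
Proof.
move=> r0 mH H0.
have cE v : (\int[P]_w H (\esum_(i in setT) (modulus (cw v i w) `^ r)%:E) =
    \int[P]_w H (\esum_(i in setT)
      if has_child M v i w then (modulus (dw (X M v i w)) `^ r)%:E else 0))%E.
  by apply: eq_integral => w _; congr H; apply: eq_esum => i _; rewrite child_powE.
apply: etrans (cE u) (etrans _ (esym (cE [::]))).
apply: (@child_sum_law u (fun x => (modulus (dw x) `^ r)%:E)) => // x.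
by rewrite lee_fin powR_ge0.
Qed.

Lemma weight_moment_child (r : R) u : r != 0 ->
  (\int[P]_w (\esum_(i in setT) (modulus (cw u i w) `^ r)%:E) = weight_moment r)%E.
Proof.
move=> r0.
have esum0 v w : (0 <= \esum_(i in setT) (modulus (cw v i w) `^ r)%:E)%E.
  by apply: esum_ge0 => i _; rewrite lee_fin powR_ge0.
(* [child_pow_law] takes functionals that are nonnegative on all of the extended line; the
   truncation at 0 stands in for the identity. *)
have maxE v : (\int[P]_w (\esum_(i in setT) (modulus (cw v i w) `^ r)%:E) =
    \int[P]_w maxe (\esum_(i in setT) (modulus (cw v i w) `^ r)%:E) 0)%E.
  by apply: eq_integral => w _; rewrite max_l.
rewrite /weight_moment; apply: etrans (maxE u) (etrans _ (esym (maxE [::]))).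
apply: (@child_pow_law r u (fun x => maxe x 0)%E r0).
  exact: measurable_maxe.
by move=> x; rewrite le_max lexx orbT.
Qed.

End weight_laws.


(** * Moments of the weights and of the martingale increments *)

Section weight_moments.
Local Open Scope classical_set_scope.
Local Open Scope ring_scope.
Context d (T : measurableType d) (R : realType) (P : probability T R).
Context (M : reproduction T R) (lambda : R[i]).
Hypothesis HM : supercritical_brw P M.
Hypothesis m_gt0 : 0 < modulus (m P M lambda).
Implicit Types (u : seq nat) (w : T).
Notation Re := complex.Re.
Notation Im := complex.Im.
Notation G := (sigma_reproduction M).
Notation sigmaG := (sigma_reproduction_sigma_algebra M).
Notation subG := (sigma_reproduction_measurable HM).
Notation indG := (brw_independent HM).
Notation cw := (child_weight P M lambda).
Notation gw := (gen_weight P M lambda).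
Notation off := (offspring_sum P M lambda).

Let modulus0 : modulus (0 : R[i]) = 0.
Proof. by rewrite modulusE/= expr0n addr0 sqrtr0. Qed.

Lemma cmeasurable_cw u i : cmeasurable (cw u i).
Proof.
apply: (cmeasurable_from_join subG (A := [set u])).
exact: cmeasurable_child_weight.
Qed.

Lemma cmeasurable_gw n u : cmeasurable (gw n u).
Proof.
apply: (cmeasurable_from_join subG (A := setT)).
exact: cmeasurable_gen_weight.
Qed.

Lemma cmeasurable_off u : cmeasurable (off u).
Proof.
apply: (cmeasurable_from_join subG (A := [set u])).
exact: cmeasurable_offspring_sum.
Qed.

Lemma measurable_powR_modulus d' (A : measurableType d') (f : A -> R[i]) (r : R) :
  cmeasurable f -> measurable_fun setT (fun x => (modulus (f x) `^ r)%:E).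
Proof.
move=> mf; apply/measurable_EFinP; apply: (measurableT_comp (measurable_powR _)).
exact: measurable_modulus.
Qed.

Lemma mreal_weight_moment (r : R) : r != 0 ->
  (mreal P M (r * Re lambda) = (modulus (m P M lambda) `^ r)%:E * weight_moment P M lambda r)%E.
Proof.
move=> r0; rewrite /weight_moment -ge0_integralZl//; last 3 first.
- apply: measurable_fun_esum => [i w|i]; first by rewrite lee_fin powR_ge0.
  exact/measurable_powR_modulus/cmeasurable_cw.
- by move=> w _; apply: esum_ge0 => i _; rewrite lee_fin powR_ge0.
- by rewrite lee_fin powR_ge0.
apply: eq_integral => w _; rewrite esum_generation1 -esumZl; last 2 first.
- by move=> i; rewrite lee_fin powR_ge0.
- exact: powR_ge0.
apply: eq_esum => i _; rewrite /child_weight; case: ifP => _; last first.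
  by rewrite modulus0 powR0// mule0.
rewrite -EFinM -powRM ?modulus_ge0// -modulusM /displacement_weight.
have mn0 : m P M lambda != 0.
  by apply/eqP => mE; move: m_gt0; rewrite mE modulus0 ltxx.
rewrite [_ * (_ / _)]mulrC divfK// modulus_expC -expRM.
congr (expR _)%:E; rewrite /position big_ord1/=.
by case: lambda => a b /=; ring.
Qed.

Lemma gen_weight_nil n w : gw n [::] w = (n == 0%N)%:R.
Proof. by rewrite /gen_weight/= eq_sym word_weight_nil; case: eqP. Qed.

Lemma gen_weight_rcons n u i w : gw n.+1 (rcons u i) w = gw n u w * cw u i w.
Proof.
rewrite /gen_weight size_rcons eqSS word_weight_rcons.
by case: ifP => // _; rewrite mul0r.
Qed.

Lemma gen_weight0 u w : gw 0 u w = (u == [::])%:R.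
Proof.
by rewrite /gen_weight size_eq0; case: eqP => // ->; rewrite word_weight_nil.
Qed.

Lemma esum_gen_weightS n w (r : R) : r != 0 ->
  (\esum_(v in setT) (modulus (gw n.+1 v w) `^ r)%:E =
   \esum_(u in setT) ((modulus (gw n u w) `^ r)%:E *
      \esum_(i in setT) (modulus (cw u i w) `^ r)%:E))%E.
Proof.
move=> r0; rewrite esum_rcons; last 2 first.
- by move=> v; rewrite lee_fin powR_ge0.
- by rewrite gen_weight_nil modulus0 powR0.
apply: eq_esum => u _; rewrite -esumZl; last 2 first.
- by move=> i; rewrite lee_fin powR_ge0.
- exact: powR_ge0.
by apply: eq_esum => i _; rewrite gen_weight_rcons modulusM powRM ?modulus_ge0.
Qed.

Lemma esum_gen_weight0 w (r : R) : r != 0 ->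
  (\esum_(u in setT) (modulus (gw 0 u w) `^ r)%:E = 1)%E.
Proof.
move=> r0; have <- : (\esum_(u in [set ([::] : seq nat)]) (1%:E : \bar R) = 1%:E)%E.
  by rewrite esum_set1 ?lee_fin.
rewrite [RHS]esum_mkcond; apply: eq_esum => u _; rewrite gen_weight0.
have -> : (u \in [set ([::] : seq nat)]) = (u == [::]).
  by apply/idP/eqP => [/set_mem|->] //; exact/mem_set.
case: eqP => _; last by rewrite modulus0 powR0.
by rewrite modulusE/= expr1n expr0n addr0 sqrtr1 powR1.
Qed.

(** The weight of u depends on its proper prefixes and the weights of its children on u alone, so
    the expectation factorises generation by generation. The identity holds in [0, +oo]. *)
Lemma integral_esum_gen_weight n (r : R) : r != 0 ->
  (\int[P]_w (\esum_(u in setT) (modulus (gw n u w) `^ r)%:E) =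
   weight_moment P M lambda r ^+ n)%E.
Proof.
move=> r0; elim: n => [|n IH].
  rewrite expe0 -[RHS](integral_probability_cst P); apply: eq_integral => w _.
  exact: esum_gen_weight0.
have sum0 u w : (0 <= \esum_(i in setT) (modulus (cw u i w) `^ r)%:E)%E.
  by apply: esum_ge0 => i _; rewrite lee_fin powR_ge0.
have msum u : measurable_fun setT
    ((fun w => \esum_(i in setT) (modulus (cw u i w) `^ r)%:E)%E : join_type G [set u] -> \bar R).
  apply: measurable_fun_esum => [i w|i]; first by rewrite lee_fin powR_ge0.
  apply: measurable_powR_modulus; exact: cmeasurable_child_weight.
have msum0 u : measurable_fun setT
    (fun w => \esum_(i in setT) (modulus (cw u i w) `^ r)%:E)%E.
  apply: measurable_fun_esum => [i w|i]; first by rewrite lee_fin powR_ge0.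
  apply: measurable_powR_modulus; exact: cmeasurable_cw.
have mgw n' u : measurable_fun setT (fun w => (modulus (gw n' u w) `^ r)%:E).
  exact/measurable_powR_modulus/cmeasurable_gw.
under eq_integral do rewrite esum_gen_weightS//.
rewrite integral_esum; last 2 first.
- by move=> u w; rewrite mule_ge0// lee_fin powR_ge0.
- by move=> u; exact: emeasurable_funM.
transitivity (\esum_(u in [set: seq nat])
   (\int[P]_w ((modulus (gw n u w) `^ r)%:E * weight_moment P M lambda r)))%E.
  apply: eq_esum => u _.
  (* Outside generation n the weight is 0 and both sides vanish, even when the moment is +oo. *)
  have [su|su] := eqVneq (size u) n; last first.
    by apply: eq_integral => w _; rewrite /gen_weight (negPf su) modulus0 powR0// !mul0e.
  pose A := [set v : seq nat | (size v < n)%N]; pose B := [set u].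
  pose h (z : join_type G A * join_type G B) : \bar R :=
    ((modulus (gw n u z.1) `^ r)%:E * \esum_(i in setT) (modulus (cw u i z.2) `^ r)%:E)%E.
  transitivity (\int[P]_w h (w, w))%E; first by [].
  rewrite (ge0_integral_freeze sigmaG subG indG); last 3 first.
  - apply/seteqP; split => // v [/= vn vu].
    by move: vn; rewrite /A/= vu su ltnn.
  - apply: emeasurable_funM.
      apply: measurable_powR_modulus.
      apply: (@cmeasurable_comp _ _ _ _ _ (gw n u : join_type G A -> R[i]) fst) => //.
      exact: cmeasurable_gen_weight.
    exact: (measurableT_comp (msum u) (@measurable_snd _ _ (join_type G A) (join_type G B))).
  - by move=> z; rewrite mule_ge0// lee_fin powR_ge0.
  apply: eq_integral => w _.
  have <- := weight_moment_child lambda HM u r0.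
  rewrite -ge0_integralZl//.
  by rewrite lee_fin powR_ge0.
have wm0 : (0 <= weight_moment P M lambda r)%E by exact: integral_ge0.
rewrite expeS -IH integral_esum//; last by move=> u w; rewrite lee_fin powR_ge0.
rewrite -ge0_esumZl//; last first.
  by move=> u; apply: integral_ge0 => w _; rewrite lee_fin powR_ge0.
apply: eq_esum => u _; under [LHS]eq_integral do rewrite muleC.
by rewrite ge0_integralZl// => w _; rewrite lee_fin powR_ge0.
Qed.

Lemma cmeasurable_Z n : cmeasurable (Z P M n lambda).
Proof.
rewrite (_ : Z P M n lambda = fun w =>
    sumC setT (fun u => m P M lambda ^+ n * gw n u w) / m P M lambda ^+ n).
  apply: cmeasurableM; last exact: cmeasurable_cst.
  apply: cmeasurable_sumC => u; apply: cmeasurableM; first exact: cmeasurable_cst.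
  exact: cmeasurable_gw.
apply/funext => w; rewrite /Z sumC_mkcond; congr (_ / _).
by apply: eq_sumC => u _; rewrite gen_weight_generation.
Qed.

Hypothesis mreal_lty : (mreal P M (Re lambda) < +oo)%E.

(** m(theta) = |m(lambda)| w(1). Through w(1)^n this is the source of the almost sure absolute
    convergence of all sums over generations. *)
Lemma weight_moment1_lty : (weight_moment P M lambda 1 < +oo)%E.
Proof.
move: mreal_lty; rewrite -[Re lambda]mul1r mreal_weight_moment ?oner_eq0//.
rewrite powRr1 ?modulus_ge0//.
have w0 : (0 <= weight_moment P M lambda 1)%E.
  by apply: integral_ge0 => w _; apply: esum_ge0 => i _; rewrite lee_fin powR_ge0.
case: (weight_moment P M lambda 1) w0 => // [r _ _|_]; first by rewrite ltry.
by rewrite gt0_muley ?lte_fin.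
Qed.

Lemma ae_asumC_gen_weight :
  {ae P, forall w, forall n, (asumC (gw n ^~ w) < +oo)%E}.
Proof.
apply: ae_foralln => n; apply: ge0_integral_lty_ae.
- apply: measurable_fun_esum => [u w|u]; first by rewrite lee_fin modulus_ge0.
  exact/measurable_EFinP/measurable_modulus/cmeasurable_gw.
- by move=> w; apply: esum_ge0 => u _; rewrite lee_fin modulus_ge0.
have := @integral_esum_gen_weight n 1 (oner_neq0 _).
rewrite (eq_integral (fun w => asumC (gw n ^~ w))); last first.
  by move=> w _; apply: eq_esum => u _; rewrite powRr1// modulus_ge0.
move=> ->; have w0 : (0 <= weight_moment P M lambda 1)%E.
  by apply: integral_ge0 => w _; apply: esum_ge0 => i _; rewrite lee_fin powR_ge0.
have /fineK <- : weight_moment P M lambda 1 \is a fin_num.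
  by rewrite ge0_fin_numE// weight_moment1_lty.
by rewrite -EFin_expe ltry.
Qed.

Lemma ae_asumC_child_weight u :
  {ae P, forall w, (asumC (fun i => cw u i w) < +oo)%E}.
Proof.
apply: ge0_integral_lty_ae.
- apply: measurable_fun_esum => [i w|i]; first by rewrite lee_fin modulus_ge0.
  exact/measurable_EFinP/measurable_modulus/cmeasurable_cw.
- by move=> w; apply: esum_ge0 => i _; rewrite lee_fin modulus_ge0.
have := weight_moment_child lambda HM u (oner_neq0 R).
rewrite (eq_integral (fun w => asumC (fun i => cw u i w))); last first.
  by move=> w _; apply: eq_esum => i _; rewrite powRr1// modulus_ge0.
by move=> ->; exact: weight_moment1_lty.
Qed.

Let m_neq0 : m P M lambda != 0.
Proof. by apply/eqP => mE; move: m_gt0; rewrite mE modulus0 ltxx. Qed.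

Let integrable_off : P.-integrable setT (fun w => (modulus (off [::] w))%:E).
Proof.
apply/integrableP; split.
  exact/measurable_EFinP/measurable_modulus/cmeasurable_off.
under eq_integral do rewrite gee0_abs ?lee_fin ?modulus_ge0//.
apply: le_lt_trans weight_moment1_lty; rewrite /weight_moment.
apply: ge0_le_integral => //.
- by move=> w _; rewrite lee_fin modulus_ge0.
- exact/measurable_EFinP/measurable_modulus/cmeasurable_off.
- apply: measurable_fun_esum => [i w|i]; first by rewrite lee_fin powR_ge0.
  exact/measurable_powR_modulus/cmeasurable_cw.
- move=> w _; apply: (le_trans (modulus_sumC_le _)); apply: le_esum => i _.
  by rewrite powRr1// modulus_ge0.
Qed.

Lemma integrable_Re_off : P.-integrable setT (EFin \o (fun w => Re (off [::] w))).
Proof.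
apply: le_integrable integrable_off => //.
  by apply/measurable_EFinP; case: (cmeasurable_off [::]).
by move=> w _; rewrite !abse_EFin lee_fin [leRHS]ger0_norm ?modulus_ge0// ler_Re_modulus.
Qed.

Let integrable_Im_off : P.-integrable setT (EFin \o (fun w => Im (off [::] w))).
Proof.
apply: le_integrable integrable_off => //.
  by apply/measurable_EFinP; case: (cmeasurable_off [::]).
by move=> w _; rewrite !abse_EFin lee_fin [leRHS]ger0_norm ?modulus_ge0// ler_Im_modulus.
Qed.

(* [m] is the mean of [m * off], so [off] has mean 1 by cancellation. *)
Lemma offspring_mean :
  (\int[P]_w (Re (off [::] w))%:E = 1)%E /\ (\int[P]_w (Im (off [::] w))%:E = 0)%E.
Proof.
set mm := m P M lambda; have iRe := integrable_Re_off.
have afin := integrable_fin_num measurableT integrable_Re_off.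
have bfin := integrable_fin_num measurableT integrable_Im_off.
set a := fine (\int[P]_w (Re (off [::] w))%:E)%E.
set b := fine (\int[P]_w (Im (off [::] w))%:E)%E.
have aE : (\int[P]_w (Re (off [::] w))%:E = a%:E)%E by rewrite fineK.
have bE : (\int[P]_w (Im (off [::] w))%:E = b%:E)%E by rewrite fineK.
have lin (c e : R) :
    (\int[P]_w (c * Re (off [::] w) + e * Im (off [::] w))%:E = (c * a + e * b)%:E)%E.
  under eq_integral do rewrite EFinD !EFinM.
  rewrite integralD//; [|exact: integrableZl..].
  by rewrite !integralZl// aE bE.
have [mo1 mo2] := cmeasurable_off [::].
pose V w := sumC (generation M 1 w)
    (fun u => expC (- lambda * (position M u w)%:C%C)).
have genE : {ae P, forall w, V w = mm * off [::] w}.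
  apply: filterS (ae_asumC_child_weight [::]) => w woo.
  rewrite /V -sumC_scale//.
  have bij : set_bij [set i | has_child M [::] i w] (generation M 1 w) (fun i => [:: i]).
    exact: generation1_bij.
  rewrite (sumC_reindex _ bij) sumC_mkcond; apply: eq_sumC => i _ /=.
  have -> : (i \in [set i | has_child M [::] i w]) = has_child M [::] i w.
    by apply/idP/idP; rewrite inE.
  rewrite /child_weight; case: ifP => _; last by rewrite mulr0.
  rewrite /displacement_weight [RHS]mulrC divfK//.
  by rewrite /position big_ord1.
have meas_gen : cmeasurable V.
  rewrite (_ : V = fun w => m P M lambda ^+ 1 * Z P M 1 lambda w).
    by apply: cmeasurableM; [exact: cmeasurable_cst|exact: cmeasurable_Z].
  by apply/funext => w; rewrite /Z expr1 mulrC divfK.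
have [mg1 mg2] := meas_gen.
have reM : Re mm = fine (\int[P]_w (Re (V w))%:E)%E.
  by rewrite /mm /m /expectationC unlock.
have imM : Im mm = fine (\int[P]_w (Im (V w))%:E)%E.
  by rewrite /mm /m /expectationC unlock.
have ReE : Re mm = Re mm * a - Im mm * b.
  rewrite [LHS]reM (ae_eq_integral (fun w =>
    (Re mm * Re (off [::] w) + (- Im mm) * Im (off [::] w))%:E)%E)//.
  - by rewrite lin /= mulNr.
  - exact/measurable_EFinP.
  - by apply/measurable_EFinP; apply: measurable_funD; apply: measurable_funM.
  - by apply: filterS genE => w -> _; rewrite complex_ReM mulNr.
have ImE : Im mm = Re mm * b + Im mm * a.
  rewrite [LHS]imM (ae_eq_integral (fun w =>
    (Im mm * Re (off [::] w) + Re mm * Im (off [::] w))%:E)%E)//.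
  - by rewrite lin /= addrC.
  - exact/measurable_EFinP.
  - by apply/measurable_EFinP; apply: measurable_funD; apply: measurable_funM.
  - by apply: filterS genE => w -> _; rewrite complex_ImM addrC.
have : Complex a b = 1.
  apply: (mulfI m_neq0); rewrite mulr1; apply: complex_ext.
    by rewrite complex_ReM; exact: esym ReE.
  by rewrite complex_ImM; exact: esym ImE.
by case=> a1 b0; rewrite aE bE a1 b0.
Qed.

End weight_moments.


Section power_sums.
Local Open Scope classical_set_scope.
Local Open Scope ring_scope.
Context (I : countType) (R : realType).

Lemma esum_powR_le (f : I -> R) (q : R) : 1 <= q -> (forall i, 0 <= f i) ->
  (\esum_(i in setT) (f i `^ q)%:E <= (\esum_(i in setT) (f i)%:E) `^ q)%E.
Proof.
move=> q1 f0; have q0 : 0 <= q by exact: le_trans q1.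
have c := @cenum_esum_cvg I R (fun i => (f i `^ q)%:E) (fun i => powR_ge0 _ _).
rewrite -(cvg_lim _ c)//; apply: lime_le; first by apply/cvg_ex; eexists; exact: c.
apply: nearW => N; rewrite sumEFin.
apply: (@le_trans _ _ (((\sum_(i <- cenum I N) f i) `^ q)%:E)).
  by rewrite lee_fin; exact: powR_sumr_le.
have se : (\sum_(i <- cenum I N) (f i)%:E <= \esum_(i in setT) (f i)%:E)%E.
  by apply: (@cenum_esum_le _ _ (fun i => (f i)%:E)) => i; rewrite lee_fin.
have s0 : (0 <= \sum_(i <- cenum I N) (f i)%:E)%E.
  by apply: sume_ge0 => i _; rewrite lee_fin.
rewrite -poweR_EFin -sumEFin; apply: gt0_ler_poweR => //; rewrite in_itv/= leey andbT//.
exact: le_trans se.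
Qed.

End power_sums.

(** * Martingale increments and quadratic sums *)

Section martingale_increments.
Local Open Scope classical_set_scope.
Local Open Scope ring_scope.
Context d (T : measurableType d) (R : realType) (P : probability T R).
Context (M : reproduction T R) (lambda : R[i]).
Hypothesis HM : supercritical_brw P M.
Hypothesis m_gt0 : 0 < modulus (m P M lambda).
Hypothesis mreal_lty : (mreal P M (complex.Re lambda) < +oo)%E.
Implicit Types (u : seq nat) (w : T).
Notation Re := complex.Re.
Notation Im := complex.Im.
Notation G := (sigma_reproduction M).
Notation sigmaG := (sigma_reproduction_sigma_algebra M).
Notation subG := (sigma_reproduction_measurable HM).
Notation indG := (brw_independent HM).
Notation cw := (child_weight P M lambda).
Notation gw := (gen_weight P M lambda).
Notation off := (offspring_sum P M lambda).

(** The centred copy of Z_1 attached to u. *)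
Definition innovation u w : R[i] := off u w - 1.
Notation xi := innovation.

Lemma cmeasurable_innovation_join u :
  cmeasurable (xi u : join_type G [set u] -> R[i]).
Proof.
by apply: cmeasurableB; [exact: cmeasurable_offspring_sum|exact: cmeasurable_cst].
Qed.

Lemma cmeasurable_innovation u : cmeasurable (xi u).
Proof. by apply: cmeasurableB; [exact: cmeasurable_off|exact: cmeasurable_cst]. Qed.

Lemma innovation_mean u :
  (\int[P]_w (Re (xi u w))%:E = 0)%E /\ (\int[P]_w (Im (xi u w))%:E = 0)%E.
Proof.
have [E1 E2] := offspring_mean HM m_gt0 mreal_lty.
split.
  rewrite (offspring_law lambda HM u (H := fun z => (Re (z - 1))%:E)); last first.
    move=> d' A f mf /=; apply/measurable_EFinP.
    by have [] := cmeasurableB mf (cmeasurable_cst A 1).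
  under eq_integral do rewrite complex_ReB EFinB.
  rewrite integralB_EFin//; last 2 first.
  - exact: integrable_Re_off.
  - exact: finite_measure_integrable_cst.
  by rewrite E1 /= integral_probability_cst subee.
rewrite (offspring_law lambda HM u (H := fun z => (Im (z - 1))%:E)); last first.
  move=> d' A f mf /=; apply/measurable_EFinP.
  by have [] := cmeasurableB mf (cmeasurable_cst A 1).
under eq_integral do rewrite complex_ImB /= subr0.
exact: E2.
Qed.

Lemma innovation_moment u (r : R) :
  (\int[P]_w (modulus (xi u w) `^ r)%:E = \int[P]_w (modulus (xi [::] w) `^ r)%:E)%E.
Proof.
apply: (offspring_law lambda HM u (H := fun z => (modulus (z - 1) `^ r)%:E)).
move=> d' A f mf; apply: measurable_powR_modulus.
exact: (cmeasurableB mf (cmeasurable_cst A 1)).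
Qed.

Lemma ae_all_asumC_child_weight :
  {ae P, forall w, forall u, (asumC (fun i => cw u i w) < +oo)%E}.
Proof.
have : {ae P, forall w, forall n, forall u, pickle_inv n = Some u ->
    (asumC (fun i => cw u i w) < +oo)%E}.
  apply: ae_foralln => n; case: (pickle_inv n) => [u|].
    apply: filterS (ae_asumC_child_weight HM m_gt0 mreal_lty u) => w wu v [<-].
    exact: wu.
  by apply: aeW.
by apply: filterS => w h u; apply: (h (pickle u)); exact: pickleK_inv.
Qed.

Lemma Z1_offspring_sum : {ae P, forall w, Z P M 1 lambda w = off [::] w}.
Proof.
apply: filterS (ae_asumC_gen_weight HM m_gt0 mreal_lty) => w woo.
rewrite Z_gen_weight//.
have bij : set_bij [set: nat] [set v : seq nat | size v = 1%N] (fun i => [:: i]).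
  split => //; first by move=> i j _ _ [].
  by move=> [|i [|//]] //= _; exists i.
transitivity (sumC [set v : seq nat | size v = 1%N] (gw 1 ^~ w)).
  rewrite [RHS]sumC_mkcond; apply: eq_sumC => v _; case: ifPn => //.
  by rewrite notin_setE /gen_weight /= => /eqP/negPf ->.
rewrite (sumC_reindex _ bij); apply: eq_sumC => i _ /=.
rewrite -[[:: i]]/(rcons [::] i) gen_weight_rcons gen_weight0 mul1r.
by [].
Qed.

(** Generation n + 1 is summed parent by parent; its almost sure absolute convergence justifies the
    double sum. *)
Lemma ae_martingale_increment : {ae P, forall w, forall n,
  Z P M n.+1 lambda w - Z P M n lambda w = weighted_series xi (gw n ^~ w) w}.
Proof.
apply: filterS2 (ae_asumC_gen_weight HM m_gt0 mreal_lty) ae_all_asumC_child_weight => w woo cwoo n.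
rewrite !Z_gen_weight//.
have dbl : (\esum_(u in [set: seq nat]) asumC (fun i => (gw n u w * cw u i w)%R) < +oo)%E.
  have := woo n.+1; rewrite /asumC esum_rcons; last 2 first.
  - by move=> v; rewrite lee_fin modulus_ge0.
  - by rewrite gen_weight_nil modulusE/= expr0n addr0 sqrtr0.
  apply: le_lt_trans; apply: le_esum => u _; apply: le_esum => i _.
  by rewrite gen_weight_rcons.
rewrite (sumC_rcons (f := gw n.+1 ^~ w)); last by rewrite gen_weight_nil.
rewrite (eq_sumC (g := fun k => gw n k.1 w * cw k.1 k.2 w)); last first.
  by move=> k _; rewrite gen_weight_rcons.
rewrite -(sumC_fubini (F := fun u i => gw n u w * cw u i w))//.
have -> : sumC [set: seq nat] (fun u => sumC setT (fun i => gw n u w * cw u i w)) =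
    sumC setT (fun u => gw n u w * off u w).
  by apply: eq_sumC => u _; exact: (sumC_scale (gw n u w) (cwoo u)).
rewrite sumCB//; last first.
  apply: le_lt_trans dbl; apply: le_esum => u _.
  by have <- := sumC_scale (gw n u w) (cwoo u); exact: modulus_sumC_le.
by apply: eq_sumC => u _; rewrite /innovation mulrBr mulr1.
Qed.

(** The alternative in the second hypothesis is meant for words outside generation n: their
    innovation is not a function of the retained information, but its weight is identically 0. *)
Lemma cmeasurable_joint_series (I : countType) d1 (T1 : measurableType d1)
    d2 (T2 : measurableType d2) (f : I -> T1 -> R[i]) (g : I -> T2 -> R[i]) :
  (forall i, cmeasurable (f i)) ->
  (forall i, cmeasurable (g i) \/ forall x, f i x = 0) ->
  cmeasurable (fun z : T1 * T2 => sumC setT (fun i => f i z.1 * g i z.2)).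
Proof.
move=> mf mg; apply: cmeasurable_sumC => i.
have [mgu|f0] := mg i.
  apply: cmeasurableM; first exact: (cmeasurable_comp (mf i) measurable_fst).
  exact: (cmeasurable_comp mgu measurable_snd).
rewrite (_ : (fun _ => _) = fun=> 0); first exact: cmeasurable_cst.
by apply/funext => z; rewrite f0 mul0r.
Qed.

Section two_sided_bound.
Context (p : R).
Hypothesis p2 : 2 <= p.
Hypothesis xi_p : (\int[P]_w (modulus (xi [::] w) `^ p)%:E < +oo)%E.
Local Notation q := (p / 2).
Local Notation increment_moment n :=
  (\int[P]_w (modulus (Z P M n.+1 lambda w - Z P M n lambda w) `^ p)%:E)%E.
Local Notation Y n w := (\esum_(u in setT) (modulus (gw n u w) `^ 2)%:E)%E.

Let q1 : 1 <= q. Proof. by rewrite ler_pdivlMr// mul1r. Qed.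

Let sqrE (z : R[i]) : modulus z `^ 2 = modulus z ^+ 2.
Proof. by rewrite -powR_mulrn ?modulus_ge0. Qed.

(** The weights depend on words shorter than n and the relevant innovations on words of length n.
    Once the former are frozen, the inner integral concerns a series with constant coefficients, as
    in the Marcinkiewicz-Zygmund inequalities. *)
Lemma increment_moment_freeze n : increment_moment n =
  (\int[P]_w \int[P]_w' (modulus (weighted_series xi (gw n ^~ w) w') `^ p)%:E)%E.
Proof.
pose A := [set v : seq nat | (size v < n)%N].
pose B := [set v : seq nat | size v = n].
pose h (z : join_type G A * join_type G B) : \bar R :=
  (modulus (weighted_series xi (gw n ^~ z.1) z.2) `^ p)%:E.
have mh : measurable_fun setT h.
  apply: measurable_powR_modulus; rewrite /weighted_series.
  apply: (cmeasurable_joint_series (f := gw n : _ -> join_type G A -> _)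
    (g := xi : _ -> join_type G B -> _)) => u.
    exact: cmeasurable_gen_weight.
  have [su|su] := eqVneq (size u) n.
    left; apply: cmeasurable_join_subset (cmeasurable_innovation_join u).
    by move=> _ ->.
  by right => x; rewrite /gen_weight (negPf su).
transitivity (\int[P]_w h (w, w))%E.
  apply: ge0_ae_eq_integral.
  - exact: measurableT.
  - apply: measurable_powR_modulus.
    by apply: cmeasurableB; exact: cmeasurable_Z.
  - apply: measurable_powR_modulus.
    have := cmeasurable_sumC (f := fun u w => gw n u w * xi u w); apply => u.
    apply: cmeasurableM; first exact: cmeasurable_gw.
    exact: cmeasurable_innovation.
  - by move=> w _; rewrite lee_fin powR_ge0.
  - by move=> w _; rewrite lee_fin powR_ge0.
  - by apply: filterS ae_martingale_increment => w -> _.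
have AB : A `&` B = set0.
  apply/seteqP; split => // v [vA vB]; move: vA vB; rewrite /A /B /= => vA vB.
  by move: vA; rewrite vB ltnn.
have h0 z : (0 <= h z)%E by rewrite lee_fin powR_ge0.
exact: (ge0_integral_freeze sigmaG subG indG AB mh h0).
Qed.

Let mseries (a : T -> seq nat -> R[i]) : (forall u, cmeasurable (a ^~ u)) ->
  measurable_fun setT (fun w => \int[P]_w' (modulus (weighted_series xi (a w) w') `^ p)%:E)%E.
Proof.
move=> ma; apply: (@measurable_fun_fubini_tonelli_F _ _ T T R P (fun z : T * T =>
  (modulus (weighted_series xi (a z.1) z.2) `^ p)%:E)) => [|z].
  apply: measurable_powR_modulus.
  apply: (cmeasurable_joint_series (f := fun u w => a w u) (g := xi)) => // u.
  by left; exact: cmeasurable_innovation.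
by rewrite lee_fin powR_ge0.
Qed.

Lemma innovation_sqr_lty : (\int[P]_w (modulus (xi [::] w) ^+ 2)%:E < +oo)%E.
Proof.
have mm := measurable_modulus (cmeasurable_innovation [::]).
apply: (@le_lt_trans _ _ (\int[P]_w (1%:E + (modulus (xi [::] w) `^ p)%:E))%E).
  apply: ge0_le_integral => //.
  - by move=> w _; rewrite lee_fin sqr_ge0.
  - exact/measurable_EFinP/measurable_funX.
  - apply: emeasurable_funD => //; apply: measurable_powR_modulus.
    exact: cmeasurable_innovation.
  - move=> w _; rewrite -EFinD lee_fin -sqrE.
    have [h|h] := leP (modulus (xi [::] w)) 1.
      rewrite (@le_trans _ _ 1)// ?lerDl ?powR_ge0// sqrE.
      by rewrite expr_le1// modulus_ge0.
    by apply: (le_trans (ler_powR (ltW h) p2)); rewrite lerDr.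
rewrite ge0_integralD//; last 2 first.
- by move=> w _; rewrite lee_fin powR_ge0.
- by apply: measurable_powR_modulus; exact: cmeasurable_innovation.
by rewrite integral_probability_cst lte_add_pinfty// ltry.
Qed.

Let xi2_lty := innovation_sqr_lty.

Let s2 := fine (\int[P]_w (modulus (xi [::] w) ^+ 2)%:E)%E.
Let mu := fine (\int[P]_w (modulus (xi [::] w) `^ p)%:E)%E.

Let xi_s2 u : (\int[P]_w (modulus (xi u w) ^+ 2)%:E = s2%:E)%E.
Proof.
rewrite /s2 fineK; last first.
  by rewrite ge0_fin_numE//; apply: integral_ge0 => w _; rewrite lee_fin sqr_ge0.
have E v : (\int[P]_w (modulus (xi v w) ^+ 2)%:E = \int[P]_w (modulus (xi v w) `^ 2)%:E)%E.
  by apply: eq_integral => w _; rewrite sqrE.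
exact: etrans (E u) (etrans (innovation_moment u 2) (esym (E [::]))).
Qed.

Let xi_mu u : (\int[P]_w (modulus (xi u w) `^ p)%:E = mu%:E)%E.
Proof.
rewrite innovation_moment /mu fineK//.
by rewrite ge0_fin_numE//; apply: integral_ge0 => w _; rewrite lee_fin powR_ge0.
Qed.

Let xi_mean1 u := (innovation_mean u).1.
Let xi_mean2 u := (innovation_mean u).2.

Let mY n : measurable_fun setT (fun w => Y n w).
Proof.
apply: measurable_fun_esum => [u w|u]; first by rewrite lee_fin powR_ge0.
apply: measurable_powR_modulus; exact: cmeasurable_gw.
Qed.

Let Y0 n w : (0 <= Y n w)%E.
Proof. by apply: esum_ge0 => u _; rewrite lee_fin powR_ge0. Qed.

Lemma increment_moment_le : exists2 K : R, 0 <= K & forall n,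
  (increment_moment n <= K%:E * \int[P]_w (Y n w `^ q))%E.
Proof.
have [K K0 HK] := marcinkiewicz_zygmund_le sigmaG subG indG p2
  cmeasurable_innovation_join xi_mean1 xi_mean2 xi_s2 xi_mu.
exists (K `^ q) => [|n]; first exact: powR_ge0.
rewrite increment_moment_freeze -ge0_integralZl//; last 3 first.
- exact: (measurableT_comp (measurable_poweR _)).
- by move=> w _; exact: poweR_ge0.
- by rewrite lee_fin powR_ge0.
apply: ae_ge0_le_integral => //.
- by move=> w _; apply: integral_ge0 => w' _; rewrite lee_fin powR_ge0.
- by apply: (mseries (a := fun w u => gw n u w)) => u; exact: cmeasurable_gw.
- by move=> w _; rewrite mule_ge0 ?poweR_ge0// lee_fin powR_ge0.
- by apply: measurable_funeM; exact: (measurableT_comp (measurable_poweR _)).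
apply: filterS (ae_asumC_gen_weight HM m_gt0 mreal_lty) => w /(_ n) woo _.
apply: (le_trans (HK _ woo)).
rewrite poweRM ?lee_fin//; last by apply: esum_ge0 => u _; rewrite lee_fin sqr_ge0.
rewrite -poweR_EFin le_eqVlt; apply/orP; left; apply/eqP.
by congr (_ * (_ `^ _))%E; apply: eq_esum => u _; rewrite sqrE.
Qed.

(** The constant (s2 / 2)^q is positive exactly because Z_1 is not degenerate; this is where
    nontriviality of the martingale will be used. *)
Lemma increment_moment_ge : 0 < s2 -> exists2 c : R, 0 < c & forall n,
  (c%:E * \int[P]_w (Y n w `^ q) <= increment_moment n)%E.
Proof.
move=> s20; exists ((s2 / 2) `^ q) => [|n]; first by rewrite powR_gt0// divr_gt0.
rewrite increment_moment_freeze -ge0_integralZl//; last 3 first.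
- exact: (measurableT_comp (measurable_poweR _)).
- by move=> w _; exact: poweR_ge0.
- by rewrite lee_fin powR_ge0.
apply: ae_ge0_le_integral => //.
- by move=> w _; rewrite mule_ge0 ?poweR_ge0// lee_fin powR_ge0.
- by apply: measurable_funeM; exact: (measurableT_comp (measurable_poweR _)).
- by move=> w _; apply: integral_ge0 => w' _; rewrite lee_fin powR_ge0.
- by apply: (mseries (a := fun w u => gw n u w)) => u; exact: cmeasurable_gw.
apply: filterS (ae_asumC_gen_weight HM m_gt0 mreal_lty) => w /(_ n) woo _.
(* An absolutely summable family is square summable: the sum of squares is at most the square of the
   sum. *)
have Yoo : (\esum_(u in [set: seq nat]) (modulus (gw n u w) ^+ 2)%:E < +oo)%E.
  have h12 : 1 <= 2 :> R by lra.
  apply: le_lt_trans (poweR_lty 2 woo).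
  apply: le_trans (esum_powR_le h12 (fun u => modulus_ge0 (gw n u w))).
  by apply: le_esum => u _; rewrite sqrE.
have := marcinkiewicz_zygmund_ge sigmaG subG indG p2
  cmeasurable_innovation_join xi_mean1 xi_mean2 xi_s2 xi_mu woo Yoo.
apply: le_trans.
rewrite poweRM ?lee_fin ?divr_ge0 ?(ltW s20)//; last first.
  by apply: esum_ge0 => u _; rewrite lee_fin sqr_ge0.
rewrite -poweR_EFin le_eqVlt; apply/orP; left; apply/eqP.
by congr (_ * (_ `^ _))%E; apply: eq_esum => u _; rewrite sqrE.
Qed.

End two_sided_bound.

Section quadratic_sum_decay.
Context (q : R).
Hypothesis q1 : 1 <= q.
Local Notation Y n w := (\esum_(u in setT) (modulus (gw n u w) `^ 2)%:E)%E.
Local Notation wm := (weight_moment P M lambda).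

Let two0 : 2 != 0 :> R. Proof. by rewrite pnatr_eq0. Qed.

Let csum u w := (\esum_(i in setT) (modulus (cw u i w) `^ 2)%:E)%E.

Let csum0 u w : (0 <= csum u w)%E.
Proof. by apply: esum_ge0 => i _; rewrite lee_fin powR_ge0. Qed.

Let mcsum_join u : measurable_fun setT (csum u : join_type G [set u] -> \bar R).
Proof.
apply: measurable_fun_esum => [i w|i]; first by rewrite lee_fin powR_ge0.
apply: measurable_powR_modulus; exact: cmeasurable_child_weight.
Qed.

Let mcsum u : measurable_fun setT (csum u).
Proof.
apply: (measurable_from_join subG (A := [set u])); exact: mcsum_join.
Qed.

Lemma quadratic_sum1 w : Y 1 w = csum [::] w.
Proof.
rewrite esum_gen_weightS//; transitivity (\esum_(u in [set ([::] : seq nat)]) csum u w)%E.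
  rewrite [RHS]esum_mkcond; apply: eq_esum => u _; rewrite gen_weight0.
  have -> : (u \in [set ([::] : seq nat)]) = (u == [::]).
    by apply/idP/eqP => [/set_mem|->] //; exact/mem_set.
  case: eqP => _.
    by rewrite modulusE/= expr1n expr0n addr0 sqrtr1 powR1 mul1e.
  by rewrite modulusE/= expr0n addr0 sqrtr0 powR0// mul0e.
by rewrite esum_set1.
Qed.

Hypothesis wm2_lty : (wm 2 < +oo)%E.
Hypothesis Y1_pow : (\int[P]_w (Y 1 w `^ q) < +oo)%E.

Let wm0 r : (0 <= wm r)%E.
Proof.
by apply: integral_ge0 => w _; apply: esum_ge0 => i _; rewrite lee_fin powR_ge0.
Qed.

Let csum_moment u : (\int[P]_w csum u w = wm 2)%E.
Proof. exact: (weight_moment_child lambda HM u two0). Qed.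

Let ae_csum_lty : {ae P, forall w, forall u, (csum u w < +oo)%E}.
Proof.
have : {ae P, forall w, forall n, forall u, pickle_inv n = Some u -> (csum u w < +oo)%E}.
  apply: ae_foralln => n; case: (pickle_inv n) => [u|]; last exact: aeW.
  have : {ae P, forall w, (csum u w < +oo)%E}.
    apply: (ge0_integral_lty_ae (mcsum u) (csum0 u)).
    by rewrite csum_moment.
  by apply: filterS => w wu v [<-].
by apply: filterS => w h u; apply: (h (pickle u)); exact: pickleK_inv.
Qed.

(** Real-valued version of [csum], almost surely equal to it for all u at once because w(2) is
    finite. *)
Let eta u w := fine (csum u w).

Let meta_join u : measurable_fun setT (eta u : join_type G [set u] -> R).
Proof.
by apply: (measurableT_comp (f := fine)); [exact: fine_measurable|exact: mcsum_join].
Qed.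

Let meta u : measurable_fun setT (eta u).
Proof.
by apply: (measurableT_comp (f := fine)); [exact: fine_measurable|exact: mcsum].
Qed.

Let eta0 u w : 0 <= eta u w. Proof. exact: fine_ge0. Qed.

Let csumE u w : (csum u w < +oo)%E -> csum u w = (eta u w)%:E.
Proof. by move=> wu; rewrite fineK// ge0_fin_numE. Qed.

Let Eeta u : (\int[P]_w (eta u w)%:E <= (fine (wm 2))%:E)%E.
Proof.
rewrite fineK ?ge0_fin_numE// -(csum_moment u).
apply: ae_ge0_le_integral => //; first by move=> w _; rewrite lee_fin.
  exact/measurable_EFinP.
by apply: filterS ae_csum_lty => w /(_ u) wu _; rewrite (csumE wu).
Qed.

Let Eeta_pow u : (\int[P]_w (eta u w `^ q)%:E <= (fine (\int[P]_w (Y 1 w `^ q)))%:E)%E.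
Proof.
rewrite fineK; last first.
  by rewrite ge0_fin_numE//; apply: integral_ge0 => w _; exact: poweR_ge0.
have mpow : measurable_fun setT (fun x : \bar R => (x `^ q)%E) by exact: measurable_poweR.
have E := child_pow_law lambda HM u two0 mpow (fun x => poweR_ge0 x q).
have -> : (\int[P]_w (Y 1 w `^ q) = \int[P]_w (csum u w `^ q))%E.
  by apply: etrans (esym E); apply: eq_integral => w _; rewrite quadratic_sum1.
apply: ae_ge0_le_integral.
- exact: measurableT.
- by move=> w _; rewrite lee_fin powR_ge0.
- by apply/measurable_EFinP; exact: (measurableT_comp (measurable_powR _)).
- by move=> w _; exact: poweR_ge0.
- exact: (measurableT_comp mpow).
apply: filterS ae_csum_lty => w /(_ u) wu _.
by rewrite (csumE wu) poweR_EFin.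
Qed.

(** With the first n generations frozen, [integral_pow_series_le] applies with the weights |w_u|^2.
    Its remainder is the sum of |w_u|^(2q), of mean w(2q)^n. *)
Lemma quadratic_sum_step (rho' : R) : (wm 2 < rho'%:E)%E ->
  exists2 C : R, 0 <= C & forall n,
  (\int[P]_w (Y n.+1 w `^ q) <=
   (rho' `^ q)%:E * \int[P]_w (Y n w `^ q) + C%:E * wm (2 * q) ^+ n)%E.
Proof.
move=> rr.
have rho0 : 0 <= fine (wm 2) by exact: fine_ge0.
have rr' : fine (wm 2) < rho' by rewrite -lte_fin fineK// ge0_fin_numE.
have [C C0 HC] := integral_pow_series_le sigmaG subG indG q1 eta0 meta_join
  Eeta Eeta_pow rho0 rr'.
exists C => // n.
have mpow : measurable_fun setT (fun x : \bar R => (x `^ q)%E) by exact: measurable_poweR.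
pose A := [set v : seq nat | (size v < n)%N].
pose B := [set v : seq nat | size v = n].
pose h (z : join_type G A * join_type G B) : \bar R :=
  ((\esum_(u in setT) (modulus (gw n u z.1) `^ 2 * eta u z.2)%:E) `^ q)%E.
have term0 u w w' : (0 <= (modulus (gw n u w) `^ 2 * eta u w')%:E)%E.
  by rewrite lee_fin mulr_ge0// powR_ge0.
have mh : measurable_fun setT h.
  apply: (measurableT_comp mpow); apply: measurable_fun_esum => [u z|u].
    exact: term0.
  have [su|su] := eqVneq (size u) n; last first.
    rewrite (_ : (fun _ => _) = fun=> 0%:E); first exact: measurable_cst.
    apply/funext => z; rewrite /gen_weight (negPf su).
    by rewrite modulusE/= expr0n addr0 sqrtr0 powR0// mul0r.
  apply/measurable_EFinP; apply: measurable_funM.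
    apply: (measurableT_comp (measurable_powR _)); apply: measurable_modulus.
    apply: (cmeasurable_comp (f := gw n u : join_type G A -> R[i]) _ measurable_fst).
    exact: cmeasurable_gen_weight.
  have meta_B : measurable_fun setT (eta u : join_type G B -> R).
    apply: (measurable_join_subset (A := [set u]) (B := B) (f := eta u)) => //.
    by move=> _ ->.
  exact: (measurableT_comp meta_B measurable_snd).
have h0 z : (0 <= h z)%E by exact: poweR_ge0.
have AB : A `&` B = set0.
  apply/seteqP; split => // v [vA vB]; move: vA vB; rewrite /A /B /= => vA vB.
  by move: vA; rewrite vB ltnn.
have mY n' : measurable_fun setT (fun w => Y n' w).
  apply: measurable_fun_esum => [u w|u]; first by rewrite lee_fin powR_ge0.
  apply: measurable_powR_modulus; exact: cmeasurable_gw.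
have Y0 n' w : (0 <= Y n' w)%E by apply: esum_ge0 => u _; rewrite lee_fin powR_ge0.
have mser : measurable_fun setT (fun w => \esum_(u in setT) (modulus (gw n u w) `^ (2 * q))%:E)%E.
  apply: measurable_fun_esum => [u w|u]; first by rewrite lee_fin powR_ge0.
  apply: measurable_powR_modulus; exact: cmeasurable_gw.
have q0 : q != 0 by rewrite gt_eqF// (lt_le_trans ltr01 q1).
have -> : (\int[P]_w (Y n.+1 w `^ q) = \int[P]_w h (w, w))%E.
  apply: ge0_ae_eq_integral.
  - exact: measurableT.
  - exact: (measurableT_comp mpow).
  - apply: (measurableT_comp mpow); apply: measurable_fun_esum => [u z|u].
      exact: term0.
    apply/measurable_EFinP; apply: measurable_funM => //.
    apply: (measurableT_comp (measurable_powR _)); apply: measurable_modulus.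
    exact: cmeasurable_gw.
  - by move=> w _; exact: poweR_ge0.
  - by move=> w _; exact: h0.
  - apply: filterS ae_csum_lty => w wu _.
    congr (_ `^ _)%E; rewrite esum_gen_weightS//; apply: eq_esum => u _ /=.
    by rewrite EFinM -(csumE (wu u)).
have -> := ge0_integral_freeze sigmaG subG indG AB mh h0.
apply: (@le_trans _ _ (\int[P]_w ((rho' `^ q)%:E * (Y n w `^ q)
   + C%:E * \esum_(u in setT) (modulus (gw n u w) `^ (2 * q))%:E))%E).
  apply: ge0_le_integral.
  - exact: measurableT.
  - by move=> w _; apply: integral_ge0 => w' _; exact: h0.
  - apply: (@measurable_fun_fubini_tonelli_F _ _ T T R P (fun z : T * T =>
      (\esum_(u in setT) (modulus (gw n u z.1) `^ 2 * eta u z.2)%:E) `^ q)%E) => [|z].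
      apply: (measurableT_comp mpow); apply: measurable_fun_esum => [u z|u].
        exact: term0.
      apply/measurable_EFinP; apply: measurable_funM.
        apply: (measurableT_comp (measurable_powR _)); apply: measurable_modulus.
        exact: (cmeasurable_comp (cmeasurable_gw lambda HM n u) measurable_fst).
      exact: (measurableT_comp (meta u) measurable_snd).
    exact: poweR_ge0.
  - apply: emeasurable_funD; apply: measurable_funeM => //.
    exact: (measurableT_comp mpow).
  - move=> w _; have := HC (fun u => modulus (gw n u w) `^ 2) (fun u => powR_ge0 _ _).
    move=> /le_trans; apply; apply: leeD.
      rewrite poweRM// ?poweR_EFin// lee_fin; lra.
    apply: lee_wpmul2l; first by rewrite lee_fin.
    by apply: le_esum => u _; rewrite powRrM.
rewrite ge0_integralD//; last 4 first.
- by move=> w _; rewrite mule_ge0 ?poweR_ge0// lee_fin powR_ge0.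
- by apply: measurable_funeM; exact: (measurableT_comp mpow).
- move=> w _; rewrite mule_ge0// ?lee_fin//; apply: esum_ge0 => u _.
  by rewrite lee_fin powR_ge0.
- exact: measurable_funeM.
rewrite !ge0_integralZl//; last 4 first.
- by move=> w _; apply: esum_ge0 => u _; rewrite lee_fin powR_ge0.
- exact: (measurableT_comp mpow).
- by move=> w _; exact: poweR_ge0.
- by rewrite lee_fin powR_ge0.
by rewrite (integral_esum_gen_weight lambda HM n (mulf_neq0 two0 q0)).
Qed.

End quadratic_sum_decay.
End martingale_increments.


(** * Convergence in L^p *)

Section Lp_norm.
Local Open Scope classical_set_scope.
Local Open Scope ring_scope.
Context d (T : measurableType d) (R : realType) (P : probability T R).
Context (p : R).
Hypothesis p1 : 1 <= p.
Implicit Types (Y : T -> R[i]).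

Let p0 : 0 < p. Proof. exact: lt_le_trans p1. Qed.
Let pn0 : p != 0. Proof. by rewrite gt_eqF. Qed.

Lemma normLp_pow Y : (normLp P p Y `^ p = \int[P]_w (modulus (Y w) `^ p)%:E)%E.
Proof.
rewrite /normLp (powR_Lnorm _ _ pn0); apply: eq_integral => w _.
have -> : (EFin \o (fun w => modulus (Y w))) w = (modulus (Y w))%:E by [].
by rewrite abse_EFin poweR_EFin ger0_norm// modulus_ge0.
Qed.

Lemma normLp_ge0 Y : (0 <= normLp P p Y)%E.
Proof. exact: Lnorm_ge0. Qed.

Let int01 (y : \bar R) : (0 <= y)%E -> y \in `[0%E, +oo%E].
Proof. by move=> y0; rewrite in_itv/= y0 leey. Qed.

Let pV : 0 <= p^-1. Proof. by rewrite invr_ge0 ltW. Qed.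

Let poweR_inj (x y : \bar R) : (0 <= x)%E -> (0 <= y)%E -> (x `^ p <= y `^ p)%E -> (x <= y)%E.
Proof.
move=> x0 y0 /(gt0_ler_poweR pV (int01 (poweR_ge0 _ _)) (int01 (poweR_ge0 _ _))).
by rewrite -!poweRrM mulfV// !poweRe1.
Qed.

Lemma normLp_le Y (x : R) : 0 <= x ->
  (\int[P]_w (modulus (Y w) `^ p)%:E <= (x `^ p)%:E)%E -> (normLp P p Y <= x%:E)%E.
Proof.
rewrite -normLp_pow -poweR_EFin => x0 h.
by apply: poweR_inj h; [exact: normLp_ge0|rewrite lee_fin].
Qed.

Lemma normLp_lty Y : (normLp P p Y < +oo)%E <->
  (\int[P]_w (modulus (Y w) `^ p)%:E < +oo)%E.
Proof.
rewrite -normLp_pow; split; first exact: poweR_lty.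
exact: lty_poweRy.
Qed.

Lemma normLp_triangle Y Y' : cmeasurable Y -> cmeasurable Y' ->
  (normLp P p (fun w => (Y w + Y' w)%R) <= normLp P p Y + normLp P p Y')%E.
Proof.
move=> mY mY'.
have mm := measurable_modulus mY; have mm' := measurable_modulus mY'.
apply: le_trans (@minkowski_EFin _ _ _ P _ _ p mm mm' p1).
set g := (_ \+ _); have g0 w : 0 <= g w by rewrite addr_ge0 ?modulus_ge0.
apply: poweR_inj; [exact: normLp_ge0|exact: Lnorm_ge0|].
rewrite normLp_pow (powR_Lnorm _ _ pn0); apply: ge0_le_integral.
- exact: measurableT.
- by move=> w _; rewrite lee_fin powR_ge0.
- by apply: measurable_powR_modulus; exact: cmeasurableD.
- apply: (measurableT_comp (measurable_poweR _)); apply: measurableT_comp => //.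
  by apply/measurable_EFinP; exact: measurable_funD.
- move=> w _; have -> : (EFin \o g) w = (g w)%:E by [].
  rewrite abse_EFin poweR_EFin lee_fin ger0_norm//.
  by apply: ge0_ler_powR; rewrite ?nnegrE ?modulus_ge0 ?(ltW p0)//; exact: le_normcD.
Qed.

Lemma normLpN Y : normLp P p (fun w => - Y w) = normLp P p Y.
Proof. by congr (Lnorm _ _ _); apply/funext => w; rewrite /comp normcN. Qed.

Lemma normLp_subC Y Y' :
  normLp P p (fun w => Y w - Y' w) = normLp P p (fun w => Y' w - Y w).
Proof. by rewrite -normLpN; congr (normLp _ _ _); apply/funext => w; rewrite opprB. Qed.

(* Summable increments: the limit is taken almost surely, then the norms pass
   to the limit by Fatou's lemma. *)
Lemma cvg_Lp_geometric (Z : nat -> T -> R[i]) (K s : R) :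
  (forall n, cmeasurable (Z n)) -> (normLp P p (Z 0%N) < +oo)%E ->
  0 <= K -> 0 < s -> s < 1 ->
  (forall n, \int[P]_w (modulus (Z n.+1 w - Z n w) `^ p)%:E <= (K * (s ^+ n) `^ p)%:E)%E ->
  cvg_Lp P p Z.
Proof.
move=> mZ Z0 K0 s0 s1 HD.
pose k := K `^ p^-1; have k0 : 0 <= k by exact: powR_ge0.
have sn0 n : 0 < s ^+ n by exact: exprn_gt0.
have s1' : 0 < 1 - s by rewrite subr_gt0.
have kp : k `^ p = K by rewrite /k -powRrM mulVf// powRr1.
have mD n : cmeasurable (fun w => Z n.+1 w - Z n w) by exact: cmeasurableB.
have ND n : (normLp P p (fun w => (Z n.+1 w - Z n w)%R) <= (k * s ^+ n)%:E)%E.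
  apply: normLp_le; first by rewrite mulr_ge0// ltW.
  by rewrite powRM ?(ltW (sn0 n))// kp.
(* The partial geometric sum is kept explicit so that the induction on m closes with equality. *)
have Nmn n m : (normLp P p (fun w => (Z (m + n)%N w - Z n w)%R) <=
    (k * s ^+ n * (1 - s ^+ m) / (1 - s))%:E)%E.
  elim: m => [|m IH].
    apply: normLp_le; first by rewrite expr0 subrr mulr0 mul0r.
    rewrite (eq_integral (fun=> 0%E)) ?integral0 ?lee_fin ?powR_ge0// => w _.
    by rewrite add0n subrr modulusE/= expr0n addr0 sqrtr0 powR0.
  have -> : (fun w => Z (m.+1 + n)%N w - Z n w) =
      (fun w => (Z (m + n)%N w - Z n w) + (Z (m + n).+1 w - Z (m + n)%N w)).
    by apply/funext => w; rewrite addSn [RHS]addrC addrA subrK.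
  apply: (le_trans (normLp_triangle _ _)) => //; first exact: cmeasurableB.
  apply: (le_trans (leeD IH (ND _))); rewrite -EFinD lee_fin.
  rewrite le_eqVlt; apply/orP; left; apply/eqP.
  by rewrite exprD exprS; field; rewrite gt_eqF.
pose C := k / (1 - s); have C0 : 0 <= C by rewrite divr_ge0// ltW.
have NC n m : (\int[P]_w (modulus (Z n w - Z (m + n)%N w) `^ p)%:E <= ((C * s ^+ n) `^ p)%:E)%E.
  have -> : (\int[P]_w (modulus (Z n w - Z (m + n)%N w) `^ p)%:E =
      \int[P]_w (modulus (Z (m + n)%N w - Z n w) `^ p)%:E)%E.
    by rewrite -!normLp_pow normLp_subC.
  rewrite -normLp_pow -poweR_EFin; apply: gt0_ler_poweR; first exact: ltW.
  - by rewrite in_itv/= leey andbT normLp_ge0.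
  - by rewrite in_itv/= leey andbT lee_fin mulr_ge0// ltW.
  apply: (le_trans (Nmn n m)); rewrite lee_fin /C [leRHS]mulrAC ler_wpM2r ?invr_ge0 ?(ltW s1')//.
  rewrite -[leRHS]mulr1 ler_wpM2l ?mulr_ge0 ?(ltW (sn0 n))// lerBlDr lerDl.
  by rewrite ltW.
have aeD : {ae P, forall w, (asumC (fun n => (Z n.+1 w - Z n w)%R) < +oo)%E}.
  have mterm n : measurable_fun setT (fun w => (modulus (Z n.+1 w - Z n w))%:E).
    exact/measurable_EFinP/measurable_modulus.
  have term0 n w : (0 <= (modulus (Z n.+1 w - Z n w))%:E)%E by rewrite lee_fin modulus_ge0.
  apply: ge0_integral_lty_ae.
  - exact: measurable_fun_esum.
  - by move=> w; exact: esum_ge0.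
  rewrite integral_esum//.
  apply: (@le_lt_trans _ _ (\esum_(n in [set: nat]) ((1 + K)%:E * (s ^+ n)%:E))%E).
    apply: le_esum => n _.
    (* With this c, x <= s^n + c x^p for all x >= 0, the power taking over once x > s^n. The p-th
       moment bound thereby yields the first moment bound (1 + K) s^n. *)
    pose c := (s ^+ n) `^ (1 - p); have c0 : 0 <= c by exact: powR_ge0.
    apply: (@le_trans _ _ (\int[P]_w ((s ^+ n)%:E
        + c%:E * (modulus (Z n.+1 w - Z n w) `^ p)%:E))%E).
      apply: ge0_le_integral => //.
      - apply: emeasurable_funD => //; apply: measurable_funeM.
        exact: measurable_powR_modulus.
      - move=> w _; rewrite -EFinM -EFinD lee_fin.
        set x := modulus _; have x0 : 0 <= x by exact: modulus_ge0.
        have [xs|xs] := leP x (s ^+ n).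
          by rewrite (le_trans xs)// lerDl mulr_ge0// powR_ge0.
        have xp : 0 < x by exact: lt_trans xs.
        apply: (@le_trans _ _ (c * x `^ p)); last by rewrite lerDr ltW.
        have e : x = x `^ (1 - p) * x `^ p.
          by rewrite -powRD ?subrK ?powRr1//; apply/implyP; rewrite gt_eqF.
        rewrite [leLHS]e; apply: ler_wpM2r; first exact: powR_ge0.
        rewrite /c -opprB !powRN lef_pV2 ?posrE ?powR_gt0//.
        apply: ge0_ler_powR; rewrite ?nnegrE ?subr_ge0 ?(ltW xs)//; exact: ltW.
    rewrite ge0_integralD//; last 3 first.
    - by move=> w _; rewrite lee_fin ltW.
    - by move=> w _; rewrite -EFinM lee_fin mulr_ge0// powR_ge0.
    - by apply: measurable_funeM; exact: measurable_powR_modulus.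
    rewrite integral_probability_cst ge0_integralZl//; last 2 first.
    - exact: measurable_powR_modulus.
    - by move=> w _; rewrite lee_fin powR_ge0.
    apply: (@le_trans _ _ ((s ^+ n)%:E + c%:E * (K * (s ^+ n) `^ p)%:E)%E).
      by apply: leeD => //; apply: lee_wpmul2l => //; exact: HD.
    rewrite -!EFinM -EFinD lee_fin le_eqVlt; apply/orP; left; apply/eqP.
    have e : c * (s ^+ n) `^ p = s ^+ n.
      rewrite /c -powRD ?subrK ?powRr1// ?(ltW (sn0 n))//.
      by apply/implyP; rewrite gt_eqF.
    by rewrite mulrCA e; ring.
  rewrite esumZl ?addr_ge0//; last by move=> n; rewrite lee_fin ltW.
  rewrite lte_mul_pinfty ?lee_fin ?addr_ge0//.
  rewrite -nneseries_esumT; last by move=> n; rewrite lee_fin ltW.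
  have -> : (\sum_(n <oo) (s ^+ n)%:E = ((1 - s)^-1)%:E)%E.
    apply/cvg_lim => //.
    under eq_fun do rewrite sumEFin.
    apply: cvg_EFin; first exact: nearW.
    have := @cvg_geometric_series R 1 s; rewrite ger0_norm ?(ltW s0)// => /(_ s1).
    rewrite div1r; apply: cvg_trans; apply: near_eq_cvg; apply: nearW => n /=.
    by apply: eq_bigr => i _; rewrite /geometric/= mul1r.
  by rewrite ltry.
(* Defined everywhere; outside the almost sure event of absolute convergence the value of [sumC] is
   immaterial. *)
pose Zoo w := Z 0%N w + sumC setT (fun n => Z n.+1 w - Z n w).
have mZoo : cmeasurable Zoo.
  by apply: cmeasurableD => //; exact: cmeasurable_sumC.
have Noo n : (normLp P p (fun w => (Z n w - Zoo w)%R) <= (C * s ^+ n)%:E)%E.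
  apply: normLp_le; first by rewrite mulr_ge0// ltW.
  apply: (@ae_cvg_integral_le _ _ _ P (fun m w => modulus (Z n w - Z (m + n)%N w) `^ p)).
  - move=> m; apply: (measurableT_comp (measurable_powR _)).
    by apply: measurable_modulus; exact: cmeasurableB.
  - apply: (measurableT_comp (measurable_powR _)).
    by apply: measurable_modulus; exact: cmeasurableB.
  - by move=> *; exact: powR_ge0.
  - by move=> *; exact: powR_ge0.
  - apply: filterS aeD => w woo; apply: cvg_powR_ge0 => //.
      by move=> m; exact: modulus_ge0.
    have := @modulus_sumC_cvg R _ _ (Z n w - Z 0%N w) woo.
    rewrite -(cvg_shiftn n) /Zoo opprD addrA; apply: cvg_trans.
    apply: near_eq_cvg; apply: nearW => m /=; congr modulus.
    (* A natural number is its own code, so [cenum nat] is an initial segment and the sum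
       telescopes. *)
    have -> : \sum_(i <- cenum nat (m + n)) (Z i.+1 w - Z i w) = Z (m + n)%N w - Z 0%N w.
      rewrite /cenum; have -> : pmap (@pickle_inv nat) (iota 0 (m + n)) = iota 0 (m + n).
        elim: (iota _ _) => //= i l ->.
        by have -> : pickle_inv i = Some i by exact: (@pickleK_inv nat).
      have -> : iota 0 (m + n) = index_iota 0 (m + n) by rewrite /index_iota subn0.
      exact: telescope_sumr.
    by rewrite opprB addrA subrK.
  - exact: NC.
split.
  move=> n; have -> : Z n = (fun w => Z 0%N w + (Z (n + 0)%N w - Z 0%N w)).
    by apply/funext => w; rewrite addn0 addrC subrK.
  apply: (le_lt_trans (normLp_triangle _ _)) => //; first exact: cmeasurableB.
  by rewrite lte_add_pinfty// (le_lt_trans (Nmn 0%N n))// ltry.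
exists Zoo; have [m1 m2] := mZoo; split => //.
  have -> : Zoo = (fun w => Z 0%N w + (Zoo w - Z 0%N w)).
    by apply/funext => w; rewrite addrC subrK.
  apply: (le_lt_trans (normLp_triangle _ _)) => //; first exact: cmeasurableB.
  rewrite lte_add_pinfty//.
  by rewrite normLp_subC (le_lt_trans (Noo 0%N))// ltry.
apply: (@squeeze_cvge _ _ _ _ (fun=> 0%E) _ (fun n => (C * s ^+ n)%:E)).
- by apply: nearW => n; rewrite normLp_ge0 Noo.
- exact: cvg_cst.
apply: cvg_EFin; first exact: nearW.
rewrite -[X in _ --> X](mulr0 C); apply: cvgMr; apply: cvg_expr.
by rewrite ger0_norm// ltW.
Qed.

End Lp_norm.



(** * The criterion in terms of weight moments *)

Section Lp_criterion.
Local Open Scope classical_set_scope.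
Local Open Scope ring_scope.
Context d (T : measurableType d) (R : realType) (P : probability T R).
Context (M : reproduction T R) (lambda : R[i]).
Hypothesis HM : supercritical_brw P M.
Hypothesis m_gt0 : 0 < modulus (m P M lambda).
Hypothesis mreal_lty : (mreal P M (complex.Re lambda) < +oo)%E.
Context (p : R).
Hypothesis p2 : 2 <= p.
Implicit Types (u : seq nat) (w : T).
Notation gw := (gen_weight P M lambda).
Notation xi := (innovation P M lambda).
Notation wm := (weight_moment P M lambda).
Local Notation Zn := (fun n => Z P M n lambda).
Local Notation q := (p / 2).
Local Notation Y n w := (\esum_(u in setT) (modulus (gw n u w) `^ 2)%:E)%E.

Let p1 : 1 <= p. Proof. by rewrite (le_trans _ p2)// ler1n. Qed.
Let p0 : 0 < p. Proof. exact: lt_le_trans p1. Qed.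
Let pn0 : p != 0. Proof. by rewrite gt_eqF. Qed.
Let q1 : 1 <= q. Proof. by rewrite ler_pdivlMr// mul1r. Qed.
Let q0 : 0 < q. Proof. exact: lt_le_trans q1. Qed.
Let two0 : 2 != 0 :> R. Proof. by rewrite pnatr_eq0. Qed.
Let twoq : 2 * q = p. Proof. by rewrite mulrC divfK. Qed.

Let one_powR r : 1 `^ r = 1 :> R. Proof. by rewrite powR1. Qed.
Let mZ n : cmeasurable (Zn n). Proof. exact: cmeasurable_Z. Qed.

Let Y0 n w : (0 <= Y n w)%E.
Proof. by apply: esum_ge0 => u _; rewrite lee_fin powR_ge0. Qed.

Let mY n : measurable_fun setT (fun w => Y n w).
Proof.
apply: measurable_fun_esum => [u w|u]; first by rewrite lee_fin powR_ge0.
apply: measurable_powR_modulus; exact: cmeasurable_gw.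
Qed.

Let mYq n : measurable_fun setT (fun w => Y n w `^ q)%E.
Proof. exact: (measurableT_comp (measurable_poweR q) (mY n)). Qed.

Let wm0 r : (0 <= wm r)%E.
Proof.
by apply: integral_ge0 => w _; apply: esum_ge0 => i _; rewrite lee_fin powR_ge0.
Qed.

Let normLp_cst (z : R[i]) : (normLp P p (fun=> z) < +oo)%E.
Proof. by apply/(normLp_lty _ p1); rewrite integral_probability_cst ltry. Qed.

Lemma innovation_moment_lty : (\int[P]_w (modulus (Zn 1%N w) `^ p)%:E < +oo)%E ->
  (\int[P]_w (modulus (xi [::] w) `^ p)%:E < +oo)%E.
Proof.
move=> /(normLp_lty _ p1) Zoo.
have -> : (\int[P]_w (modulus (xi [::] w) `^ p)%:E =
    \int[P]_w (modulus (Zn 1%N w + (- 1)) `^ p)%:E)%E.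
  apply: ge0_ae_eq_integral.
  - exact: measurableT.
  - by apply: measurable_powR_modulus; exact: cmeasurable_innovation.
  - by apply: measurable_powR_modulus; exact: cmeasurableD (cmeasurable_cst _ _).
  - by move=> w _; rewrite lee_fin powR_ge0.
  - by move=> w _; rewrite lee_fin powR_ge0.
  - by apply: filterS (Z1_offspring_sum HM m_gt0 mreal_lty) => w ->.
apply/(normLp_lty _ p1).
have h := normLp_triangle P p1 (mZ 1%N) (cmeasurable_cst T (- 1)).
by apply: (le_lt_trans h); rewrite lte_add_pinfty.
Qed.

Lemma normLp_Z0 : (normLp P p (Zn 0%N) < +oo)%E.
Proof.
apply/(normLp_lty _ p1).
apply: (@le_lt_trans _ _ (\int[P]_w 1%:E)%E); last by rewrite integral_probability_cst ltry.
have E w : asumC (gw 0 ^~ w) = 1%E.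
  rewrite -(esum_gen_weight0 P M lambda w (oner_neq0 R)).
  by apply: eq_esum => u _; rewrite powRr1// modulus_ge0.
apply: ge0_le_integral.
- exact: measurableT.
- by move=> w _; rewrite lee_fin powR_ge0.
- by apply: measurable_powR_modulus.
- exact: measurable_cst.
- move=> w _; rewrite lee_fin.
  have h : modulus (Zn 0%N w) <= 1.
    rewrite Z_gen_weight// ?E ?ltry// -lee_fin -[leRHS](E w); exact: modulus_sumC_le.
  by rewrite -[leRHS](one_powR p) ge0_ler_powR ?nnegrE ?modulus_ge0// ltW.
Qed.

Lemma quadratic_sum_decay : (wm 2 < 1)%E -> (wm p < 1)%E ->
  (\int[P]_w (Y 1 w `^ q) < +oo)%E ->
  exists2 r : R, 0 < r < 1 & exists2 K, 0 <= K &
    forall n, (\int[P]_w (Y n w `^ q) <= (K * r ^+ n)%:E)%E.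
Proof.
move=> w2 wp Y1.
have fin r : (wm r < 1)%E -> wm r \is a fin_num.
  by move=> r1; rewrite ge0_fin_numE// (lt_trans r1)// ltry.
pose b := fine (wm p); have b0 : 0 <= b by exact: fine_ge0.
have bE : wm p = b%:E by rewrite /b (fineK (fin _ wp)).
have b1 : b < 1 by rewrite -lte_fin -bE; exact: wp.
clearbody b.
have w20 : 0 <= fine (wm 2) by exact: fine_ge0.
have w21 : fine (wm 2) < 1 by rewrite -lte_fin (fineK (fin _ w2)); exact: w2.
(* The midpoint of w(2) and 1: a contraction rate strictly above w(2). *)
pose rho := (1 + fine (wm 2)) / 2.
have rho0 : 0 < rho by rewrite /rho; lra.
have rho1 : rho < 1 by rewrite /rho; lra.
have rhoE : (wm 2 < rho%:E)%E by rewrite -[wm 2](fineK (fin _ w2)) lte_fin /rho; lra.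
clearbody rho; have [C C0 HC] := quadratic_sum_step HM q1
  (lt_trans w2 (ltry 1)) Y1 rhoE.
set a := rho `^ q in HC; have a0 : 0 <= a by exact: powR_ge0.
have a1 : a < 1.
  by rewrite /a -[ltRHS](one_powR q); apply: gt0_ltr_powR; rewrite ?nnegrE ?(ltW rho0).
(* r exceeds strictly both rates a = rho^q and b = w(p), so that no polynomial factor appears when
   they coincide. *)
clearbody a; pose r := (1 + Num.max a b) / 2.
have ar : a < r.
  have : a <= Num.max a b by rewrite le_max lexx.
  by rewrite /r; lra.
have br : b <= r.
  have : b <= Num.max a b by rewrite le_max lexx orbT.
  by rewrite /r; lra.
have r1 : r < 1.
  have : Num.max a b < 1 by rewrite gt_max a1 b1.
  by rewrite /r; lra.
have r0 : 0 < r by exact: le_lt_trans ar.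
exists r; first by rewrite r0.
(* Solves (r - a) K = (r - a) + C, so that a K + C <= r K and the induction closes. *)
pose K := 1 + C / (r - a).
have Cr0 : 0 <= C / (r - a) by rewrite divr_ge0// subr_ge0 ltW.
have K0 : 0 <= K by rewrite addr_ge0.
exists K => // n; elim: n => [|n IH].
  rewrite (eq_integral (fun=> 1%E)) ?integral_probability_cst ?expr0 ?mulr1 ?lee_fin ?lerDl//.
  by move=> w _; rewrite esum_gen_weight0// poweR_EFin powR1.
apply: (le_trans (HC n)); rewrite twoq bE -EFin_expe -EFinM.
apply: (@le_trans _ _ (a%:E * (K * r ^+ n)%:E + (C * b ^+ n)%:E)%E).
  by apply: leeD => //; apply: lee_wpmul2l.
rewrite -EFinM -EFinD lee_fin.
have rn0 : 0 <= r ^+ n by rewrite exprn_ge0// ltW.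
have bn : C * b ^+ n <= C * r ^+ n by rewrite ler_wpM2l// lerXn2r// nnegrE ltW.
apply: (le_trans (lerD (lexx _) bn)).
have -> : a * (K * r ^+ n) + C * r ^+ n = (a * K + C) * r ^+ n by ring.
rewrite exprS mulrA ler_wpM2r// -lerBrDl.
have -> : K * r - a * K = (r - a) + C.
  by rewrite /K; field; rewrite subr_eq0 gt_eqF.
by rewrite lerDr subr_ge0 ltW.
Qed.

Lemma cvg_Lp_Z : (\int[P]_w (modulus (Zn 1%N w) `^ p)%:E < +oo)%E ->
  (wm 2 < 1)%E -> (wm p < 1)%E -> (\int[P]_w (Y 1 w `^ q) < +oo)%E ->
  cvg_Lp P p Zn.
Proof.
move=> Z1 w2 wp Y1.
have [K K0 HK] := increment_moment_le HM m_gt0 mreal_lty p2 (innovation_moment_lty Z1).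
have [r /andP[r0 r1] [K' K'0 HK']] := quadratic_sum_decay w2 wp Y1.
(* The rate for norms: (s^n)^p = r^n. *)
pose s := r `^ p^-1.
have s0 : 0 < s by exact: powR_gt0.
have s1 : s < 1.
  by rewrite /s -[ltRHS](one_powR p^-1); apply: gt0_ltr_powR;
    rewrite ?nnegrE ?(ltW r0) ?invr_gt0.
apply: (@cvg_Lp_geometric _ _ _ P p p1 Zn (K * K') s) => //.
- exact: normLp_Z0.
- exact: mulr_ge0.
move=> n; apply: (le_trans (HK n)).
have sp : s `^ p = r by rewrite /s -powRrM mulVf// powRr1// ltW.
have -> : (s ^+ n) `^ p = r ^+ n.
  by rewrite -powR_mulrn ?(ltW s0)// -powRrM [_ * p]mulrC powRrM sp powR_mulrn// ltW.
by rewrite -mulrA EFinM; apply: lee_wpmul2l.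
Qed.

(** Zero variance would force the innovation at the root to vanish almost surely, that is, Z_1 =
    1. *)
Lemma innovation_variance_gt0 : (\int[P]_w (modulus (Zn 1%N w) `^ p)%:E < +oo)%E ->
  ~ trivial_martingale P M lambda ->
  0 < fine (\int[P]_w (modulus (xi [::] w) ^+ 2)%:E)%E.
Proof.
move=> Z1 nt.
have xi2 := innovation_sqr_lty HM p2 (innovation_moment_lty Z1).
have xi0 : (0 <= \int[P]_w (modulus (xi [::] w) ^+ 2)%:E)%E.
  by apply: integral_ge0 => w _; rewrite lee_fin sqr_ge0.
rewrite lt_neqAle fine_ge0// andbT eq_sym; apply/eqP => /eqP.
rewrite fine_eq0 ?ge0_fin_numE// => /eqP i0.
have mxi : measurable_fun setT (fun w => (modulus (xi [::] w) ^+ 2)%:E).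
  apply/measurable_EFinP/measurable_funX/measurable_modulus.
  exact: cmeasurable_innovation.
apply: nt; have /(ae_eq_integral_abs P measurableT mxi) : (\int[P]_w `|(modulus (xi [::] w) ^+ 2)%:E| = 0)%E.
  rewrite -[RHS]i0; apply: eq_integral => w _; rewrite gee0_abs// lee_fin.
  exact: sqr_ge0.
apply: filterS2 (Z1_offspring_sum HM m_gt0 mreal_lty) => w -> /(_ I) /eqP.
rewrite eqe sqrf_eq0 => /eqP /ComplexField.Normc.eq0_normc /eqP.
by rewrite subr_eq0 => /eqP.
Qed.

(** Otherwise the lower bound keeps the norm of every increment above c^(1/p), while the increments
    of a convergent sequence tend to 0. *)
Lemma cvg_Lp_quadratic_sum : cvg_Lp P p Zn -> ~ trivial_martingale P M lambda ->
  exists n, (\int[P]_w (Y n w `^ q) < 1)%E.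
Proof.
move=> [Zoo [Zinf [m1 m2 Zinf_lty Zcvg]]] nt.
have Z1 : (\int[P]_w (modulus (Zn 1%N w) `^ p)%:E < +oo)%E by apply/(normLp_lty _ p1).
have [c c0 Hc] := increment_moment_ge HM m_gt0 mreal_lty p2 (innovation_moment_lty Z1)
  (innovation_variance_gt0 Z1 nt).
apply: contrapT => /forallNP nY.
have mZinf : cmeasurable Zinf by [].
pose N n := normLp P p (fun w => Zn n w - Zinf w).
have ND n : ((c `^ p^-1)%:E <= N n.+1 + N n)%E.
  rewrite [N n]normLp_subC.
  have h := normLp_triangle P p1 (cmeasurableB (mZ n.+1) mZinf) (cmeasurableB mZinf (mZ n)).
  apply: le_trans h.
  have -> : (fun w => Zn n.+1 w - Zinf w + (Zinf w - Zn n w)) = (fun w => Zn n.+1 w - Zn n w).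
    by apply/funext => w; rewrite addrA subrK.
  rewrite leNgt; apply/negP => hlt.
  have fin : normLp P p (fun w => Zn n.+1 w - Zn n w) \is a fin_num.
    by rewrite ge0_fin_numE ?normLp_ge0// (lt_trans hlt)// ltry.
  have cI : (c%:E <= \int[P]_w (modulus (Zn n.+1 w - Zn n w) `^ p)%:E)%E.
    apply: le_trans (Hc n); rewrite -[leLHS]mule1; apply: lee_wpmul2l; first by rewrite lee_fin ltW.
    by rewrite leNgt; apply/negP; exact: nY.
  move: cI; rewrite -normLp_pow// -[normLp _ _ _]fineK// poweR_EFin lee_fin leNgt => /negP; apply.
  have -> : c = (c `^ p^-1) `^ p by rewrite -powRrM mulVf// powRr1// ltW.
  apply: gt0_ltr_powR; rewrite ?nnegrE ?powR_ge0 ?fine_ge0 ?normLp_ge0//.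
  by rewrite -lte_fin fineK.
have : ((c `^ p^-1)%:E <= 0)%E.
  have cN : (N n.+1 + N n)%E @[n --> \oo] --> (0 + 0)%E.
    by apply: cvgeD => //; rewrite (_ : (fun n => N n.+1) = [sequence N (n + 1)%N]_n) ?cvg_shiftn//;
      apply/funext => n; rewrite /= addn1.
  rewrite adde0 in cN; apply: cvge_to_ge cN _; exact: nearW.
by rewrite lee_fin leNgt powR_gt0.
Qed.

(** A single n with E Y_n^q < 1 excludes w(2) >= 1, by Jensen and E Y_n = w(2)^n, and w(p) >= 1, by
    Y_n^q >= sum of |w_u|^p, whose mean is w(p)^n. *)
Lemma cvg_Lp_Z_inv : cvg_Lp P p Zn -> ~ trivial_martingale P M lambda ->
  [/\ (\int[P]_w (modulus (Zn 1%N w) `^ p)%:E < +oo)%E,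
      (wm 2 < 1)%E, (wm p < 1)%E & (\int[P]_w (Y 1 w `^ q) < +oo)%E].
Proof.
move=> cZ nt; have [Zoo _] := cZ.
have Z1 : (\int[P]_w (modulus (Zn 1%N w) `^ p)%:E < +oo)%E by apply/(normLp_lty _ p1).
have [n Yn] := cvg_Lp_quadratic_sum cZ nt.
split=> //.
- rewrite ltNge; apply/negP => w2.
  have YE : (\int[P]_w Y n w = wm 2 ^+ n)%E by exact: integral_esum_gen_weight.
  have wn : (1 <= wm 2 ^+ n)%E.
    elim: n {Yn YE} => [|n IH]; first by rewrite expe0.
    by rewrite expeS -[leLHS]mule1; apply: lee_pmul.
  (* Tangent of y^q at 1, extended to +oo; integrating it is Jensen's inequality in the form needed
     here. *)
  have tang (y : \bar R) : (0 <= y)%E -> (q%:E * y <= y `^ q + (q - 1)%:E)%E.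
    case: y => [y y0| _|//]; last by rewrite poweRyr ?gt_eqF// addye// leey.
    rewrite poweR_EFin -EFinM -EFinD lee_fin.
    have := @powR_tangent R q y 1 q1 y0 ler01.
    by rewrite !powR1 mulr1 mulrBr mulr1; lra.
  have : (q%:E <= \int[P]_w (Y n w `^ q) + (q - 1)%:E)%E.
    apply: (@le_trans _ _ (\int[P]_w (q%:E * Y n w))%E).
      rewrite ge0_integralZl//; last by rewrite lee_fin ltW.
      rewrite YE -[leLHS]mule1; apply: lee_wpmul2l => //; by rewrite lee_fin ltW.
    rewrite -[X in (_ <= _ + X)%E](integral_probability_cst P) -ge0_integralD//; last 2 first.
    - by move=> w _; exact: poweR_ge0.
    - by move=> w _; rewrite lee_fin subr_ge0.
    apply: ge0_le_integral.
    - exact: measurableT.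
    - by move=> w _; rewrite mule_ge0// lee_fin ltW.
    - exact: measurable_funeM.
    - exact: emeasurable_funD.
    - by move=> w _; exact: tang.
  have Y0' : (0 <= \int[P]_w (Y n w `^ q))%E by apply: integral_ge0 => w _; exact: poweR_ge0.
  have fY : (\int[P]_w (Y n w `^ q))%E \is a fin_num by rewrite ge0_fin_numE// (lt_trans Yn)// ltry.
  by move: Yn; rewrite -[X in (X < _)%E]fineK// -[X in (_ <= X + _)%E]fineK// lte_fin -EFinD lee_fin; lra.
- rewrite ltNge; apply/negP => wp.
  have wn : (1 <= wm p ^+ n)%E.
    elim: n {Yn} => [|n IH]; first by rewrite expe0.
    by rewrite expeS -[leLHS]mule1; apply: lee_pmul.
  move: Yn; rewrite ltNge => /negP; apply; apply: (le_trans wn).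
  rewrite -(integral_esum_gen_weight lambda HM n pn0); apply: ge0_le_integral.
  - exact: measurableT.
  - by move=> w _; apply: esum_ge0 => u _; rewrite lee_fin powR_ge0.
  - apply: measurable_fun_esum => [u w|u]; first by rewrite lee_fin powR_ge0.
    apply: measurable_powR_modulus; exact: cmeasurable_gw.
  - exact: mYq.
  - move=> w _; apply: le_trans (esum_powR_le q1 (fun u => powR_ge0 (modulus (gw n u w)) 2)).
    by apply: le_esum => u _; rewrite -powRrM twoq.
(* The moment of Y_1 is read off the increment Z_2 - Z_1, which lies in L^p. *)
have [c c0 Hc] := increment_moment_ge HM m_gt0 mreal_lty p2 (innovation_moment_lty Z1)
  (innovation_variance_gt0 Z1 nt).
have D1 : (\int[P]_w (modulus (Zn 2%N w - Zn 1%N w) `^ p)%:E < +oo)%E.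
  apply/(normLp_lty _ p1).
  have mN : cmeasurable (fun w => - Zn 1%N w).
    have := cmeasurableB (cmeasurable_cst T 0) (mZ 1%N).
    by under eq_fun do rewrite sub0r.
  have h := normLp_triangle P p1 (mZ 2%N) mN.
  by apply: (le_lt_trans h); rewrite normLpN lte_add_pinfty.
have IY0 : (0 <= \int[P]_w (Y 1 w `^ q))%E by apply: integral_ge0 => w _; exact: poweR_ge0.
have := le_lt_trans (Hc 1%N) D1.
case: (\int[P]_w (Y 1 w `^ q))%E IY0 => [x _ _|_|//]; first exact: ltry.
by rewrite gt0_muley ?lte_fin.
Qed.

End Lp_criterion.



(** * From weight moments to the conditions of the statement *)

Section moment_conditions.
Local Open Scope classical_set_scope.
Local Open Scope ring_scope.
Context d (T : measurableType d) (R : realType) (P : probability T R).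
Context (M : reproduction T R) (lambda : R[i]).
Hypothesis HM : supercritical_brw P M.
Implicit Types (u : seq nat) (w : T).
Notation gw := (gen_weight P M lambda).
Notation wm := (weight_moment P M lambda).
Local Notation Y w := (\esum_(u in setT) (modulus (gw 1 u w) `^ 2)%:E)%E.

Lemma momentE (r : R) (f : T -> R) : moment P r f = (\int[P]_w (f w `^ r)%:E)%E.
Proof. by rewrite /moment unlock. Qed.

Lemma J_ereal_esum u w :
  J_ereal M u w = (\esum_(i in setT) if has_child M u i w then 1 else 0)%E.
Proof.
have sumI k : (\esum_(i in `I_k) 1 = (k%:R)%:E :> \bar R)%E.
  rewrite esum_fset; [|exact: finite_II|by []].
  by rewrite -fsbig_ord sumEFin big_const_ord iter_addr_0.
rewrite /J_ereal /has_child; case: (J M u w) => [k|].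
  rewrite -sumI esum_mkcond; apply: eq_esum => i _.
  by have -> : (i \in `I_k) = (i < k)%N by apply/idP/idP; rewrite inE.
have le_sum k : ((k%:R)%:E <= \esum_(i in [set: nat]) (1 : \bar R))%E.
  by rewrite -sumI esum_mkcond; apply: le_esum => i _; case: ifP.
have s0 : (0 <= \esum_(i in [set: nat]) (1 : \bar R))%E by exact: esum_ge0.
case: (\esum_(i in [set: nat]) (1 : \bar R))%E s0 le_sum => [x x0 le_sum|//|//].
have := le_sum (Num.truncn x).+1; rewrite lee_fin leNgt truncnS_gt//.
Qed.

Lemma mreal0_gt1 : (1 < mreal P M 0)%E.
Proof.
have [_ _ _ h] := HM; apply: (lt_le_trans h); rewrite le_eqVlt; apply/orP; left.
apply/eqP/eq_integral => w _; rewrite J_ereal_esum esum_generation1.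
by apply: eq_esum => i _; rewrite oppr0 mul0r expR0.
Qed.

Hypothesis m_gt0 : 0 < modulus (m P M lambda).

Lemma weight_moment_ratio (r : R) : r != 0 ->
  (mreal P M (r * complex.Re lambda) / (modulus (m P M lambda) `^ r)%:E = wm r)%E.
Proof.
move=> r0; have c0 : modulus (m P M lambda) `^ r != 0 by rewrite gt_eqF// powR_gt0.
rewrite mreal_weight_moment// inver (negPf c0) muleAC -EFinM mulfV// mul1e.
by [].
Qed.

Let two0 : 2 != 0 :> R. Proof. by rewrite pnatr_eq0. Qed.

Let Y0 w : (0 <= Y w)%E.
Proof. by apply: esum_ge0 => u _; rewrite lee_fin powR_ge0. Qed.

Let mY : measurable_fun setT (fun w => Y w).
Proof.
apply: measurable_fun_esum => [u w|u]; first by rewrite lee_fin powR_ge0.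
apply: measurable_powR_modulus; exact: cmeasurable_gw.
Qed.

Let YE : (\int[P]_w Y w = wm 2)%E.
Proof. by rewrite (integral_esum_gen_weight lambda HM 1 two0) expeS expe0 mule1. Qed.

Let wm2_ge0 : (0 <= wm 2)%E.
Proof. by rewrite -YE; exact: integral_ge0. Qed.

Hypothesis wm2_lty : (wm 2 < +oo)%E.
Context (q : R).
Hypothesis q_gt0 : 0 < q.

Notation t := (2 * complex.Re lambda).
Let E1 w := (\esum_(u in generation M 1 w) (expR (- t * position M u w))%:E)%E.
Let m2 := modulus (m P M lambda) `^ 2.

Let m2_gt0 : 0 < m2. Proof. exact: powR_gt0. Qed.

(** |exp(-lambda S)|^2 = exp(-2 theta S): the quadratic sum of the first generation is the
    unnormalised sum at parameter 2 theta, up to |m(lambda)|^2. *)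
Let E1E w : E1 w = (m2%:E * Y w)%E.
Proof.
rewrite quadratic_sum1// -esumZl; last 2 first.
- by move=> i; rewrite lee_fin powR_ge0.
- exact: ltW.
rewrite /E1 esum_generation1; apply: eq_esum => i _; rewrite /child_weight.
case: ifP => _; last by rewrite modulusE/= expr0n addr0 sqrtr0 powR0// mule0.
rewrite -EFinM -powRM ?modulus_ge0// -modulusM /displacement_weight.
have mn0 : m P M lambda != 0.
  apply/eqP => mE; move: m_gt0.
  by rewrite mE modulusE/= expr0n addr0 sqrtr0 ltxx.
rewrite [_ * (_ / _)]mulrC divfK// modulus_expC -expRM.
congr (expR _)%:E; rewrite /position big_ord1/=.
by case: lambda => a b /=; ring.
Qed.

(** At a real parameter the terms are positive reals, so only the sum of positive parts survives; an
    infinite sum is read as 0 by [fine]. *)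
Let sum_expC w : sumC (generation M 1 w) (fun u => expC (- t%:C%C * (position M u w)%:C%C))
  = (fine (E1 w))%:C%C.
Proof.
have rE u : expC (- t%:C%C * (position M u w)%:C%C) = (expR (- t * position M u w))%:C%C.
  rewrite /expC.
  have -> : - t%:C%C * (position M u w)%:C%C = (- t * position M u w)%:C%C.
    by apply: complex_ext; rewrite ?complex_ReM ?complex_ImM /=; ring.
  by rewrite /= cos0 sin0 mulr1 mulr0.
rewrite (eq_sumC (g := fun u => (expR (- t * position M u w))%:C%C))//.
rewrite /sumC /sumR /=; congr Complex.
  rewrite [X in _ - fine X]esum1 ?subr0; last first.
    by move=> u _; rewrite (max_idPr _)// oppr_le0 expR_ge0.
  by congr fine; apply: eq_esum => u _; rewrite (max_idPl _)// expR_ge0.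
by rewrite oppr0 maxxx subrr.
Qed.

Let mE1 : measurable_fun setT E1.
Proof.
rewrite (_ : E1 = fun w => m2%:E * Y w)%E; first exact: measurable_funeM.
by apply/funext => w; exact: E1E.
Qed.

Let ae_Y_fin : {ae P, forall w, (Y w < +oo)%E}.
Proof. by apply: ge0_integral_lty_ae; rewrite ?YE. Qed.

Let c := fine (wm 2).

(** Because w(2) is finite the sum is almost surely finite, and the default value of [fine] does not
    affect the expectation. *)
Let m_real : m P M t%:C%C = (m2 * c)%:C%C.
Proof.
rewrite /m /expectationC unlock; under eq_fun do rewrite sum_expC.
under [X in Complex _ (fine X)]eq_integral do rewrite sum_expC.
rewrite integral0; congr Complex.
have <- : fine (m2%:E * wm 2) = m2 * c.
  by rewrite /c -[wm 2]fineK ?ge0_fin_numE.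
congr fine; rewrite -YE -ge0_integralZl//; last by rewrite lee_fin ltW.
apply: ge0_ae_eq_integral.
- exact: measurableT.
- by apply/measurable_EFinP/measurableT_comp.
- exact: measurable_funeM.
- move=> w _; rewrite lee_fin fine_ge0// E1E mule_ge0// lee_fin ltW//.
- by move=> w _; rewrite mule_ge0// lee_fin ltW.
- apply: filterS ae_Y_fin => w Yoo _; rewrite fineK E1E//.
  by rewrite ge0_fin_numE ?mule_ge0 ?lte_mul_pinfty// lee_fin ltW.
Qed.

(* Dividing by a vanishing [c] gives [0]; then the quadratic sum vanishes almost
   surely. *)
Lemma moment_quadratic_sum :
  (moment P q (fun w => complex.Re (Z P M 1 t%:C%C w)) < +oo)%E <->
  (\int[P]_w (Y w `^ q) < +oo)%E.
Proof.
have c0 : 0 <= c by exact: fine_ge0.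
have cE : wm 2 = c%:E by rewrite /c fineK// ge0_fin_numE.
have ReZ w : (Y w < +oo)%E ->
    ((complex.Re (Z P M 1 t%:C%C w)) `^ q)%:E = ((c^-1 `^ q)%:E * Y w `^ q)%E.
  move=> Yoo; rewrite /Z m_real sum_expC expr1 E1E.
  have Yfin : Y w \is a fin_num by rewrite ge0_fin_numE.
  have -> : complex.Re ((fine (m2%:E * Y w))%:C%C / (m2 * c)%:C%C) = c^-1 * fine (Y w).
    rewrite -fmorphV -rmorphM /= fineM//= invfM.
    by rewrite mulrACA mulfV ?mul1r ?gt_eqF// mulrC.
  rewrite powRM ?invr_ge0 ?fine_ge0// EFinM; congr (_ * _)%E.
  by rewrite -poweR_EFin fineK.
have -> : (moment P q (fun w => complex.Re (Z P M 1 t%:C%C w)) =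
    (c^-1 `^ q)%:E * \int[P]_w (Y w `^ q))%E.
  rewrite momentE -ge0_integralZl//; last 3 first.
  - exact: (measurableT_comp (measurable_poweR q) mY).
  - by move=> w _; exact: poweR_ge0.
  - by rewrite lee_fin powR_ge0.
  apply: ge0_ae_eq_integral.
  - exact: measurableT.
  - apply/measurable_EFinP/(measurableT_comp (measurable_powR _)).
    rewrite (_ : (fun _ => _) = fun w => (m2 * c)^-1 * fine (E1 w)).
      by apply: measurable_funM => //; exact: measurableT_comp.
    apply/funext => w; rewrite /Z m_real sum_expC expr1 -fmorphV -rmorphM /=.
    by rewrite mulrC.
  - apply: measurable_funeM; exact: (measurableT_comp (measurable_poweR q) mY).
  - by move=> w _; rewrite lee_fin powR_ge0.
  - by move=> w _; rewrite mule_ge0 ?poweR_ge0// lee_fin powR_ge0.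
  - by apply: filterS ae_Y_fin => w Yoo _; exact: ReZ.
have I0 : (0 <= \int[P]_w (Y w `^ q))%E by apply: integral_ge0 => w _; exact: poweR_ge0.
split=> [|Yq]; last by rewrite lte_mul_pinfty ?lee_fin ?powR_ge0.
have [c_eq0 _|cn0] := eqVneq c 0.
  have /(ae_eq_integral_abs P measurableT mY) Yae : (\int[P]_w `|Y w| = 0)%E.
    by under eq_integral do rewrite gee0_abs//; rewrite YE cE c_eq0.
  rewrite (ae_eq_integral (cst 0%E))//; last 2 first.
  - exact: (measurableT_comp (measurable_poweR q) mY).
  - by apply: filterS Yae => w /(_ I) -> _; rewrite poweR0r// gt_eqF.
  by rewrite integral0.
case: (\int[P]_w (Y w `^ q))%E I0 => [x _ _|_|//]; first exact: ltry.
by rewrite gt0_muley ?lte_fin// powR_gt0 ?invr_gt0// lt_neqAle eq_sym cn0.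
Qed.

End moment_conditions.



(** * The characterization and its two special forms *)

Section Lp_characterization.
Local Open Scope classical_set_scope.
Local Open Scope ring_scope.
Context d (T : measurableType d) (R : realType) (P : probability T R).
Context (M : reproduction T R) (lambda : R[i]).
Hypothesis HM : supercritical_brw P M.
Hypothesis m_gt0 : 0 < modulus (m P M lambda).
Hypothesis mreal_lty : (mreal P M (complex.Re lambda) < +oo)%E.
Hypothesis nontrivial : ~ trivial_martingale P M lambda.
Context (p : R).
Hypothesis p2 : 2 <= p.
Notation wm := (weight_moment P M lambda).

Let two0 : 2 != 0 :> R. Proof. by rewrite pnatr_eq0. Qed.

Lemma cvg_Lp_ZP : cvg_Lp P p (fun n => Z P M n lambda) <->
  [/\ (moment P p (fun w => modulus (Z P M 1 lambda w)) < +oo)%E,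
      (wm 2 < 1)%E, (wm p < 1)%E &
      (moment P (p / 2)
        (fun w => complex.Re (Z P M 1 (2 * complex.Re lambda)%:C%C w)) < +oo)%E].
Proof.
have q0 : 0 < p / 2 by rewrite divr_gt0// (lt_le_trans _ p2).
have lty : (wm 2 < 1)%E -> (wm 2 < +oo)%E by move=> /lt_trans; apply; exact: ltry.
rewrite momentE; split=> [cZ|[Z1 w2 wp]].
  have [Z1 w2 wp Y1] := cvg_Lp_Z_inv HM m_gt0 mreal_lty p2 cZ nontrivial.
  by split => //; apply/(moment_quadratic_sum HM m_gt0 (lty w2) q0).
move=> /(moment_quadratic_sum HM m_gt0 (lty w2) q0).
exact: (cvg_Lp_Z HM m_gt0 mreal_lty p2 Z1 w2 wp).
Qed.

Lemma moment1_lty : (wm 2 < 1)%E ->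
  (moment P 1 (fun w => complex.Re (Z P M 1 (2 * complex.Re lambda)%:C%C w)) < +oo)%E.
Proof.
move=> w2; have lty : (wm 2 < +oo)%E by apply: lt_trans w2 _; exact: ltry.
apply/(moment_quadratic_sum HM m_gt0 lty ltr01).
have := integral_esum_gen_weight lambda HM 1 two0; rewrite expeS expe0 mule1 => E.
rewrite -E in lty; apply: le_lt_trans lty; rewrite le_eqVlt; apply/orP; left.
apply/eqP/eq_integral => w _; rewrite poweRe1//.
by apply: esum_ge0 => u _; rewrite lee_fin powR_ge0.
Qed.

Lemma weight_moment_lt1 : complex.Re lambda = 0 -> (wm 2 < 1)%E -> (wm p < 1)%E.
Proof.
move=> l0 w2; have p0 : p != 0 by rewrite gt_eqF// (lt_le_trans _ p2).
move: mreal_lty; rewrite l0 => M_lty.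
have ratio (r : R) : r != 0 -> (wm r = mreal P M 0 * ((modulus (m P M lambda) `^ r)^-1)%:E)%E.
  move=> r0; rewrite -(weight_moment_ratio HM m_gt0 r0) l0 mulr0 inver.
  by rewrite gt_eqF ?powR_gt0.
have M1 := mreal0_gt1 HM.
move: w2; rewrite !ratio//.
have : mreal P M 0 \is a fin_num by rewrite ge0_fin_numE// ltW// (lt_trans _ M1).
move=> /fineK E; move: M1; rewrite -E; move: (fine _) => x.
rewrite -!EFinM !lte_fin => x1 h.
have m2_gt0 : 0 < modulus (m P M lambda) `^ 2 by exact: powR_gt0.
have xm : x < modulus (m P M lambda) `^ 2 by rewrite ltr_pdivrMr// mul1r in h.
(* x is the mean number of children: it exceeds 1 and, by the assumption on w(2), lies below
   |m(lambda)|^2. *)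
have m1 : 1 <= modulus (m P M lambda).
  rewrite leNgt; apply/negP => m1.
  have : modulus (m P M lambda) `^ 2 <= 1 `^ 2.
    by apply: ge0_ler_powR; rewrite ?nnegrE ?ltW.
  by rewrite powR1 leNgt (lt_trans x1).
by rewrite ltr_pdivrMr ?powR_gt0// mul1r (lt_le_trans xm)// ler_powR.
Qed.

End Lp_characterization.

Theorem theorem3p7 (R : realType) (d : measure_display) (T : measurableType d)
    (P : probability T R) (M : reproduction T R) (HM : supercritical_brw P M)
    (p theta gamma : R) (lambda : R[i])
    (Hp : 2 <= p) (Hgamma : gamma != 0) (Hlambda : lambda = Complex theta gamma)
    (Hm0 : 0 < modulus (m P M lambda))
    (Hm1 : ((modulus (m P M lambda))%:E < mreal P M theta)%E)
    (Hm2 : (mreal P M theta < +oo)%E)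
    (Hnontrivial : ~ trivial_martingale P M lambda) :
  (theta != 0 ->
     cvg_Lp P p (fun n => Z P M n lambda) <->
     [/\ (moment P p (fun w => modulus (Z P M 1 lambda w)) < +oo)%E,
         (Order.max
            (mreal P M (2 * theta) / ((modulus (m P M lambda)) ^+ 2)%:E)
            (mreal P M (p * theta) / ((modulus (m P M lambda)) `^ p)%:E)
          < 1)%E &
         2 < p ->
         (moment P (p / 2) (fun w => complex.Re (Z P M 1 (2 * theta)%:C%C w))
          < +oo)%E])
  /\
  (theta = 0 ->
     cvg_Lp P p (fun n => Z P M n lambda) <->
     [/\ (moment P p (fun w => modulus (Z P M 1 lambda w)) < +oo)%E,
         (moment P (p / 2) (fun w => complex.Re (Z P M 1 0%:C%C w)) < +oo)%E &
         (mreal P M 0 / ((modulus (m P M lambda)) ^+ 2)%:E < 1)%E]).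
Proof.
have Rel : complex.Re lambda = theta by rewrite Hlambda.
have m_lty : (mreal P M (complex.Re lambda) < +oo)%E by rewrite Rel.
have p0 : p != 0 by rewrite gt_eqF// (lt_le_trans _ Hp).
have two0 : 2 != 0 :> R by rewrite pnatr_eq0.
have sqrE : (modulus (m P M lambda)) ^+ 2 = (modulus (m P M lambda)) `^ 2.
  by rewrite powR_mulrn// ltW.
have ratio (r : R) := @weight_moment_ratio _ _ _ P M lambda HM Hm0 r.
have iffZ := cvg_Lp_ZP HM Hm0 m_lty Hnontrivial Hp.
split=> [_|theta0].
  rewrite -Rel sqrE [X in Order.max X _](ratio 2 two0) [X in Order.max _ X](ratio p p0) gt_max; split.
    by move=> /iffZ[Z1 w2 wp mom]; split; [exact: Z1|apply/andP; split; [exact: w2|exact: wp]|move=> _; exact: mom].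
  move=> [Z1 /andP[w2 wp] mom]; apply/iffZ; split; [exact: Z1|exact: w2|exact: wp|].
  (* For p = 2 the statement provides no moment condition; it is recovered from w(2) < 1, the
     exponent being 1. *)
  have [/mom//|p_le2] := ltP 2 p.
  have -> : p = 2 by apply/eqP; rewrite eq_le p_le2 Hp.
  rewrite (divff two0); exact: (moment1_lty HM Hm0 w2).
have E0 : 2 * complex.Re lambda = 0 by rewrite Rel theta0 mulr0.
rewrite sqrE -{2}E0 (ratio 2 two0); rewrite E0 in iffZ; split.
  by move=> /iffZ[Z1 w2 _ mom]; split; [exact: Z1|exact: mom|exact: w2].
move=> [Z1 mom w2]; apply/iffZ; split; [exact: Z1|exact: w2| |exact: mom].
exact: (weight_moment_lt1 HM Hm0 m_lty Hp (etrans Rel theta0) w2).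
Qed.
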